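(* Let $R$ be a computable integral domain that admits master polynomials. Then (i) the set $IMDR_R\cap H_R$ is $\Pi^0_2$-complete, and (ii) the sets $PR_R\cap H_R$, $PR_R$, $IPR_R\cap H_R$ and $IPR_R$ are $\Pi^0_2$-complete. In fact, all of these sets are $\Pi^0_2$-universal.
   Context: A computable integral domain is a countably infinite integral domain $R$ with a bijection $\phi:R\to\mathbb{N}$ making addition and multiplication computable; $K$ denotes its field of fractions (computable as well). Polynomials over $R$ are coded by natural numbers via $\phi$. Lightface classes: $A\subseteq\mathbb{N}$ is $\Sigma^0_1$ if $n\in A\iff\exists m\,(n,m)\in B$ for a computable $B$; $\Pi^0_n$ = complements of $\Sigma^0_n$; $\Sigma^0_n=\exists\Pi^0_{n-1}$. $A$ is $\Pi^0_2$-complete if $A\in\Pi^0_2$ and $A\notin\Sigma^0_2$; $\Pi^0_2$-universal if every $\Pi^0_2$ subset of $\mathbb{N}$ is computably reducible to $A$. Master polynomials: Let $S\subseteq\mathbb{N}\times\mathbb{Z}$ be $\Sigma^0_1$. A triple $(p,f,g)$ with $p\in R[x,y,z_1,\dots,z_k]$, $g:K\to\mathbb{Z}$ computable with $g(0)=0$ and $g|_{K^\times}$ a surjective homomorphism $(K^\times,\cdot)\to(\mathbb{Z},+)$, and $f:\mathbb{N}\to R$ computable, is an additive master polynomial for $S$ if for all $m,n$: $S(m,n)$ holds iff for every $b\in K$ with $g(b)=n$ the polynomial $p(f(m),b,z_1,\dots,z_k)$ has a root with $z_1,\dots,z_k\in K^\times$; and $S(m,n)$ fails iff for every $b\in K$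 with $g(b)=n$, $p(f(m),b,z_1,\dots,z_k)$ has no root in $K^k$. A multiplicative master polynomial is defined the same way with $S\subseteq\mathbb{N}\times\mathbb{Q}$ and $g|_{K^\times}$ a surjective homomorphism $(K^\times,\cdot)\to(\mathbb{Q}^\times,\cdot)$. $R$ admits master polynomials if either every $\Sigma^0_1$ set $S\subseteq\mathbb{N}\times\mathbb{Z}$ has an additive master polynomial, or every $\Sigma^0_1$ set $S\subseteq\mathbb{N}\times\mathbb{Q}$ has a multiplicative master polynomial. $d^*_\times$: upper Banach density in $(R\setminus\{0\},\cdot)$, i.e. $d^*_\times(A)=\sup_{\mathcal F}\limsup_n|A\cap F_n|/|F_n|$ over Følner sequences $(F_n)$ of $(R\setminus\{0\},\cdot)$. $H_R$: homogeneous polynomials over $R$. $IMDR_R$: polynomials $p$ over $R$ such that every $B\subseteq R$ with $d^*_\times(B)>0$ contains an injective root of $p$ (a root with pairwise distinct coordinates, all in $B$). $PR_R$ ($IPR_R$): polynomials $p$ such that for every $\ell$ and every partition $R\setminus\{0\}=C_1\cup\dots\cup C_\ell$, some cell contains a (an injective) root of $p$. *)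

(* Defs.v *)
From Stdlib Require Cantor.
From mathcomp Require Import all_boot all_order all_algebra.
From mathcomp Require Import finmap fraction mpoly.
From mathcomp Require Import boolp classical_sets reals ereal topology.
From mathcomp Require Import normedtype sequences.

Set Implicit Arguments.
Unset Strict Implicit.
Unset Printing Implicit Defensive.

Import Order.TTheory GRing.Theory Num.Theory.
Import numFieldNormedType.Exports.

Local Open Scope classical_set_scope.
Local Open Scope ring_scope.

(* Partial recursive functions, presented as the unary functions generated by
   zero, successor, the projections of the Cantor pairing, pairing,
   composition, primitive recursion and minimization. Functions of several
   arguments are unary functions of a Cantor pair. *)

Definition pairN (x y : nat) : nat := Cantor.to_nat (x, y).

Inductive code : Type :=
| Zero | Succ | Fst | Snd
| Pair of code & code
| Comp of code & code
| Prec of code & code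
| Mu of code.

(* [eval c n v]: the program [c] halts on input [n] with output [v]. In the
   last clause, [w] witnesses that [c] halts with a positive value on every
   argument below the minimum. *)
Inductive eval : code -> nat -> nat -> Prop :=
| eval_Zero n : eval Zero n 0
| eval_Succ n : eval Succ n n.+1
| eval_Fst n : eval Fst n (Cantor.of_nat n).1
| eval_Snd n : eval Snd n (Cantor.of_nat n).2
| eval_Pair c d n x y :
    eval c n x -> eval d n y -> eval (Pair c d) n (pairN x y)
| eval_Comp c d n x y :
    eval d n x -> eval c x y -> eval (Comp c d) n y
| eval_Prec0 c d a x :
    eval c a x -> eval (Prec c d) (pairN a 0) x
| eval_PrecS c d a k x y :
    eval (Prec c d) (pairN a k) x -> eval d (pairN a (pairN k x)) y ->
    eval (Prec c d) (pairN a k.+1) y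
| eval_Mu c a k (w : nat -> nat) :
    eval c (pairN a k) 0 ->
    (forall j, (j < k)%N -> eval c (pairN a j) (w j).+1) ->
    eval (Mu c) a k.

Definition computable (f : nat -> nat) : Prop :=
  exists c : code, forall n, eval c n (f n).

Definition computable2 (f : nat -> nat -> nat) : Prop :=
  computable (fun x => f (Cantor.of_nat x).1 (Cantor.of_nat x).2).

Definition computable_set (A : set nat) : Prop :=
  exists2 chi : nat -> bool,
    computable (fun n => nat_of_bool (chi n)) & forall n, A n <-> chi n.

Definition Sigma1 (A : set nat) : Prop :=
  exists2 B : set nat, computable_set B &
    forall n, A n <-> exists m, B (pairN n m).

Definition Pi1 (A : set nat) : Prop := Sigma1 (~` A).

Definition Sigma2 (A : set nat) : Prop :=
  exists2 B : set nat, Pi1 B & forall n, A n <-> exists m, B (pairN n m).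

Definition Pi2 (A : set nat) : Prop := Sigma2 (~` A).

Definition Pi2_complete (A : set nat) : Prop := Pi2 A /\ ~ Sigma2 A.

Definition computably_reducible (A B : set nat) : Prop :=
  exists2 f : nat -> nat, computable f & forall n, A n <-> B (f n).

Definition Pi2_universal (A : set nat) : Prop :=
  forall B : set nat, Pi2 B -> computably_reducible B A.

Definition code_int (z : int) : nat :=
  match z with Posz n => n.*2 | Negz n => n.*2.+1 end.

Definition code_rat (q : rat) : nat :=
  pairN (code_int (numq q)) (code_int (denq q)).

Definition Sigma1_rel (T : Type) (enc : T -> nat) (S : nat -> T -> Prop) :
    Prop :=
  exists2 A : set nat, Sigma1 A & forall m t, S m t <-> A (pairN m (enc t)).

Record computable_idomain (R : idomainType) : Type := ComputableIdomain {
  phi : R -> nat;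
  phi_inv : nat -> R;
  phiK : cancel phi phi_inv;
  phi_invK : cancel phi_inv phi;
  phi_add : computable2 (fun m n => phi (phi_inv m + phi_inv n));
  phi_mul : computable2 (fun m n => phi (phi_inv m * phi_inv n))
}.

(* A natural number [c] is read, through the bijection [CodeSeq.decode] between
   numbers and finite sequences of numbers, as [:: n; t_1; ...; t_r], and each
   [t_j] as [:: a; e_1; ...; e_n]; it stands for the polynomial in [n] variables
   that is the sum over [j] of [phi_inv a * X_1^e_1 ... X_n^e_n]. Missing
   entries are read as the number 0 and excess ones are ignored, so that every
   number codes a polynomial. *)
Definition code_nvars (c : nat) : nat := head 0%N (CodeSeq.decode c).

Definition mpoly_of_code (R : idomainType) (C : computable_idomain R)
    (c : nat) : {mpoly R[code_nvars c]} :=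
  \sum_(t <- behead (CodeSeq.decode c))
    let u := CodeSeq.decode t in
    phi_inv C (head 0%N u) *:
      'X_[[multinom nth 0%N (behead u) i | i < code_nvars c]].

Definition code_set (R : idomainType) (C : computable_idomain R)
    (P : forall n, {mpoly R[n]} -> Prop) : set nat :=
  [set c | P (code_nvars c) (mpoly_of_code C c)].

(* Elements of the fraction field are given to an algorithm by the [phi]-codes of
   a numerator and a nonzero denominator. *)
Definition computable_frac (R : idomainType) (C : computable_idomain R)
    (T : Type) (enc : T -> nat) (g : {fraction R} -> T) : Prop :=
  exists2 h : nat -> nat -> nat, computable2 h &
    forall a b : R, b != 0 ->
      h (phi C a) (phi C b) = enc (g (tofrac a / tofrac b)).

Definition additive_valuation (K : fieldType) (g : K -> int) : Prop :=
  [/\ g 0 = 0,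
      forall a b, a != 0 -> b != 0 -> g (a * b) = g a + g b &
      forall z, exists2 b, b != 0 & g b = z].

Definition multiplicative_valuation (K : fieldType) (g : K -> rat) : Prop :=
  [/\ g 0 = 0,
      forall a, a != 0 -> g a != 0,
      forall a b, a != 0 -> b != 0 -> g (a * b) = g a * g b &
      forall q, q != 0 -> exists2 b, b != 0 & g b = q].

Definition frac_root (R : idomainType) (k : nat) (p : {mpoly R[k.+2]})
    (x y : {fraction R}) (z : k.-tuple {fraction R}) : Prop :=
  (map_mpoly (@tofrac R) p).@[tnth [tuple of [:: x, y & z]]] = 0.

Definition master_equivalence (R : idomainType) (T : Type)
    (S : nat -> T -> Prop) (k : nat) (p : {mpoly R[k.+2]})
    (f : nat -> R) (g : {fraction R} -> T) : Prop :=
  forall (m : nat) (n : T),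
    (S m n <-> forall b, g b = n ->
       exists2 z : k.-tuple {fraction R},
         (forall i, tnth z i != 0) & frac_root p (tofrac (f m)) b z) /\
    (~ S m n <-> forall b, g b = n ->
       ~ exists z : k.-tuple {fraction R}, frac_root p (tofrac (f m)) b z).

Definition additive_master (R : idomainType) (C : computable_idomain R)
    (S : nat -> int -> Prop) (k : nat) (p : {mpoly R[k.+2]})
    (f : nat -> R) (g : {fraction R} -> int) : Prop :=
  [/\ computable (fun n => phi C (f n)),
      computable_frac C code_int g,
      additive_valuation g &
      master_equivalence S p f g].

Definition multiplicative_master (R : idomainType) (C : computable_idomain R)
    (S : nat -> rat -> Prop) (k : nat) (p : {mpoly R[k.+2]})
    (f : nat -> R) (g : {fraction R} -> rat) : Prop :=
  [/\ computable (fun n => phi C (f n)),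
      computable_frac C code_rat g,
      multiplicative_valuation g &
      master_equivalence S p f g].

Definition admits_master_polynomials (R : idomainType)
    (C : computable_idomain R) : Prop :=
  (forall S : nat -> int -> Prop, Sigma1_rel code_int S ->
     exists (k : nat) (p : {mpoly R[k.+2]}) f g, additive_master C S p f g) \/
  (forall S : nat -> rat -> Prop, Sigma1_rel code_rat S ->
     exists (k : nat) (p : {mpoly R[k.+2]}) f g,
       multiplicative_master C S p f g).

Definition symdiff (R : choiceType) (A B : {fset R}) : {fset R} :=
  ((A `\` B) `|` (B `\` A))%fset.

(* [F n] is a nonempty finite subset of [R \ {0}], and [r * F n] is
   asymptotically equal to [F n] for every nonzero [r]. *)
Definition folner (Rr : realType) (R : idomainType) (F : nat -> {fset R}) :
    Prop :=
  [/\ forall n, F n != fset0,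
      forall n, 0 \notin F n &
      forall r : R, r != 0 ->
        (fun n => #|` symdiff [fset r * x | x in F n]%fset (F n)|%:R
                  / #|` F n|%:R : Rr) @ \oo --> (0 : Rr)].

Definition upper_banach_density (Rr : realType) (R : idomainType)
    (A : set R) : \bar Rr :=
  ereal_sup
    [set limn_esup (fun n =>
       (#|` [fset x in F n | x \in A]%fset|%:R / #|` F n|%:R)%:E)
    | F in [set F : nat -> {fset R} | folner Rr F]].

Definition has_root_in (R : idomainType) (n : nat) (p : {mpoly R[n]})
    (B : set R) : Prop :=
  exists2 v : 'I_n -> R, (forall i, B (v i)) & p.@[v] = 0.

Definition has_injective_root_in (R : idomainType) (n : nat)
    (p : {mpoly R[n]}) (B : set R) : Prop :=
  exists v : 'I_n -> R, [/\ injective v, forall i, B (v i) & p.@[v] = 0].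

Definition homogeneous (R : idomainType) (n : nat) (p : {mpoly R[n]}) : Prop :=
  exists d : nat, p \is d.-homog.

Definition IMDR (Rr : realType) (R : idomainType) (n : nat)
    (p : {mpoly R[n]}) : Prop :=
  forall B : set R, (0 < upper_banach_density Rr B)%E ->
    has_injective_root_in p B.

Definition nonzero_partition (R : idomainType) (l : nat)
    (P : 'I_l -> set R) : Prop :=
  \bigcup_i P i = [set x | x != 0] /\ trivIset setT P.

Definition PR (R : idomainType) (n : nat) (p : {mpoly R[n]}) : Prop :=
  forall (l : nat) (P : 'I_l -> set R), nonzero_partition P ->
    exists i, has_root_in p (P i).

Definition IPR (R : idomainType) (n : nat) (p : {mpoly R[n]}) : Prop :=
  forall (l : nat) (P : 'I_l -> set R), nonzero_partition P ->
    exists i, has_injective_root_in p (P i).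

Definition mpolyI (R : idomainType) (P Q : forall n, {mpoly R[n]} -> Prop)
    (n : nat) (p : {mpoly R[n]}) : Prop := P n p /\ Q n p.

(* Main.v *)
From Stdlib Require Cantor.
From mathcomp Require Import all_boot all_order all_algebra generic_quotient.
From mathcomp Require Import finmap fraction mpoly zify ring lra.
From mathcomp Require Import boolp classical_sets reals ereal topology.
From mathcomp Require Import normedtype sequences.
Require Import Defs.

(* Upper bounds. By compactness (along a free ultrafilter on the indices), [p]
   is (injectively) partition regular iff for every [l] there is a finite set
   all of whose [l]-colourings have a monochromatic (injective) root. For
   homogeneous [p], membership in [IMDR] is equivalent to: for every [e] there
   is a finite set all of whose subsets of density at least [1 / e] have an
   injective root.
   One direction averages dilates of the finite set over a Folner sequence; for
   the other one, dilates of bad subsets of Folner sets converge to a finitely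
   additive measure on the sets without roots, and a Fatou argument extracts a
   set of positive upper Banach density.

   Lower bounds. Given [A] in [Pi2], say
     [m \in A <-> forall x, exists y, chi m x y],
   take a master polynomial [p] for the set [S] of the [(m, q)] such that [q] is
   not neutral and [forall x <= code of q, exists y, chi m x y]. Let [m] be
   mapped to the homogenized equation
     [p (f m, x / y, (u_1 - v_1) / D, ..., (u_k - v_k) / D) = 0]
   with [D = w - t] for injective roots and [D = w] for the other ones. If [m]
   is not in [A], colour by the values of [g] so that [x] and [y] of the same
   colour have [g (x / y)] neutral or of large code: then [S m (g (x / y))] fails.
   If [m] is in [A], any [x] and [y] with [g (x / y)] not neutral give nonzero
   [z_j = a_j / d] with [p (f m, x / y, z) = 0]. In a multiplicatively dense
   set, a pigeonhole argument for additive translates provides [w - t = d * r]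
   and [u_j - v_j = a_j * r]. For a partition, the Brauer-type theorem
   [finite_brauer] provides [w = d * r] and [u_j - v_j = a_j * r] in one cell,
   and a dilation avoids the cells where [g (x / y)] is always neutral.

   [Pi2] sets that are not [Sigma2] come from diagonalization, so universality
   implies completeness. *)

Set Implicit Arguments.
Unset Strict Implicit.
Unset Printing Implicit Defensive.

Import Order.TTheory GRing.Theory Num.Theory numFieldNormedType.Exports.

(** * Computable functions *)

(** Encodings found by type class resolution let [recursive] be stated for functions between
    products, lists and Booleans, and be proved by following the syntax of the function. *)
Class rep (T : Type) := repr : T -> nat.

#[global] Instance rep_nat : rep nat := id.
#[global] Instance rep_bool : rep bool := nat_of_bool.
#[global] Instance rep_seq : rep (seq nat) := CodeSeq.code.
#[global] Instance rep_prod (T U : Type) (rT : rep T) (rU : rep U) :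
  rep (T * U) := fun p => pairN (repr p.1) (repr p.2).

Definition recursive (T U : Type) {rT : rep T} {rU : rep U} (f : T -> U) :=
  exists2 g : nat -> nat, computable g & forall x, g (repr x) = repr (f x).

Lemma of_pairN x y : Cantor.of_nat (pairN x y) = (x, y).
Proof. exact: Cantor.cancel_of_to. Qed.

Lemma pairN_of x : pairN (Cantor.of_nat x).1 (Cantor.of_nat x).2 = x.
Proof. by rewrite /pairN -surjective_pairing Cantor.cancel_to_of. Qed.

Lemma eq_computable f g : f =1 g -> computable f -> computable g.
Proof. by move=> fg [c Hc]; exists c => n; rewrite -fg. Qed.

Lemma computable_id : computable id.
Proof.
exists (Pair Fst Snd) => n.
by have := eval_Pair (eval_Fst n) (eval_Snd n); rewrite pairN_of.
Qed.

Lemma computable_comp f g :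
  computable f -> computable g -> computable (f \o g).
Proof.
by move=> [c Hc] [d Hd]; exists (Comp c d) => n; apply: eval_Comp (Hd n) (Hc _).
Qed.

Lemma computable_pair f g :
  computable f -> computable g -> computable (fun n => pairN (f n) (g n)).
Proof.
by move=> [c Hc] [d Hd]; exists (Pair c d) => n; apply: eval_Pair.
Qed.

Lemma computable_const k : computable (fun=> k).
Proof.
elim: k => [|k [c Hc]]; first by exists Zero => n; constructor.
by exists (Comp Succ c) => n; apply: eval_Comp (Hc n) _; constructor.
Qed.

Lemma computable_iteri (n a : nat -> nat) (s : nat -> nat) :
  computable n -> computable a -> computable s ->
  computable (fun x =>
    iteri (n x) (fun k y => s (pairN x (pairN k y))) (a x)).
Proof.
move=> cn [ca Ha] [cs Hs].
have [c Hc] : computable (fun x => pairN x (n x)).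
  exact: (computable_pair computable_id cn).
exists (Comp (Prec ca cs) c) => x; apply: eval_Comp (Hc x) _.
elim: (n x) => [|k IH] /=; first exact: eval_Prec0.
exact: eval_PrecS IH _.
Qed.

Section RecursiveFunctions.
Context {T U V A : Type} {rT : rep T} {rU : rep U} {rV : rep V} {rA : rep A}.

Lemma rec_id : recursive (fun x : T => x).
Proof. by exists id => //; exact: computable_id. Qed.

Lemma rec_const (u : U) : recursive (fun _ : T => u).
Proof. by exists (fun=> repr u) => //; exact: computable_const. Qed.

Lemma rec_comp (f : U -> V) (g : T -> U) :
  recursive f -> recursive g -> recursive (fun x => f (g x)).
Proof.
move=> [f' cf Hf] [g' cg Hg]; exists (f' \o g'); first exact: computable_comp.
by move=> x /=; rewrite Hg Hf.
Qed.

Lemma rec_fst (f : T -> U * V) : recursive f -> recursive (fun x => (f x).1).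
Proof.
move=> [f' cf Hf]; exists ((fun n => (Cantor.of_nat n).1) \o f').
  by apply: computable_comp => //; exists Fst => n; constructor.
by move=> x /=; rewrite Hf of_pairN.
Qed.

Lemma rec_snd (f : T -> U * V) : recursive f -> recursive (fun x => (f x).2).
Proof.
move=> [f' cf Hf]; exists ((fun n => (Cantor.of_nat n).2) \o f').
  by apply: computable_comp => //; exists Snd => n; constructor.
by move=> x /=; rewrite Hf of_pairN.
Qed.

Lemma rec_pair (f : T -> U) (g : T -> V) :
  recursive f -> recursive g -> recursive (fun x => (f x, g x)).
Proof.
move=> [f' cf Hf] [g' cg Hg]; exists (fun n => pairN (f' n) (g' n)).
  exact: computable_pair.
by move=> x; rewrite Hf Hg.
Qed.

Lemma eq_rec (f g : T -> U) : f =1 g -> recursive f -> recursive g.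
Proof. by move=> fg [f' cf Hf]; exists f' => // x; rewrite Hf fg. Qed.

Lemma rec_succ (f : T -> nat) : recursive f -> recursive (fun x => (f x).+1).
Proof.
move=> [f' cf Hf]; exists (succn \o f'); last by move=> x /=; rewrite Hf.
by apply: computable_comp => //; exists Succ => n; constructor.
Qed.

Lemma rec_iteri (n : T -> nat) (s : T -> nat -> A -> A) (a : T -> A) :
  recursive n -> recursive (fun p : T * (nat * A) => s p.1 p.2.1 p.2.2) ->
  recursive a -> recursive (fun x => iteri (n x) (s x) (a x)).
Proof.
move=> [n' cn Hn] [s' cs Hs] [a' ca Ha].
exists (fun x => iteri (n' x) (fun k y => s' (pairN x (pairN k y))) (a' x)).
  exact: computable_iteri.
move=> x; rewrite Ha Hn /repr /rep_nat /=.
elim: (n x) => //= k ->; exact: (Hs (x, (k, _))).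
Qed.

End RecursiveFunctions.

Lemma rec_comp2 {T U V W : Type} {rT : rep T} {rU : rep U} {rV : rep V}
    {rW : rep W} (F : U -> V -> W) (f : T -> U) (g : T -> V) :
  recursive (fun p : U * V => F p.1 p.2) ->
  recursive f -> recursive g -> recursive (fun x => F (f x) (g x)).
Proof. move=> rF rf rg; exact: (rec_comp rF (rec_pair rf rg)). Qed.

Lemma rec_iter {T A : Type} {rT : rep T} {rA : rep A} (n : T -> nat) (s : T ->
  A -> A) (a : T -> A) :
  recursive n -> recursive (fun p : T * A => s p.1 p.2) ->
  recursive a -> recursive (fun x => iter (n x) (s x) (a x)).
Proof.
move=> rn rs ra.
apply: (eq_rec (f := fun x => iteri (n x) (fun=> s x) (a x))).
  by move=> x; elim: (n x) => //= k ->.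
apply: rec_iteri => //; apply: (rec_comp2 (F := s)) => //.
  exact: rec_fst rec_id.
exact: (rec_snd (rec_snd rec_id)).
Qed.


(** An empty hook, redefined below: each batch of closure lemmas extends [rec_tac] through the hook
    left by the previous one. *)
Ltac rec_arith := fail.

Ltac rec_step :=
  match goal with
  | H : recursive ?f |- recursive ?f => exact H
  | H : recursive ?f |- recursive (fun x => ?f (@?g x)) =>
      apply: (rec_comp (g := g) H)
  | H : recursive (fun p => ?f p.1 p.2) |-
      recursive (fun x => ?f (@?g x) (@?h x)) =>
      apply: (rec_comp2 (F := f) (f := g) (g := h) H)
  | |- recursive (fun x => ?c) => exact: rec_const
  | |- recursive (fun x => x) => exact: rec_id
  | |- recursive fst => exact: (rec_fst rec_id)
  | |- recursive snd => exact: (rec_snd rec_id)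
  | |- recursive (fun x => @fst _ _ (@?f x)) => apply: (rec_fst (f := f))
  | |- recursive (fun x => @snd _ _ (@?f x)) => apply: (rec_snd (f := f))
  | |- recursive (fun x => (@?f x, @?g x)) =>
      apply: (rec_pair (f := f) (g := g))
  | |- recursive (fun x => (@?f x).+1) => apply: (rec_succ (f := f))
  | |- recursive (fun x => iter (@?n x) (@?s x) (@?a x)) =>
      apply: (rec_iter (n := n) (s := s) (a := a))
  | |- recursive (fun x => iteri (@?n x) (@?s x) (@?a x)) =>
      apply: (rec_iteri (n := n) (s := s) (a := a))
  | |- _ => rec_arith
  end.
Ltac rec_tac := cbv beta; repeat (rec_step; cbv beta).

(** * Arithmetic, Boolean operations and bounded quantifiers *)

Lemma rec_addn {T : Type} {rT : rep T} (f g : T -> nat) :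
  recursive f -> recursive g -> recursive (fun x => f x + g x).
Proof.
apply: rec_comp2.
apply: (eq_rec (f := fun p => iter p.2 succn p.1)).
  by move=> p; elim: p.2 => [|n IH] /=; rewrite ?addn0 ?addnS ?IH.
by rec_tac.
Qed.

Lemma rec_muln {T : Type} {rT : rep T} (f g : T -> nat) :
  recursive f -> recursive g -> recursive (fun x => f x * g x).
Proof.
apply: rec_comp2.
apply: (eq_rec (f := fun p => iter p.2 (fun z => p.1 + z) 0)).
  by move=> p; elim: p.2 => [|n IH] /=; rewrite ?muln0 ?mulnS ?IH.
by rec_tac; apply: rec_addn; rec_tac.
Qed.

Lemma rec_expn {T : Type} {rT : rep T} (f g : T -> nat) :
  recursive f -> recursive g -> recursive (fun x => f x ^ g x).
Proof.
apply: rec_comp2.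
apply: (eq_rec (f := fun p => iter p.2 (fun z => p.1 * z) 1)).
  by move=> p; elim: p.2 => [|n IH] /=; rewrite ?expn0 ?expnS ?IH.
by rec_tac; apply: rec_muln; rec_tac.
Qed.

Lemma rec_pred {T : Type} {rT : rep T} (f : T -> nat) : recursive f ->
  recursive (fun x => (f x).-1).
Proof.
apply: (rec_comp (f := predn)).
apply: (eq_rec (f := fun p => iteri p (fun k _ => k) 0)); first by case.
by rec_tac.
Qed.

Lemma rec_subn {T : Type} {rT : rep T} (f g : T -> nat) :
  recursive f -> recursive g -> recursive (fun x => f x - g x).
Proof.
apply: rec_comp2.
apply: (eq_rec (f := fun p => iter p.2 predn p.1)).
  by move=> p; elim: p.2 => [|n IH] /=; rewrite ?subn0 ?subnS ?IH.
by rec_tac; apply: rec_pred; rec_tac.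
Qed.

(** A conditional is an iteration run at most once, the test being read as the number of rounds. *)
Lemma rec_if {T : Type} {rT : rep T} {A : Type} {rA : rep A} (b : T ->
  bool) (f g : T -> A) :
  recursive b -> recursive f -> recursive g ->
  recursive (fun x => if b x then f x else g x).
Proof.
move=> [b' cb Hb] rf rg.
apply: (eq_rec (f := fun x => iter (b x : nat) (fun=> f x) (g x))).
  by move=> x; case: (b x).
have rb : recursive (fun x => b x : nat) by exists b'.
by rec_tac; apply: rec_comp; rec_tac.
Qed.

Lemma rec_eqn0 {T : Type} {rT : rep T} (f : T -> nat) : recursive f ->
  recursive (fun x => f x == 0).
Proof.
apply: (rec_comp (f := fun n => n == 0)).
apply: (eq_rec (f := fun n => iter n (fun=> false) true)); first by case.
by rec_tac.
Qed.

Ltac rec_bool := fail.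
Ltac rec_arith ::=
  match goal with
  | |- recursive (fun x => (@?f x + @?g x)%N) => apply: (rec_addn (f :=
    f) (g := g))
  | |- recursive (fun x => (@?f x * @?g x)%N) => apply: (rec_muln (f :=
    f) (g := g))
  | |- recursive (fun x => (@?f x - @?g x)%N) => apply: (rec_subn (f :=
    f) (g := g))
  | |- recursive (fun x => (@?f x ^ @?g x)%N) => apply: (rec_expn (f :=
    f) (g := g))
  | |- recursive (fun x => (@?f x).-1) => apply: (rec_pred (f := f))
  | |- recursive (fun x => if _ then _ else _) => apply: rec_if
  | |- recursive (fun x => (@?f x) == 0) => apply: (rec_eqn0 (f := f))
  | |- _ => rec_bool
  end.

Lemma rec_leq {T : Type} {rT : rep T} (f g : T -> nat) :
  recursive f -> recursive g -> recursive (fun x => f x <= g x).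
Proof. by move=> rf rg; rewrite /leq; rec_tac. Qed.

Lemma rec_negb {T : Type} {rT : rep T} (f : T -> bool) : recursive f ->
  recursive (fun x => ~~ f x).
Proof. by move=> rf; rewrite /negb; rec_tac. Qed.

Lemma rec_andb {T : Type} {rT : rep T} (f g : T -> bool) :
  recursive f -> recursive g -> recursive (fun x => f x && g x).
Proof. by move=> rf rg; rewrite /andb; rec_tac. Qed.

Lemma rec_orb {T : Type} {rT : rep T} (f g : T -> bool) :
  recursive f -> recursive g -> recursive (fun x => f x || g x).
Proof. by move=> rf rg; rewrite /orb; rec_tac. Qed.

Lemma rec_implyb {T : Type} {rT : rep T} (f g : T -> bool) :
  recursive f -> recursive g -> recursive (fun x => f x ==> g x).
Proof. by move=> rf rg; rewrite /implb; rec_tac. Qed.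

Lemma rec_eqn {T : Type} {rT : rep T} (f g : T -> nat) :
  recursive f -> recursive g -> recursive (fun x => f x == g x).
Proof.
move=> rf rg.
apply: (eq_rec (f := fun x => (f x <= g x) && (g x <= f x))).
  by move=> x; rewrite eqn_leq.
by apply: rec_andb; apply: rec_leq.
Qed.

Lemma rec_nat_of_bool {T : Type} {rT : rep T} (f : T -> bool) :
  recursive f -> recursive (fun x => f x : nat).
Proof. by case=> f' ? ?; exists f'. Qed.

Lemma rec_has_iota {T : Type} {rT : rep T} (P : T -> nat -> bool) (n : T ->
  nat) :
  recursive (fun p : T * nat => P p.1 p.2) -> recursive n ->
  recursive (fun x => has (P x) (iota 0 (n x))).
Proof.
move=> rP rn.
apply: (eq_rec (f := fun x => iteri (n x) (fun k b => P x k || b) false)).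
  move=> x; elim: (n x) => // k IH; rewrite -[in RHS]addn1 iotaD has_cat -IH /=.
  by rewrite orbF orbC.
by rec_tac; apply: rec_orb; rec_tac.
Qed.

Lemma rec_all_iota {T : Type} {rT : rep T} (P : T -> nat -> bool) (n : T ->
  nat) :
  recursive (fun p : T * nat => P p.1 p.2) -> recursive n ->
  recursive (fun x => all (P x) (iota 0 (n x))).
Proof.
move=> rP rn.
apply: (eq_rec (f := fun x => iteri (n x) (fun k b => P x k && b) true)).
  move=> x; elim: (n x) => // k IH; rewrite -[in RHS]addn1 iotaD all_cat -IH /=.
  by rewrite andbT andbC.
by rec_tac; apply: rec_andb; rec_tac.
Qed.

Lemma rec_count_iota {T : Type} {rT : rep T} (P : T -> nat -> bool) (n : T ->
  nat) :
  recursive (fun p : T * nat => P p.1 p.2) -> recursive n ->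
  recursive (fun x => count (P x) (iota 0 (n x))).
Proof.
move=> rP rn.
apply: (eq_rec (f := fun x => iteri (n x) (fun k b => P x k + b) 0)).
  move=> x; elim: (n x) => // k IH;
    rewrite -[in RHS]addn1 iotaD count_cat -IH /=.
  by rewrite addn0 addnC.
by rec_tac; apply: rec_nat_of_bool; rec_tac.
Qed.

Ltac rec_div := fail.
Ltac rec_bool ::=
  match goal with
  | |- recursive (fun x => (@?f x <= @?g x)%N) => apply: (rec_leq (f :=
    f) (g := g))
  | |- recursive (fun x => ~~ @?f x) => apply: (rec_negb (f := f))
  | |- recursive (fun x => nat_of_bool (@?f x)) =>
    apply: (rec_nat_of_bool (f := f))
  | |- recursive (fun x => @?f x && @?g x) => apply: (rec_andb (f := f) (g :=
    g))
  | |- recursive (fun x => @?f x || @?g x) => apply: (rec_orb (f := f) (g := g))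
  | |- recursive (fun x => @?f x ==> @?g x) => apply: (rec_implyb (f :=
    f) (g := g))
  | |- recursive (fun x => has (@?P x) (iota 0 (@?n x))) =>
      apply: (rec_has_iota (P := P) (n := n))
  | |- recursive (fun x => all (@?P x) (iota 0 (@?n x))) =>
      apply: (rec_all_iota (P := P) (n := n))
  | |- recursive (fun x => count (@?P x) (iota 0 (@?n x))) =>
      apply: (rec_count_iota (P := P) (n := n))
  | |- recursive (fun x => @eq_op _ (@?f x) (@?g x)) => apply: (rec_eqn (f :=
    f) (g := g))
  | |- _ => rec_div
  end.

(** * Division, and lists of numbers *)

Lemma count_iota_lt m n : count (fun i => i < m) (iota 0 n) = minn m n.
Proof.
elim: n => [|n IH]; first by rewrite minn0.
rewrite -addn1 iotaD count_cat IH /= addn0 addn1.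
by case: (ltnP n m) => h; lia.
Qed.

Lemma rec_divn {T : Type} {rT : rep T} (f g : T -> nat) :
  recursive f -> recursive g -> recursive (fun x => f x %/ g x).
Proof.
move=> rf rg.
apply: (eq_rec (f := fun x => if g x == 0 then 0 else
  count (fun i => i.+1 * g x <= f x) (iota 0 (f x)))); last by rec_tac.
move=> x; case: eqP => [->|/eqP]; first by rewrite divn0.
rewrite -lt0n => g0.
under eq_count => i do rewrite -leq_divRL //.
by rewrite count_iota_lt; apply/minn_idPl/leq_div.
Qed.

Lemma rec_modn {T : Type} {rT : rep T} (f g : T -> nat) :
  recursive f -> recursive g -> recursive (fun x => f x %% g x).
Proof.
move=> rf rg; have rd := rec_divn rf rg.
apply: (eq_rec (f := fun x => f x - (f x %/ g x) * g x)); last by rec_tac.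
by move=> x; rewrite [in X in X - _](divn_eq (f x) (g x)) addKn.
Qed.

Lemma rec_dvdn {T : Type} {rT : rep T} (f g : T -> nat) :
  recursive f -> recursive g -> recursive (fun x => f x %| g x).
Proof. by move=> rf rg; rewrite /dvdn; have rd := rec_modn rg rf; rec_tac. Qed.

(** [CodeSeq.code (n :: s)] is [2 ^ n] times an odd number, so the head is a 2-adic valuation, found
    by counting the positive powers of 2 that divide the code. The empty list has code 0, where the
    count is 0, the default of [head]. *)
Lemma rec_head {T : Type} {rT : rep T} (f : T -> seq nat) :
  recursive f -> recursive (fun x => head 0 (f x)).
Proof.
apply: (rec_comp (f := head 0)).
pose h (c : nat) := count (fun i => 2 ^ i.+1 %| c) (iota 0 c).
have [g cg Hg] : recursive h.
  rewrite /h; rec_tac.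
  by apply: (rec_dvdn (f := fun p : nat * nat => 2 ^ p.2.+1)); rec_tac.
exists g => // s; rewrite Hg /repr /rep_nat /rep_seq /h.
case: s => [|n s] //=; set m := (CodeSeq.code s).*2.+1.
have modd : odd m by rewrite /m /= odd_double.
have E i : (2 ^ i.+1 %| 2 ^ n * m) = (i < n).
  case: (leqP i.+1 n) => le_in.
    by rewrite -(subnK le_in) expnD -mulnA dvdn_mull // dvdn_mulr.
  apply/negP => /(dvdn_trans (@dvdn_exp2l 2 n.+1 i.+1 le_in)).
  rewrite expnSr dvdn_pmul2l ?expn_gt0 // => d2.
  by move: d2; rewrite dvdn2 modd.
under eq_count => i do rewrite E.
rewrite count_iota_lt; apply/minn_idPl.
by apply: leq_trans (ltnW (ltn_expl n (isT : 1 < 2))) _; rewrite leq_pmulr.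
Qed.

Lemma rec_behead {T : Type} {rT : rep T} (f : T -> seq nat) :
  recursive f -> recursive (fun x => behead (f x)).
Proof.
apply: (rec_comp (f := behead)).
have [h ch Hh] := rec_head (rec_id (T := seq nat)).
have rh : recursive h by exists h.
have [g cg Hg] : recursive (fun c => (c %/ 2 ^ h c).-1 %/ 2).
  by apply: rec_divn; rec_tac; apply: rec_divn; rec_tac.
exists g => // s.
have -> : g (repr s) = (repr s %/ 2 ^ h (repr s)).-1 %/ 2 := Hg (repr s).
rewrite (Hh s).
rewrite /repr /rep_nat /rep_seq.
case: s => [|n s] //=.
by rewrite mulKn ?expn_gt0 //= divn2 doubleK.
Qed.

Lemma rec_cons {T : Type} {rT : rep T} (f : T -> nat) (g : T -> seq nat) :
  recursive f -> recursive g -> recursive (fun x => f x :: g x).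
Proof.
apply: rec_comp2.
have [h ch Hh] : recursive (fun p : nat * nat =>
  2 ^ p.1 * (2 * p.2).+1) by rec_tac.
exists h => // -[n s]; rewrite [LHS](Hh (n, CodeSeq.code s)).
by rewrite /repr /rep_nat /= mul2n.
Qed.

Lemma rec_decode {T : Type} {rT : rep T} (f : T -> nat) :
  recursive f -> recursive (fun x => CodeSeq.decode (f x)).
Proof.
by case=> g cg Hg; exists g => // x; rewrite Hg [RHS]CodeSeq.decodeK.
Qed.

Lemma rec_code {T : Type} {rT : rep T} (f : T -> seq nat) :
  recursive f -> recursive (fun x => CodeSeq.code (f x)).
Proof. by case=> g cg Hg; exists g => // x; rewrite Hg. Qed.

Lemma rec_pairN {T : Type} {rT : rep T} (f g : T -> nat) :
  recursive f -> recursive g -> recursive (fun x => pairN (f x) (g x)).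
Proof.
move=> rf rg; have [h ch Hh] := rec_pair rf rg.
by exists h => // x; rewrite Hh.
Qed.

Lemma rec_of_nat {T : Type} {rT : rep T} (f : T -> nat) :
  recursive f -> recursive (fun x => Cantor.of_nat (f x)).
Proof.
by case=> g cg Hg; exists g => // x; rewrite Hg [RHS]pairN_of.
Qed.

Lemma rec_nilp {T : Type} {rT : rep T} (f : T -> seq nat) :
  recursive f -> recursive (fun x => nilp (f x)).
Proof.
move=> rf; have rc := rec_code rf.
apply: (eq_rec (f := fun x => CodeSeq.code (f x) == 0)); last by rec_tac.
move=> x; case: (f x) => //= n s.
by rewrite muln_eq0 expn_eq0.
Qed.

Ltac rec_list := fail.
Ltac rec_div ::=
  match goal with
  | |- recursive (fun x => (@?f x %/ @?g x)%N) => apply: (rec_divn (f :=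
    f) (g := g))
  | |- recursive (fun x => (@?f x %% @?g x)%N) => apply: (rec_modn (f :=
    f) (g := g))
  | |- recursive (fun x => (@?f x %| @?g x)%N) => apply: (rec_dvdn (f :=
    f) (g := g))
  | |- recursive (fun x => head 0 (@?f x)) => apply: (rec_head (f := f))
  | |- recursive (fun x => behead (@?f x)) => apply: (rec_behead (f := f))
  | |- recursive (fun x => @?f x :: @?g x) => apply: (rec_cons (f := f) (g :=
    g))
  | |- recursive (fun x => CodeSeq.decode (@?f x)) => apply: (rec_decode (f :=
    f))
  | |- recursive (fun x => CodeSeq.code (@?f x)) => apply: (rec_code (f := f))
  | |- recursive (fun x => nilp (@?f x)) => apply: (rec_nilp (f := f))
  | |- recursive (fun x => pairN (@?f x) (@?g x)) => apply: (rec_pairN (f :=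
    f) (g := g))
  | |- recursive (fun x => Cantor.of_nat (@?f x)) => apply: (rec_of_nat (f :=
    f))
  | |- _ => rec_list
  end.

Lemma size_code s : size s <= CodeSeq.code s.
Proof.
elim: s => //= n s IH; apply: leq_trans (leq_pmull _ _);
  last by rewrite expn_gt0.
by lia.
Qed.

Lemma rec_foldl {T A : Type} {rT : rep T} {rA : rep A}
    (s : T -> A -> nat -> A) (a : T -> A) (l : T -> seq nat) :
  recursive (fun p : T * (A * nat) => s p.1 p.2.1 p.2.2) ->
  recursive a -> recursive l ->
  recursive (fun x => foldl (s x) (a x) (l x)).
Proof.
move=> rs ra rl.
pose step x (st : A * seq nat) := if nilp st.2 then st
  else (s x st.1 (head 0 st.2), behead st.2).
apply: (eq_rec (f := fun x =>
    (iter (CodeSeq.code (l x)) (step x) (a x, l x)).1)).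
  move=> x; move: (size_code (l x)); move: (CodeSeq.code _) => n.
  elim: n (l x) (a x) => [|n IH] [|y t] b //= le_n; rewrite -iterS iterSr.
    by rewrite {2}/step /= IH.
  by rewrite {2}/step /= IH.
rec_tac; rewrite /step; rec_tac.
have rs' : recursive (fun p : T * (A * nat) => (fun u : T * (A * nat) =>
  s u.1 u.2.1 u.2.2) p).
  exact: rs.
by apply: (rec_comp (g := fun p : T * (A * seq nat) =>
  (p.1, (p.2.1, head 0 p.2.2))) rs'); rec_tac.
Qed.

Lemma rec_has {T : Type} {rT : rep T} (P : T -> nat -> bool) (l : T ->
  seq nat) :
  recursive (fun p : T * nat => P p.1 p.2) -> recursive l ->
  recursive (fun x => has (P x) (l x)).
Proof.
move=> rP rl.
apply: (eq_rec (f := fun x => foldl (fun b y => b || P x y) false (l x))).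
  move=> x; rewrite -[RHS]orFb; elim: (l x) false => [|y s IH] b /=.
    by rewrite orbF.
  by rewrite IH orbA.
by apply: rec_foldl; rec_tac.
Qed.

Lemma rec_drop {T : Type} {rT : rep T} (n : T -> nat) (l : T -> seq nat) :
  recursive n -> recursive l -> recursive (fun x => drop (n x) (l x)).
Proof.
move=> rn rl.
apply: (eq_rec (f := fun x => iter (n x) behead (l x))); last by rec_tac.
move=> x; elim: (n x) (l x) => [|k IH] [|y s]; rewrite ?drop0 //.
  by rewrite iterSr IH.
by rewrite iterSr IH.
Qed.

Lemma rec_nth {T : Type} {rT : rep T} (n : T -> nat) (l : T -> seq nat) :
  recursive n -> recursive l -> recursive (fun x => nth 0 (l x) (n x)).
Proof.
move=> rn rl; have rd := rec_drop rn rl.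
apply: (eq_rec (f := fun x => head 0 (drop (n x) (l x)))); last by rec_tac.
by move=> x; rewrite -nth0 nth_drop addn0.
Qed.

Lemma rec_size {T : Type} {rT : rep T} (l : T -> seq nat) :
  recursive l -> recursive (fun x => size (l x)).
Proof.
move=> rl; apply: (eq_rec (f := fun x => foldl (fun n _ => n.+1) 0 (l x))).
  move=> x; rewrite -[RHS]addn0; elim: (l x) 0 => //= _ s IH k.
  by rewrite IH addnS.
by apply: rec_foldl; rec_tac.
Qed.

Lemma rec_mem {T : Type} {rT : rep T} (f : T -> nat) (l : T -> seq nat) :
  recursive f -> recursive l -> recursive (fun x => f x \in l x).
Proof.
move=> rf rl; apply: (eq_rec (f := fun x => has (fun y => y == f x) (l x))).
  by move=> x; apply/hasP/idP => [[y ? /eqP <-]|] //; exists (f x).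
by apply: rec_has; rec_tac.
Qed.

Ltac rec_local := fail.
Ltac rec_list ::=
  match goal with
  | |- recursive (fun x => drop (@?n x) (@?l x)) => apply: (rec_drop (n :=
    n) (l := l))
  | |- recursive (fun x => nth 0 (@?l x) (@?n x)) => apply: (rec_nth (n :=
    n) (l := l))
  | |- recursive (fun x => size (@?l x)) => apply: (rec_size (l := l))
  | |- recursive (fun x => foldl (@?s x) (@?a x) (@?l x)) =>
      apply: (rec_foldl (s := s) (a := a) (l := l))
  | |- recursive (fun x => (@?f x) \in (@?l x)) => apply: (rec_mem (f :=
    f) (l := l))
  | |- recursive (fun x => has (@?P x) (@?l x)) => apply: (rec_has (P :=
    P) (l := l))
  | |- _ => rec_local
  end.

(** * Quantifier normal forms over recursive predicates *)

Lemma recursive_computable {A : Type} {rA : rep A} (f : nat -> A) :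
  recursive f -> computable (fun n => repr (f n)).
Proof. by case=> g cg Hg; apply: eq_computable cg => n; rewrite -Hg. Qed.

Lemma computable_recursive (f : nat -> nat) : computable f -> recursive f.
Proof. by move=> cf; exists f. Qed.

Lemma computable2_recursive (f : nat -> nat -> nat) :
  computable2 f -> recursive (fun p : nat * nat => f p.1 p.2).
Proof.
move=> cf; exists (fun x => f (Cantor.of_nat x).1 (Cantor.of_nat x).2) => //.
by move=> x; rewrite of_pairN.
Qed.

Lemma Sigma1P A : Sigma1 A <-> exists2 chi : nat -> nat -> bool,
  recursive (fun p : nat * nat => chi p.1 p.2) &
  forall n, A n <-> exists m, chi n m.
Proof.
split=> [[B [chi cchi Bchi] AB]|[chi rchi Achi]].
  exists (fun n m => chi (pairN n m)).
    have [g cg Hg] : recursive (fun x => chi x) by exists (fun n => chi n :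
      nat).
    have rchi : recursive (fun x => chi x) by exists g.
    by rec_tac.
  by move=> n; rewrite AB; split=> -[m /Bchi]; exists m => //; exact/Bchi.
exists (fun x => is_true (chi (Cantor.of_nat x).1 (Cantor.of_nat x).2)).
  exists (fun x => chi (Cantor.of_nat x).1 (Cantor.of_nat x).2) => //.
  have : recursive (fun x => chi (Cantor.of_nat x).1 (Cantor.of_nat x).2).
    by rec_tac.
  by move/recursive_computable.
by move=> n; rewrite Achi; split=> -[m Hm]; exists m; rewrite of_pairN in Hm *.
Qed.

Lemma Sigma2P A : Sigma2 A <-> exists2 chi : nat -> nat -> nat -> bool,
  recursive (fun p : nat * nat * nat => chi p.1.1 p.1.2 p.2) &
  forall n, A n <-> exists m, forall k, chi n m k.
Proof.
split=> [[B /Sigma1P[chi rchi Bchi] AB]|[chi rchi Achi]].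
  exists (fun n m k => ~~ chi (pairN n m) k); first by rec_tac.
  move=> n; rewrite AB; split=> -[m Hm]; exists m.
    by move=> k; apply/negP => Hk; case: ((Bchi _).2 (ex_intro _ k Hk)).
  by apply/not_notP => /Bchi [k]; apply/negP.
exists (fun x => forall k, chi (Cantor.of_nat x).1 (Cantor.of_nat x).2 k).
  apply/Sigma1P; exists (fun x k =>
    ~~ chi (Cantor.of_nat x).1 (Cantor.of_nat x).2 k).
    rec_tac.
    have r' : recursive (fun p : nat * nat * nat => (fun u =>
      chi u.1.1 u.1.2 u.2) p).
      exact: rchi.
    apply: (rec_comp (g := fun p : nat * nat =>
      ((Cantor.of_nat p.1).1, (Cantor.of_nat p.1).2, p.2)) r').
    by rec_tac.
  move=> x; split.
    by move/existsNP => [k /negP]; exists k.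
  by case=> k /negP nk; apply/existsNP; exists k.
by move=> n; rewrite Achi; split=> -[m Hm]; exists m => k; have := Hm k;
   rewrite of_pairN.
Qed.

Lemma Pi2P A : Pi2 A <-> exists2 chi : nat -> nat -> nat -> bool,
  recursive (fun p : nat * nat * nat => chi p.1.1 p.1.2 p.2) &
  forall n, A n <-> forall m, exists k, chi n m k.
Proof.
split=> [/Sigma2P[chi rchi Achi]|[chi rchi Achi]].
  exists (fun n m k => ~~ chi n m k); first by rec_tac.
  move=> n; split=> [An m|H].
    apply: contrapT => /forallNP Hm; have [_ H] := Achi n.
    by apply: (H _ An); exists m => k; apply/negPn/negP/Hm.
  by apply: contrapT => /Achi [m Hm]; have [k /negP] := H m.
apply/Sigma2P; exists (fun n m k => ~~ chi n m k); first by rec_tac.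
move=> n; split=> [nA|[m Hm]].
  apply: contrapT => /forallNP H; apply: nA; apply/Achi => m.
  by have /existsNP[k /negP/negPn] := H m; exists k.
by move/Achi => /(_ m) [k]; apply/negP.
Qed.

(** * A universal [Sigma1] predicate *)

Section UniversalPredicate.

Local Arguments pairN : simpl never.

Fixpoint code_nat (c : code) : nat :=
  match c with
  | Zero => pairN 0 0
  | Succ => pairN 1 0
  | Fst => pairN 2 0
  | Snd => pairN 3 0
  | Pair c d => pairN 4 (pairN (code_nat c) (code_nat d))
  | Comp c d => pairN 5 (pairN (code_nat c) (code_nat d))
  | Prec c d => pairN 6 (pairN (code_nat c) (code_nat d))
  | Mu c => pairN 7 (code_nat c)
  end.

(** The number of the assertion [eval c n v], where [e] is the number of [c]. *)
Definition fact (e n v : nat) : nat := pairN e (pairN n v).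

Local Notation "x ..1" := ((Cantor.of_nat x).1) (at level 2, format "x ..1").
Local Notation "x ..2" := ((Cantor.of_nat x).2) (at level 2, format "x ..2").

Lemma of_pairN1 x y : (pairN x y)..1 = x.
Proof. by rewrite of_pairN. Qed.

Lemma of_pairN2 x y : (pairN x y)..2 = y.
Proof. by rewrite of_pairN. Qed.

Let pairNE := (of_pairN1, of_pairN2).

(** One disjunct per constructor of [code]. Intermediate values are searched below [CodeSeq.code s]
    only, so that the predicate is decidable; nothing is lost, since by [fact_bound] every value
    asserted in [s] is smaller. *)
Definition justified (e n v : nat) (s : seq nat) : bool :=
  let tag := e..1 in let a := e..2..1 in let b := e..2..2 in
  let bound := CodeSeq.code s in
  [|| (tag == 0) && (v == 0),
      (tag == 1) && (v == n.+1),
      (tag == 2) && (v == n..1),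
      (tag == 3) && (v == n..2),
      (tag == 4) && ((fact a n v..1 \in s) && (fact b n v..2 \in s)),
      (tag == 5) &&
        has (fun x => (fact b n x \in s) && (fact a x v \in s)) (iota 0 bound),
      (tag == 6) && (if n..2 == 0 then fact a n..1 v \in s else
        has (fun x => (fact e (pairN n..1 n..2.-1) x \in s) &&
                      (fact b (pairN n..1 (pairN n..2.-1 x)) v \in s))
            (iota 0 bound)) |
      (tag == 7) && ((fact e..2 (pairN n v) 0 \in s) &&
        all (fun j => has (fun w => fact e..2 (pairN n j) w.+1 \in s)
                          (iota 0 bound)) (iota 0 v))].

(* A derivation of [eval] is coded by a list of facts, each of which follows by
   one rule from the facts after it. *)
Definition derivation (s : seq nat) : bool :=
  all (fun i => let t := nth 0 s i in
        justified t..1 t..2..1 t..2..2 (drop i.+1 s)) (iota 0 (size s)).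

Lemma derivation_cons t s :
  derivation (t :: s) = justified t..1 t..2..1 t..2..2 s && derivation s.
Proof.
rewrite /derivation /= drop0 -[1]/(1 + 0) iotaDl all_map.
by congr (_ && _); apply: eq_all.
Qed.

Lemma pairN_ge2 x y : y <= pairN x y.
Proof. by have := Cantor.to_nat_non_decreasing x y; rewrite /pairN; lia. Qed.

Lemma fact_bound e n v s : fact e n v \in s -> v < CodeSeq.code s.
Proof.
move=> /(allP (CodeSeq.ltn_code s)); apply: leq_ltn_trans.
exact: leq_trans (pairN_ge2 n v) (pairN_ge2 e _).
Qed.

Lemma derivation_sound s : derivation s ->
  forall c n v, fact (code_nat c) n v \in s -> eval c n v.
Proof.
elim: s => // t s IH; rewrite derivation_cons => /andP[jt /IH {}IH] c n v.
rewrite inE => /orP[/eqP tE|]; last exact: IH.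
move: jt; rewrite -tE /fact !pairNE /justified.
case: c {tE} => [||||c d|c d|c d|c]; cbn [code_nat]; rewrite !pairNE /= ?orbF.
- by move/eqP->; constructor.
- by move/eqP->; constructor.
- by move/eqP->; constructor.
- by move/eqP->; constructor.
- move=> /andP[/IH Hc /IH Hd]; rewrite -(pairN_of v).
  exact: eval_Pair.
- by case/hasP=> x _ /andP[/IH Hd /IH Hc]; apply: eval_Comp Hd Hc.
- case: eqP => [n0 /IH Hc|/eqP n0].
    by rewrite -(pairN_of n) n0; apply: eval_Prec0.
  case/hasP=> x _ /andP[]; rewrite -/(code_nat (Prec c d)) => /IH H /IH Hd.
  by rewrite -(pairN_of n) -(prednK (n := n..2)) ?lt0n //;
    apply: eval_PrecS H Hd.
- case/andP=> /IH H0 /allP Hj.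
  have {}Hj j : exists w, j < v -> eval c (pairN n j) w.+1.
    case: (ltnP j v) => jv; last by exists 0.
    have /hasP[w _ /IH Hw] := Hj j ltac:(by rewrite mem_iota).
    by exists w.
  have [w Hw] := choice Hj.
  exact: eval_Mu H0 Hw.
Qed.

Lemma justified_sub e n v (s s' : seq nat) : {subset s <= s'} ->
  justified e n v s -> justified e n v s'.
Proof.
move=> ss'; rewrite /justified.
have hs (P P' : pred nat) : (forall x, P x -> P' x /\ x < CodeSeq.code s') ->
    has P (iota 0 (CodeSeq.code s)) -> has P' (iota 0 (CodeSeq.code s')).
  move=> PP /hasP[x _ /PP[Px lx]]; apply/hasP; exists x => //.
  by rewrite mem_iota.
do 4 (case/orP => [->|]; rewrite ?orbT //).
case/orP => [/and3P[-> /ss' -> /ss' ->]|]; rewrite ?orbT //.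
case/orP => [/andP[-> H]|].
  rewrite (hs _ _ _ H) ?orbT // => x /andP[/ss' h1 /ss' ->]; split=> //.
    by rewrite h1.
  exact: fact_bound h1.
case/orP => [/andP[-> H]|].
  suff -> : (if n..2 == 0 then fact (e..2)..1 n..1 v \in s' else
     has (fun x => (fact e (pairN n..1 n..2.-1) x \in s') &&
       (fact (e..2)..2 (pairN n..1 (pairN n..2.-1 x)) v \in s'))
       (iota 0 (CodeSeq.code s'))) by rewrite !orbT.
  case: eqP H => _; first exact: ss'.
  apply: hs => x /andP[/ss' h1 /ss' ->]; split=> //.
    by rewrite h1.
  exact: fact_bound h1.
case/and3P => -> /ss' -> /allP H.
suff -> : all (fun j => has (fun w => fact e..2 (pairN n j) w.+1 \in s')
     (iota 0 (CodeSeq.code s'))) (iota 0 v) by rewrite !orbT.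
apply/allP => j /H; apply: hs => x /ss' h1; split=> //.
exact: ltnW (fact_bound h1).
Qed.

Lemma derivation_cat s s' :
  derivation s -> derivation s' -> derivation (s ++ s').
Proof.
elim: s => // t s IH; rewrite cat_cons !derivation_cons => /andP[jt ds] ds'.
rewrite IH // andbT; apply: justified_sub jt => x xs.
by rewrite mem_cat xs.
Qed.

Lemma derivation_complete c n v : eval c n v ->
  exists2 s, derivation s & fact (code_nat c) n v \in s.
Proof.
have add e m u s : derivation s -> justified e m u s ->
    exists2 s, derivation s & fact e m u \in s.
  move=> ds js; exists (fact e m u :: s); rewrite ?mem_head //.
  by rewrite derivation_cons /fact !pairNE js.
have nat_iota k s e m : fact e m k \in s -> k \in iota 0 (CodeSeq.code s).
  by move=> /fact_bound; rewrite mem_iota.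
elim=> {c n v}.
- by move=> n; apply: (add _ _ _ [::]) => //; rewrite /justified;
  cbn [code_nat]; rewrite !pairNE.
- by move=> n; apply: (add _ _ _ [::]) => //; rewrite /justified;
  cbn [code_nat]; rewrite !pairNE /= eqxx.
- by move=> n; apply: (add _ _ _ [::]) => //; rewrite /justified;
  cbn [code_nat]; rewrite !pairNE /= eqxx.
- by move=> n; apply: (add _ _ _ [::]) => //; rewrite /justified;
  cbn [code_nat]; rewrite !pairNE /= eqxx.
- move=> c d n x y _ [s ds Hs] _ [s' ds' Hs'].
  apply: (add _ _ _ (s ++ s')); first exact: derivation_cat.
  by rewrite /justified; cbn [code_nat];
    rewrite !pairNE /= !mem_cat Hs Hs' !orbT.
- move=> c d n x y _ [s ds Hs] _ [s' ds' Hs'].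
  apply: (add _ _ _ (s ++ s')); first exact: derivation_cat.
  rewrite /justified; cbn [code_nat]; rewrite !pairNE /= orbF; apply/hasP;
    exists x.
    by apply: (nat_iota _ _ (code_nat d) n); rewrite mem_cat Hs.
  by rewrite !mem_cat Hs Hs' !orbT.
- move=> c d a x _ [s ds Hs]; apply: (add _ _ _ s) => //.
  by rewrite /justified; cbn [code_nat]; rewrite !pairNE orbF.
- move=> c d a k x y _ [s ds Hs] _ [s' ds' Hs'].
  apply: (add _ _ _ (s ++ s')); first exact: derivation_cat.
  rewrite /justified; cbn [code_nat]; rewrite !pairNE /= orbF; apply/hasP;
    exists x.
    by apply: (nat_iota _ _ (code_nat (Prec c d)) (pairN a k));
      rewrite mem_cat Hs.
  by rewrite !mem_cat Hs Hs' !orbT.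
- move=> c a k w _ [s ds Hs] _ IH.
  (* The minimization rule has one premise for each [j < k]; their derivations are concatenated by
     induction on [k]. *)
  have [s' ds' Hs'] : exists2 s', derivation s' & forall j, j < k ->
      fact (code_nat c) (pairN a j) (w j).+1 \in s'.
    elim: k {Hs} IH => [|k IHk] IH; first by exists [::].
    have [|s1 d1 H1] := IHk; first by move=> j jk; apply: IH; apply: ltnW.
    have [s2 d2 H2] := IH k (ltnSn k).
    exists (s1 ++ s2); first exact: derivation_cat.
    move=> j; rewrite ltnS leq_eqVlt mem_cat => /orP[/eqP->|/H1->] //.
    by rewrite H2 orbT.
  apply: (add _ _ _ (s ++ s')); first exact: derivation_cat.
  rewrite /justified; cbn [code_nat]; rewrite !pairNE /= mem_cat Hs /=.
  apply/allP => j; rewrite mem_iota => /= jk; apply/hasP; exists (w j).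
    have := fact_bound (Hs' _ jk); rewrite mem_iota /= add0n => lt_w.
    apply: ltnW; apply: (@fact_bound (code_nat c) (pairN a j)).
    by rewrite mem_cat Hs' ?orbT.
  by rewrite mem_cat Hs' ?orbT.
Qed.

Lemma rec_fact {T : Type} {rT : rep T} (e n v : T -> nat) :
  recursive e -> recursive n -> recursive v ->
  recursive (fun x => fact (e x) (n x) (v x)).
Proof. by rewrite /fact => *; rec_tac. Qed.

Ltac rec_local ::=
  match goal with
  | |- recursive (fun x => fact (@?e x) (@?n x) (@?v x)) =>
     apply: (rec_fact (e := e) (n := n) (v := v))
  end.

Lemma rec_derivation : recursive derivation.
Proof.
rewrite /derivation /justified; cbv zeta.
by rec_tac.
Qed.

(** Determinism turns a derivation with output 1 into the truth of the characteristic function in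
    [universal_Sigma1P]. *)
Lemma eval_inj c n v v' : eval c n v -> eval c n v' -> v = v'.
Proof.
move=> ev; elim: ev v' => {c n v}.
- by move=> n v' ev; inversion ev.
- by move=> n v' ev; inversion ev.
- by move=> n v' ev; inversion ev.
- by move=> n v' ev; inversion ev.
- by move=> c d n x y _ IHc _ IHd v' ev; inversion ev; subst;
     rewrite (IHc x0) // (IHd y0).
- move=> c d n x y _ IHd _ IHc v' ev; inversion ev; subst.
  by apply: IHc; rewrite (IHd x0).
- move=> c d a x _ IH v'; move En: (pairN a 0) => n ev.
  inversion ev as [| | | | | |c' d' a' x' H E1 E2|c' d' a' k' x' y' H Hd E1 E2|].
    by move: E2; rewrite -En => /Cantor.to_nat_inj[E]; apply: IH; rewrite -E.
  by move: E2; rewrite -En => /Cantor.to_nat_inj.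
- move=> c d a k x y _ IHk _ IHd v'; move En: (pairN a k.+1) => n ev.
  inversion ev as [| | | | | |c' d' a' x' H E1 E2|c' d' a' k' x' y' H Hd E1 E2|].
    by move: E2; rewrite -En => /Cantor.to_nat_inj.
  move: E2; rewrite -En => /Cantor.to_nat_inj[Ea Ek]; apply: IHd.
  by rewrite (IHk x') -?Ea -?Ek.
- move=> c a k w _ IH0 _ IHw v' ev;
  inversion ev as [| | | | | | | |c0 a0 k0 w' H0 Hw]; subst.
  case: (ltngtP k v') => // h.
    by have := IH0 _ (Hw _ h).
  by have := IHw _ h _ H0.
Qed.

(** [m] packs a witness of the existential quantifier together with the code of a derivation showing
    that program number [e] outputs 1 on the pair of [n] and this witness. *)
Definition universal_Sigma1 (e n m : nat) : bool :=
  let s := CodeSeq.decode m..2 in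
  derivation s && (fact e (pairN n m..1) 1 \in s).

Lemma universal_Sigma1P A : Sigma1 A ->
  exists e, forall n, A n <-> exists m, universal_Sigma1 e n m.
Proof.
case=> B [chi [c Hc] Bchi] AB; exists (code_nat c) => n; rewrite AB; split.
  case=> m /Bchi Hm; have := Hc (pairN n m); rewrite Hm.
  case/derivation_complete => s ds Hs; exists (pairN m (CodeSeq.code s)).
  by rewrite /universal_Sigma1 of_pairN /= CodeSeq.codeK ds.
case=> m /andP[/derivation_sound H /H ev]; exists m..1; apply/Bchi.
by have := eval_inj ev (Hc _); case: (chi _).
Qed.

Lemma rec_universal_Sigma1 :
  recursive (fun p : nat * nat * nat => universal_Sigma1 p.1.1 p.1.2 p.2).
Proof.
by rewrite /universal_Sigma1; cbv zeta; have rd := rec_derivation; rec_tac.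
Qed.

(** [A n] says that the [Sigma1] set of index [n] contains all pairs with first component [n]. If
    [A] were the projection of a [Pi1] set [B], and [e] an index of the complement of [B], then
    [A e] would be equivalent to its own negation. *)
Lemma Pi2_not_Sigma2 : exists2 A, Pi2 A & ~ Sigma2 A.
Proof.
have ru := rec_universal_Sigma1.
pose A n := forall m, exists k, universal_Sigma1 n (pairN n m) k.
exists A.
  apply/Pi2P; exists (fun n m k => universal_Sigma1 n (pairN n m) k) => //.
  apply: (rec_comp (g := fun p : nat * nat * nat =>
    (p.1.1, pairN p.1.1 p.1.2, p.2)) ru).
  by rec_tac.
case=> B /universal_Sigma1P[e Be] /(_ e)[AB BA].
have nA : ~ A e.
  by move=> Ae; have [m Bm] := AB Ae; exact: ((Be _).2 (Ae m) Bm).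
by apply: (nA) => m; apply/Be => Bm; apply: nA; apply: BA; exists m.
Qed.

Lemma Sigma2_reducible A B : computably_reducible A B -> Sigma2 B -> Sigma2 A.
Proof.
case=> f /computable_recursive rf AB /Sigma2P[chi rchi Bchi].
apply/Sigma2P; exists (fun n m k => chi (f n) m k); last by move=> n;
  rewrite AB.
by apply: (rec_comp (g := fun p : nat * nat * nat =>
  (f p.1.1, p.1.2, p.2)) rchi);
   rec_tac.
Qed.

Lemma Pi2_universal_complete A : Pi2 A -> Pi2_universal A -> Pi2_complete A.
Proof.
move=> PA UA; split=> // SA; have [B PB] := Pi2_not_Sigma2; apply.
exact: Sigma2_reducible (UA _ PB) SA.
Qed.

End UniversalPredicate.

(** * Recurrence and partition regularity of linear equations *)

Section FiniteSets.
Local Open Scope fset_scope.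

Lemma card_fset_count (T : choiceType) (A : {fset T}) (P : pred T) :
  #|` [fset x in A | P x]| = \sum_(x <- A) P x.
Proof.
transitivity (count P A); last by rewrite -sum1_count big_mkcond.
rewrite -size_filter; apply: perm_size; apply: uniq_perm.
- exact: fset_uniq.
- by rewrite filter_uniq ?fset_uniq.
- by move=> x; rewrite mem_filter !inE /= andbC.
Qed.

Lemma pigeonhole_color (T : choiceType) (A : {fset T}) (chi : T -> nat) l :
  (forall x, x \in A -> chi x < l) -> 0 < l ->
  exists2 c, c < l & #|` A| <= l * #|` [fset x in A | chi x == c]|.
Proof.
move=> chil l_gt0; apply: contrapT => H.
have {}H c : c < l -> l * #|` [fset x in A | chi x == c]| < #|` A|.
  by move=> cl; rewrite ltnNge; apply/negP => h; apply: H; exists c.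
have : \sum_(c < l) l * #|` [fset x in A | chi x == c]| < \sum_(c < l) #|` A|.
  case: l l_gt0 {chil} H => // l _ H.
  rewrite big_ord_recl [X in _ < X]big_ord_recl -addSn leq_add //.
    exact: H.
  by apply: leq_sum => i _; apply/ltnW/H.
rewrite -big_distrr sum_nat_const card_ord /= ltn_pmul2l // ltnNge => /negP;
  apply.
under eq_bigr do rewrite card_fset_count.
rewrite exchange_big -sum1_size big_seq [X in _ <= X]big_seq.
apply: leq_sum => x xA; rewrite (bigD1 (Ordinal (chil x xA))) //= eqxx.
exact: leq_addr.
Qed.

(** In multiplicative notation, the elements [s_1^e_1 ... s_r^e_r x0] with all exponents at most
    [n], in a list of length [(n + 1)^r]. *)
Fixpoint gen_seq (T : Type) (op : T -> T -> T) (S : seq T) (x0 : T) n :=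
  if S is s :: S' then
    [seq iter e (op s) y | e <- iota 0 n.+1, y <- gen_seq op S' x0 n]
  else [:: x0].

(** By Bernoulli's inequality [(1 + 1/m)^m] is at least 2, so [n >= m K] gives [(1 + 1/m)^n >= 2^K].
    With [n + 1] a power of 2, it suffices that [K] exceed the exponent of 2 in [(n + 1)^k]. *)
Lemma exp_gt_poly m k : 0 < m -> exists n, m ^ n * n.+1 ^ k < m.+1 ^ n.
Proof.
move=> m0.
have bern : 2 * m ^ m <= m.+1 ^ m.
  have H n : m ^ n.+1 + n.+1 * m ^ n <= m.+1 ^ n.+1.
    elim: n => [|n IH]; first by rewrite !expn1 expn0 muln1 addn1.
    rewrite [m.+1 ^ _]expnS;
      apply: (@leq_trans (m.+1 * (m ^ n.+1 + n.+1 * m ^ n))).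
      by rewrite ![m ^ _.+1]expnS; move: (m ^ n) => x; nia.
    by rewrite leq_mul2l IH orbT.
  by case: m m0 H => // m _ /(_ m); rewrite expnS; lia.
(* This makes [m * (2 * i * k + 1)] smaller than [i ^ 2], while [n + 1 = 2 ^ (2 * i)] is at least
   [(i + 1) ^ 2]. *)
pose i := (m * (2 * k + 1)).+1.
exists (2 ^ (2 * i)).-1; set n := _.-1.
have n1 : n.+1 = 2 ^ (2 * i) by rewrite prednK ?expn_gt0.
have le_n : m * (2 * i * k).+1 <= n.
  have i2 : i.+1 ^ 2 <= n.+1.
    by rewrite n1 mulnC expnM leq_exp2r //; apply: ltn_expl.
  by rewrite -ltnS; apply: leq_trans i2; rewrite /i; nia.
have ltK : n.+1 ^ k < 2 ^ (2 * i * k).+1 by rewrite n1 -expnM ltn_exp2l.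
move: (2 * i * k).+1 le_n ltK => K le_n ltK.
have leK : 2 ^ K * m ^ (m * K) <= m.+1 ^ (m * K).
  case: (posnP K) => [->|K0]; first by rewrite muln0.
  by rewrite !(expnM _ m K) -expnMn leq_exp2r.
rewrite -{1 3}(subnKC le_n) !expnD mulnAC.
apply: (@leq_trans (m.+1 ^ (m * K) * m ^ (n - m * K))).
  rewrite ltn_pmul2r ?expn_gt0 ?m0 //; apply: leq_trans leK.
  by rewrite mulnC ltn_pmul2r ?expn_gt0 ?m0.
rewrite leq_mul2l; apply/orP; right.
by elim: (n - _) => // r IH; rewrite !expnS leq_mul.
Qed.

Lemma gen_seqP (T : eqType) (op : T -> T -> T) s S x0 n x :
  reflect (exists e y, [/\ e <= n, y \in gen_seq op S x0 n &
             x = iter e (op s) y])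
          (x \in gen_seq op (s :: S) x0 n).
Proof.
rewrite -[gen_seq op (s :: S) x0 n]/[seq iter e (op s) y | e <- iota 0 n.+1,
                                        y <- gen_seq op S x0 n].
apply: (iffP allpairsPdep) => -[e [y]]; rewrite ?mem_iota => -[le_e yS ->];
  by exists e, y; rewrite ?mem_iota.
Qed.

Lemma gen_seqS (T : eqType) (op : T -> T -> T) S x0 n x :
  x \in gen_seq op S x0 n -> x \in gen_seq op S x0 n.+1.
Proof.
elim: S x => // s S IH x /gen_seqP[e [y [le_e /IH yS ->]]].
by apply/gen_seqP; exists e, y; split=> //; apply: leqW.
Qed.

Lemma gen_seq_op (T : eqType) (op : T -> T -> T) S x0 n s x :
  associative op -> commutative op -> s \in S ->
  x \in gen_seq op S x0 n -> op s x \in gen_seq op S x0 n.+1.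
Proof.
move=> opA opC; elim: S s x => // t S IH s x.
rewrite in_cons => /orP[/eqP-> | sS] /gen_seqP[e [y [le_e yS ->]]];
  apply/gen_seqP.
  by exists e.+1, y; split=> //; apply: gen_seqS.
exists e, (op s y); split=> //; [exact: leqW|exact: IH|].
by elim: e {le_e} => //= e <-; rewrite !opA (opC s).
Qed.

(* Since [op] is commutative, [gen_seq] grows polynomially in [n], so the
   ratio of consecutive sizes gets arbitrarily close to 1. *)
Lemma almost_invariant (T : choiceType) (op : T -> T -> T) (P : T -> Prop)
    (S : seq T) (x0 : T) m :
  associative op -> commutative op -> 0 < m -> P x0 ->
  (forall s x, s \in S -> P x -> P (op s x)) ->
  exists A B : {fset T}, [/\ x0 \in A, A `<=` B, forall x, x \in B -> P x,
    forall s x, s \in S -> x \in A -> op s x \in B &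
    m * #|` B| <= m.+1 * #|` A|].
Proof.
move=> opA opC m0 Px0 PS.
pose A n := [fset x in gen_seq op S x0 n].
have A0 n : x0 \in A n.
  rewrite inE /=; elim: S {PS A} => [|s S IH]; rewrite ?mem_head //.
  by apply/gen_seqP; exists 0, x0.
have AS n : A n `<=` A n.+1.
  by apply/fsubsetP => x; rewrite !inE; apply: gen_seqS.
have AP n x : x \in A n -> P x.
  rewrite inE /= => xA.
  elim: S x PS xA {A A0 AS} => [|s S IH] x PS; first by rewrite inE => /eqP->.
  case/gen_seqP=> e [y [_ yS ->]].
  have Py : P y by apply: IH yS => t z tS; apply: PS; rewrite inE tS orbT.
  by elim: e => //= e; apply: PS; rewrite mem_head.
have [n Hn] : exists n, m * #|` A n.+1| <= m.+1 * #|` A n|.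
  apply: contrapT => /forallNP H.
  have grow n : m.+1 ^ n <= m ^ n * #|` A n|.
    elim: n => [|n IH].
      by rewrite mul1n cardfs_gt0; apply/fset0Pn; exists x0.
    rewrite !expnS; apply: (@leq_trans (m.+1 * (m ^ n * #|` A n|))).
      by rewrite leq_mul2l IH orbT.
    have /negP := H n; rewrite -ltnNge => /ltnW h.
    by rewrite mulnCA (mulnC m) -mulnA leq_mul2l h orbT.
  have [n] := exp_gt_poly (size S) m0; rewrite ltnNge => /negP; apply.
  apply: leq_trans (grow n) _; rewrite leq_mul2l; apply/orP; right.
  rewrite /A; rewrite card_fseq; apply: leq_trans (size_undup _) _.
  elim: (S) => // s S' IH.
  by rewrite [size _]size_allpairs size_iota expnS leq_mul2l IH orbT.
exists (A n), (A n.+1); split=> // [x|s x sS]; first exact: AP.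
by rewrite !inE; apply: gen_seq_op.
Qed.
End FiniteSets.

Definition infinite_type (T : choiceType) : Prop :=
  forall n, exists A : {fset T}, #|` A| = n.

(** * Additive recurrence and a Brauer-type theorem *)

Section AdditiveRecurrence.
Local Open Scope fset_scope.
Local Open Scope ring_scope.
Variables (R : idomainType) (Rinf : infinite_type R).

(** Double counting of the pairs of [y] in [B] and [s] in [T] with [y - q * s] in [C]: each [s]
    contributes [#|C|] pairs because [C + q * s] lies in [B], so some [y] has a fibre of at least
    [#|T| / (2 * e)] elements [s]. Two elements of one fibre give the required [u] and [v]. *)
Lemma pigeonhole_translate (T A B C : {fset R}) (q : R) (e : nat) :
  A != fset0 -> C `<=` A -> (#|` A| <= e * #|` C|)%N ->
  (forall x s, x \in A -> s \in T -> x + q * s \in B) ->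
  (#|` B| <= 2 * #|` A|)%N ->
  exists T' : {fset R}, [/\ T' `<=` T, (#|` T| <= 2 * e * #|` T'|)%N &
    forall s s', s \in T' -> s' \in T' ->
      exists u v, [/\ u \in C, v \in C & u - v = q * (s - s')]].
Proof.
move=> A0 CA leAC AB leBA.
have [T0|[t tT]] := fset_0Vmem T.
  by exists fset0; split=> [||s s']; rewrite ?fsub0set ?T0 ?inE.
pose fib y := [fset s in T | y - q * s \in C].
have [y yB Hy] : exists2 y, y \in B & (#|` T| <= 2 * e * #|` fib y|)%N.
  apply: contrapT => H.
  have {}H y : y \in B -> (2 * e * #|` fib y| < #|` T|)%N.
    by move=> yB; rewrite ltnNge; apply/negP => h; apply: H; exists y.
  have /fset0Pn[a aA] := A0.
  have bB := AB a t aA tT.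
  have : (\sum_(y <- B) 2 * e * #|` fib y| < \sum_(y <- B) #|` T|)%N.
    rewrite [X in (X < _)%N]big_seq [X in (_ < X)%N]big_seq.
    rewrite (big_rem _ bB) /= bB [X in (_ < X)%N](big_rem _ bB) /= bB -addSn.
    apply: leq_add; first exact: H.
    by apply: leq_sum => y /H/ltnW.
  rewrite -big_distrr /= big_const_seq count_predT iter_addn addn0.
  under eq_bigr do rewrite card_fset_count.
  rewrite exchange_big /= ltnNge => /negP; apply.
  apply: (@leq_trans (2 * e * (\sum_(s <- T) #|` C|))).
    rewrite big_const_seq count_predT iter_addn addn0.
    have := leq_mul (leqnn #|` T|) (leq_trans leBA (leq_mul (leqnn 2) leAC)).
    move/leq_trans; apply; rewrite leq_eqVlt; apply/orP; left; apply/eqP.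
    by ring.
  rewrite leq_mul2l; apply/orP; right.
  rewrite big_seq [X in (_ <= X)%N]big_seq; apply: leq_sum => s sT.
  rewrite -card_fset_count.
  have -> : #|` C| = #|` [fset c + q * s | c in C]|.
    by rewrite card_imfset //; exact: addIr.
  apply/fsubset_leq_card/fsubsetP => _ /imfsetP[c /= cC ->].
  by rewrite !inE /= AB ?addrK ?cC // (fsubsetP CA).
exists (fib y); split=> //; first by apply/fsubsetP => s; rewrite inE =>
  /andP[].
move=> s s'; rewrite !inE /= => /andP[_ Cs] /andP[_ Cs'].
exists (y - q * s'), (y - q * s); split=> //; ring.
Qed.

(* Each condition [q_i * r \in C i - C i] is met by all differences [r] of a
   subset of the current set of candidates whose size is smaller by a bounded
   factor only. *)
Lemma additive_recurrence (qs : seq R) (e N : nat) : (0 < e)%N ->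
  exists A T : {fset R}, [/\ 0 \notin A, (N <= #|` A|)%N, 0 \notin T &
    forall C : nat -> {fset R},
      (forall i, (i < size qs)%N -> C i `<=` A /\ (#|` A| <= e * #|` C i|)%N) ->
      exists2 r, r \in T & forall i, (i < size qs)%N ->
        exists u v, [/\ u \in C i, v \in C i & u - v = qs`_i * r]].
Proof.
move=> e0.
(* After [size qs] reductions by the factor [2 * e], at least two candidates remain, hence a nonzero
   difference. The set [N0] is contained in [B], being made of translates of 0, and forces [A] to
   have at least [N] elements. *)
have [T0 cT0] := Rinf ((2 * e) ^ size qs).+1%N.
have [N0 cN0] := Rinf (2 * N)%N.
pose S := enum_fset N0 ++ [seq q * s | q <- qs, s <- enum_fset T0].
have [A [B [A0 AB _ AS]]] := @almost_invariant R +%R (fun=>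
  True) S 0 1 (@addrA _)
   (@addrC _) isT Logic.I (fun _ _ _ _ => Logic.I).
rewrite mul1n => leBA.
(* Translating by [c] moves 0 out of the set without changing differences. *)
have [c cA] : exists c, - c \notin A.
  have [D cD] := Rinf #|` A|.+1.
  have /fsubsetPn[d _ dA] : ~~ (D `<=` A).
    by apply/negP => /fsubset_leq_card; rewrite cD ltnn.
  by exists (- d); rewrite opprK.
pose tr (X : {fset R}) : {fset R} := [fset x + c | x in X].
have ctr X : #|` tr X| = #|` X| by rewrite card_imfset //; exact: addIr.
exists (tr A), [fset s - s' | s in T0, s' in [fset s' in T0 | s' != s]].
split.
- apply/imfsetP => -[x /= xA /eqP]; rewrite eq_sym addr_eq0 => /eqP xE.
  by move: cA; rewrite -xE xA.
- rewrite ctr -(@leq_pmul2l 2) // -cN0; apply: leq_trans leBA.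
  apply/fsubset_leq_card/fsubsetP => x xN; rewrite -[x]addr0.
  by apply: AS => //; rewrite mem_cat xN.
- apply/imfset2P => -[s /= _ [s' /=]]; rewrite !inE => /andP[_ ss'] /eqP.
  by rewrite eq_sym subr_eq0 eq_sym (negPf ss').
move=> C HC.
have trAB q s x : q \in qs -> s \in T0 -> x \in tr A -> x + q * s \in tr B.
  move=> qS sT /imfsetP[a /= aA ->].
  rewrite addrAC; apply/imfsetP; exists (a + q * s) => //=.
  rewrite addrC; apply: AS => //; rewrite mem_cat; apply/orP; right.
  exact: allpairs_f.
have tA0 : tr A != fset0.
  by rewrite -cardfs_gt0 ctr cardfs_gt0; apply/fset0Pn; exists 0.
have shrink k : (k <= size qs)%N -> exists T' : {fset R}, [/\ T' `<=` T0,
   (#|` T0| <= (2 * e) ^ k * #|` T'|)%N &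
   forall i s s', (i < k)%N -> s \in T' -> s' \in T' ->
      exists u v, [/\ u \in C i, v \in C i & u - v = qs`_i * (s - s')]].
  elim: k => [|k IH] kq; first by exists T0; rewrite mul1n.
  have [T1 [T10 cT1 T1P]] := IH (ltnW kq).
  have [CA cC] := HC _ kq.
  have [||T2 [T21 cT2 T2P]] := pigeonhole_translate (T := T1) (q := qs`_k)
      tA0 CA cC (B := tr B).
  - by move=> x s xA sT; apply: trAB (fsubsetP T10 _ sT) xA; rewrite mem_nth.
  - by rewrite !ctr.
  exists T2; split; first exact: fsubset_trans T10.
    apply: leq_trans cT1 _; rewrite expnSr -mulnA leq_mul2l; apply/orP; right.
    exact: cT2.
  move=> i s s'; rewrite ltnS leq_eqVlt => /orP[/eqP->|ik] sT s'T.
    exact: T2P.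
  by apply: T1P; rewrite ?(fsubsetP T21).
have [T' [T'T cT' T'P]] := shrink _ (leqnn _).
have [s [s' [sT s'T ss']]] : exists s s', [/\ s \in T', s' \in T' & s' != s].
  have cT'2 : (1 < #|` T'|)%N.
    rewrite ltnNge; apply/negP => h; move: cT'; rewrite cT0.
    rewrite ltnNge => /negP; apply.
    by rewrite -[X in (_ <= X)%N]muln1 leq_mul2l h orbT.
  have [s sT] : exists s, s \in T' by apply/fset0Pn; rewrite -cardfs_gt0 ltnW.
  have [s' ] : exists s', s' \in T' `\ s.
    apply/fset0Pn; rewrite -cardfs_gt0.
    by move: cT'2; rewrite (cardfsD1 s) sT.
  by rewrite !inE => /andP[ss' s'T]; exists s, s'.
exists (s - s').
  apply/imfset2P; exists s => /=; first exact: (fsubsetP T'T).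
  by exists s' => //=; rewrite !inE ss' (fsubsetP T'T).
by move=> i iq; apply: T'P.
Qed.

(* By induction on the number of colours: the most frequent colour of [A] either
   contains one of the elements [d * r * f], or is absent from a dilate of the
   set obtained for one colour less. *)
Lemma finite_brauer (d : R) (qs : seq R) (l : nat) : d != 0 ->
  exists2 F : {fset R}, 0 \notin F &
    forall chi : R -> nat, (forall x, x \in F -> (chi x < l)%N) ->
    exists s, [/\ s != 0, d * s \in F & forall q, q \in qs ->
      exists u v, [/\ u \in F, v \in F, chi u = chi (d * s),
                      chi v = chi (d * s) & u - v = q * s]].
Proof.
move=> d0; elim: l => [|l [F F0 FP]].
  exists [fset 1]; first by rewrite inE eq_sym oner_eq0.
  by move=> chi /(_ 1); rewrite inE eqxx => /(_ isT).
(* The products with [F] anticipate every choice of [f]: the condition for [q * f] at [r] is the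
   condition for [q] at [f * r]. *)
pose qs' := [seq q * f | q <- qs, f <- enum_fset F].
have [A [T [A0 A1 T0 AP]]] := additive_recurrence qs' 1 (ltn0Sn l).
exists (A `|` [fset d * r * f | r in T, f in F]).
  rewrite !inE negb_or A0; apply/imfset2P => -[r /= rT [f /= fF]].
  move/esym/eqP; rewrite !mulf_eq0 (negPf d0) /= => /orP[] /eqP E.
    by rewrite -E rT in T0.
  by rewrite -E fF in F0.
set F' := _ `|` _ => chi chil.
have [||c cl cA] := pigeonhole_color (A := A) (chi := chi) (l := l.+1) => //.
  by move=> x xA; apply: chil; rewrite inE xA.
pose C := [fset x in A | chi x == c].
have [|r rT rP] := AP (fun=> C).
  by move=> _ _; split=> //; apply/fsubsetP => x; rewrite inE => /andP[].
have {}rP q f : q \in qs -> f \in F ->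
    exists u v, [/\ u \in C, v \in C & u - v = q * (f * r)].
  move=> qq fF; have qf : q * f \in qs' by exact: allpairs_f.
  have [|u [v [uC vC E]]] := rP (index (q * f) qs'); first by rewrite index_mem.
  by exists u, v; split=> //; rewrite E nth_index // mulrA.
have r0 : r != 0 by apply: contraNneq T0 => <-.
have CF u : u \in C -> u \in F' /\ chi u = c.
  by rewrite !inE => /andP[-> /eqP].
have dF f : f \in F -> d * r * f \in F'.
  by move=> fF; rewrite inE; apply/orP; right; apply/imfset2P; exists r => //;
    exists f.
case: (pselect (exists2 f, f \in F & chi (d * r * f) = c)) => [[f fF Ec]|nc].
  have E : d * (f * r) = d * r * f by ring.
  exists (f * r); rewrite E; split; [|exact: dF|].
    by rewrite mulf_neq0 //; apply: contraNneq F0 => <-.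
  move=> q qq; have [u [v [/CF[uF uc] /CF[vF vc] uv]]] := rP q f qq fF.
  by exists u, v; rewrite Ec.
(* No [d * r * f] has colour [c], so colour [l] can be renamed [c] without merging two classes,
   which leaves [l] colours. *)
pose chi' f := if chi (d * r * f) == l then c else chi (d * r * f).
have chi'E u v : u \in F -> v \in F -> chi' u = chi' v ->
  chi (d * r * u) = chi (d * r * v).
  move=> uF vF; rewrite /chi'; case: eqP => [->|_]; case: eqP => [->|_] // E.
    by case: nc; exists v.
  by case: nc; exists u.
have [f fF|s [s0 dsF sP]] := FP chi'.
  rewrite /chi'; case: eqP => [E|/eqP E].
    have cl' : c != l by apply/eqP => cl'; case: nc; exists f; rewrite // E.
    by move: cl; rewrite ltnS leq_eqVlt (negPf cl').
  by have := chil _ (dF _ fF); rewrite ltnS leq_eqVlt (negPf E).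
have E : d * (d * r * s) = d * r * (d * s) by ring.
exists (d * r * s); rewrite E; split; [|exact: dF|].
  by rewrite !mulf_neq0.
move=> q qq; have [u [v [uF vF Eu Ev uv]]] := sP q qq.
exists (d * r * u), (d * r * v); split; try exact: dF.
- exact: chi'E.
- exact: chi'E.
- by rewrite -mulrBr uv; ring.
Qed.

End AdditiveRecurrence.

(** * Multiplicative density *)

Section Density.
Local Open Scope classical_set_scope.
Local Open Scope ring_scope.
Variables (Rr : realType) (R : idomainType).
Local Notation dilate r A := [fset r * x | x in A]%fset.
Implicit Types (F : nat -> {fset R}) (B : set R).

(** The form in which positive upper density along [F] is used: a lower bound [1 / e] on the
    proportion of [B] for infinitely many [n], in natural numbers. *)
Definition frequently_dense F B (e : nat) : Prop :=
  forall N, exists2 n, (N <= n)%N &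
    (#|` F n| <= e * #|` [fset x in F n | x \in B]%fset|)%N.

Lemma exists_inv_lt (x : Rr) : 0 < x -> exists e : nat, e.+1%:R^-1 < x.
Proof.
move=> x0; exists (Num.truncn x^-1).
rewrite -[X in _ < X]invrK ltf_pV2 ?posrE ?invr_gt0 ?ltr0n //.
exact: truncnS_gt.
Qed.

Lemma density_gt0P B : (0 < upper_banach_density Rr B)%E <->
  exists F e, [/\ folner Rr F, (0 < e)%N & frequently_dense F B e].
Proof.
split=> [/ereal_sup_gt[_ [F /= Ff <-]]|[F [e [Ff e0 FB]]]]; last first.
  apply: (@lt_le_trans _ _ (e%:R^-1)%:E).
    by rewrite lte_fin invr_gt0 ltr0n.
  apply: le_ereal_sup_tmp; eexists; first by exists F.
  rewrite /limn_esup limf_esupE; apply: le_ereal_inf_tmp => _ [V [N _ NV] <-].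
  have [n Nn Hn] := FB N; apply: le_ereal_sup_tmp; eexists.
    by exists n => //; apply: NV.
  have [Fn _ _] := Ff; have F0 : (0 < #|` F n|)%N by rewrite cardfs_gt0.
  rewrite lee_fin ler_pdivlMr ?ltr0n // ler_pdivrMl ?ltr0n //.
  by rewrite -natrM ler_nat.
rewrite /limn_esup limf_esupE => pos; apply: contrapT => H.
have {}H e : exists N, forall n, (N <= n)%N ->
    (e.+1 * #|` [fset x in F n | x \in B]%fset| < #|` F n|)%N.
  apply: contrapT => He; apply: H; exists F, e.+1; split=> // N.
  apply: contrapT => HN; apply: He; exists N => n Nn.
  by rewrite ltnNge; apply/negP => h; apply: HN; exists n.
have lee e : (ereal_inf [set ereal_sup [set
   (#|` [fset x in F n | x \in B]%fset|%:R / #|` F n|%:R : Rr)%:E | n in V] |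
    V in \oo] <= (e.+1%:R^-1)%:E)%E.
  have [N HN] := H e; apply: ge_ereal_inf; eexists.
    by exists [set n | (N <= n)%N] => //; exists N.
  apply: ge_ereal_sup => _ [n /= Nn <-]; rewrite lee_fin.
  have := HN _ Nn => lt.
  rewrite ler_pdivrMr ?ltr0n ?(leq_ltn_trans _ lt) // ler_pdivlMl ?ltr0n //.
  by rewrite -natrM ler_nat ltnW.
move: pos lee; case: ereal_inf => [x| |] //; last by move=> _ /(_ 0%N).
rewrite lte_fin => /exists_inv_lt[e He] /(_ e); rewrite lee_fin leNgt.
by rewrite He.
Qed.

Lemma folnerP F (r : R) m : folner Rr F -> r != 0 -> exists N, forall n,
  (N <= n)%N ->
  (m * #|` symdiff (dilate r (F n)) (F n)| <= #|` F n|)%N.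
Proof.
case=> F0 _ HF r0; case: (posnP m) => [->|m0]; first by exists 0%N.
have /cvgr0Pnorm_le /(_ (m%:R^-1)) := HF r r0.
rewrite invr_gt0 ltr0n m0 => /(_ isT) [N _ HN]; exists N => n /HN /=.
have Fn : (0 < #|` F n|)%N by rewrite cardfs_gt0.
rewrite ger0_norm ?divr_ge0 // ler_pdivrMr ?ltr0n // ler_pdivlMl ?ltr0n //.
by rewrite -natrM ler_nat.
Qed.

(** For large [n] the set [F n] and its dilate by [a] differ in at most [#|F n| / (2 * e)] points,
    so translation costs at most half of the density. The bound [N] is chosen before [B] because
    [dense_limit] applies it to a set varying with [n]. *)
Lemma folner_translate_count F e (A : {fset R}) :
  folner Rr F -> 0 \notin A -> exists N, forall n B, (N <= n)%N ->
  (#|` F n| <= e * #|` [fset x in F n | x \in B]%fset|)%N ->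
  forall a, a \in A -> (#|` F n| <= 2 * e * \sum_(r <- F n)
    ((r * a)%R \in B))%N.
Proof.
move=> Ff A0.
have [N HN] : exists N, forall n a, (N <= n)%N -> a \in enum_fset A ->
   (2 * e * #|` symdiff (dilate a (F n)) (F n)| <= #|` F n|)%N.
  have {}A0 : forall a, a \in enum_fset A -> a != 0.
    by move=> a aA; apply: contraNneq A0 => <-.
  elim: (enum_fset A) A0 => [|a s IH] As0; first by exists 0%N => n a _;
    rewrite in_nil.
  have [|N HN] := IH; first by move=> b bs; apply: As0; rewrite inE bs orbT.
  have [|N' HN'] := folnerP (2 * e) Ff (r := a); first by rewrite As0 ?mem_head.
  exists (maxn N N') => n b; rewrite geq_max inE => /andP[h h'] /orP[/eqP->|bs].
    exact: HN'.
  exact: HN.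
exists N => n B Nn dn a aA; have := HN n a Nn aA.
have an0 : a != 0 by apply: contraNneq A0 => <-.
rewrite -card_fset_count.
have : (#|` [fset x in F n | x \in B]%fset| <=
   #|` [fset x in F n | (x * a)%R \in B]%fset| +
   #|` symdiff (dilate a (F n)) (F n)|)%N.
  have -> : #|` [fset x in F n | (x * a)%R \in B]%fset| =
      #|` [fset (a * x)%R | x in [fset x in F n | (x * a)%R \in B]]%fset|.
    by rewrite [RHS]card_imfset //; exact: (mulfI an0).
  apply: leq_trans (leq_trans (fsubset_leq_card _) (leq_card_fsetU _ _)) => //.
  apply/fsubsetP => x; rewrite !inE /= => /andP[xF xB].
  case: (boolP (x \in dilate a (F n))) => [|_].
    case/imfsetP => y /= yF xE; apply/orP; left; apply/imfsetP; exists y => //.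
    by rewrite !inE /= yF mulrC -xE xB.
  by rewrite xF /= orbT.
by move: dn; nia.
Qed.

(** Double counting of the pairs with [r * a] in [B]: each [a] in [A] accounts for a proportion
    [1 / (2 * e)] of the [r] in [F n], hence some [r] accounts for this proportion of [A]. *)
Lemma folner_dense_translate F B e (A : {fset R}) :
  folner Rr F -> frequently_dense F B e -> 0 \notin A ->
  exists2 r, r != 0 &
    (#|` A| <= 2 * e * #|` [fset a in A | (r * a)%R \in B]%fset|)%N.
Proof.
move=> Ff FB A0; have [F0 Fn0 _] := Ff.
have [N HN] := folner_translate_count e Ff A0.
have [n Nn /(HN n B Nn) dA] := FB N.
apply: contrapT => H.
have {}H r : r \in F n -> (2 * e * \sum_(a <- A) ((r * a)%R \in B) < #|` A|)%N.
  move=> rF; rewrite ltnNge -card_fset_count; apply/negP => h; apply: H.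
  by exists r => //; apply: contraNneq (Fn0 n) => <-.
have : (\sum_(r <- F n) 2 * e * \sum_(a <- A) ((r * a)%R \in B) <
        \sum_(r <- F n) #|` A|)%N.
  have /fset0Pn[r rF] := F0 n.
  rewrite [X in (X < _)%N]big_seq [X in (_ < X)%N]big_seq.
  rewrite (big_rem _ rF) /= rF [X in (_ < X)%N](big_rem _ rF) /= rF -addSn.
  apply: leq_add; first exact: H.
  by apply: leq_sum => y /H/ltnW.
rewrite -big_distrr /= ltnNge => /negP; apply.
rewrite exchange_big /= big_distrr /=.
apply: leq_trans (_ : \sum_(a <- A) #|` F n| <= _)%N.
  by rewrite !big_const_seq !count_predT !iter_addn !addn0 mulnC.
by rewrite [X in (X <= _)%N]big_seq [X in (_ <= X)%N]big_seq; apply: leq_sum =>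
  a /dA.
Qed.

(** Countability makes it enough that [F n] be almost invariant under the nonzero ones among the
    first [n + 1] elements, which [almost_invariant] provides for multiplication, starting from
    1. *)
Lemma folner_exists (enum : nat -> R) : (forall x, exists n, enum n = x) ->
  exists F, folner Rr F.
Proof.
move=> enumP.
have H n : exists A : {fset R}, [/\ A != fset0,
  0 \notin A & forall k, (k <= n)%N ->
    enum k != 0 -> (n.+1 * #|` symdiff (dilate (enum k) A) A| <= 2 * #|` A|)%N].
  pose S := [seq x <- [seq enum k | k <- iota 0 n.+1] | x != 0].
  have [|A [B [A1 AB B0 AS cB]]] := @almost_invariant R *%R (fun x =>
    x != 0) S 1
     n.+1 (@mulrA R) (@mulrC R) (ltn0Sn n) (oner_neq0 R).
    by move=> s x; rewrite mem_filter => /andP[s0 _] x0; rewrite mulf_neq0.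
  exists A; split.
  - by apply/fset0Pn; exists 1.
  - by apply/negP => /(fsubsetP AB)/B0/eqP.
  move=> k kn ek0; set D := dilate _ _.
  have DB : (D `<=` B)%fset.
    apply/fsubsetP => _ /imfsetP[x /= xA ->]; apply: AS => //.
    by rewrite mem_filter ek0 map_f // mem_iota.
  have cD : #|` D| = #|` A| by rewrite card_imfset //; exact: (mulfI ek0).
  have h1 : (#|` (D `\` A)%fset| <= #|` B| - #|` A|)%N.
    rewrite -cardfsDS //; apply: fsubset_leq_card; exact: fsetSD.
  have h2 : (#|` (A `\` D)%fset| <= #|` B| - #|` A|)%N.
    rewrite -cD -cardfsDS //; apply: fsubset_leq_card; exact: fsetSD.
  have h3 : (#|` symdiff D A| <= #|` (D `\` A)%fset| + #|` (A `\` D)%fset|)%N.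
    exact: leq_card_fsetU.
  by move: cB; nia.
have [F HF] := choice H; exists F; split=> [n|n|r r0].
- by have [] := HF n.
- by have [] := HF n.
have [k ek] := enumP r; apply/cvgr0Pnorm_le => eps eps0.
have [e He] := exists_inv_lt (divr_gt0 eps0 (ltr0n Rr 2)).
exists (maxn k e) => //= n; rewrite /= geq_max => /andP[kn en].
have [An0 _ /(_ k kn)] := HF n; rewrite ek => /(_ r0) h.
have A0 : (0 < #|` F n|)%N by rewrite cardfs_gt0.
rewrite ger0_norm ?divr_ge0 // ler_pdivrMr ?ltr0n //.
have e2 : e.+1%:R^-1 * 2 <= eps by rewrite -ler_pdivlMr ?ltr0n ?ltW.
apply: le_trans (ler_wpM2r (ler0n _ _) e2).
rewrite -mulrA ler_pdivlMl ?ltr0n // -!natrM ler_nat.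
by apply: leq_trans h; rewrite leq_mul2r ltnS en orbT.
Qed.

(** Each [F n] has a cell of proportion at least [1 / l], and one of the finitely many cells serves
    infinitely many [n]. *)
Lemma density_cover (enum : nat -> R) l (P : 'I_l -> set R) :
  (forall x, exists n, enum n = x) -> (forall x, x != 0 -> exists i, P i x) ->
  exists i, (0 < upper_banach_density Rr (P i))%E.
Proof.
move=> enumP cover; have [F Ff] := folner_exists enumP; have [F0 Fn0 _] := Ff.
have l0 : (0 < l)%N.
  by have [i _] := cover 1 (oner_neq0 R); case: (l) i => // -[].
have /choice[chi chiP] : forall x, exists i, x != 0 -> P i x.
  move=> x; case: (pselect (x != 0)) => [/cover[i Pi]|nx]; first by exists i.
  by exists (Ordinal l0) => /nx.
have H n : exists i : 'I_l,
  (#|` F n| <= l * #|` [fset x in F n | x \in P i]%fset|)%N.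
  have [||c cl cF] := pigeonhole_color (A := F n) (chi := chi) (l := l) => //.
  exists (Ordinal cl); apply: leq_trans cF _; rewrite leq_mul2l; apply/orP;
    right.
  apply/fsubset_leq_card/fsubsetP => x; rewrite !inE /= => /andP[xF /eqP xc].
  rewrite xF; apply/asboolP; have -> : Ordinal cl = chi x by apply/val_inj.
  by apply: chiP; apply: contraNneq (Fn0 n) => <-.
have [i Hi] : exists i, frequently_dense F (P i) l.
  apply: contrapT => /forallNP Hi.
  have {}Hi i : exists N, forall n, (N <= n)%N ->
     ~ (#|` F n| <= l * #|` [fset x in F n | x \in P i]%fset|)%N.
    apply: contrapT => /forallNP h; apply: (Hi i) => N.
    by apply: contrapT => h'; apply: (h N) => n Nn Hn; apply: h'; exists n.
  have [N HN] := choice Hi.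
  have [i] := H (\max_i N i)%N.
  by apply: HN; rewrite (leq_bigmax i).
by exists i; apply/density_gt0P; exists F, l.
Qed.

End Density.

(** * Limits along a free ultrafilter *)

Section UltrafilterLimits.
Local Open Scope classical_set_scope.
Local Open Scope ring_scope.

Lemma free_ultrafilter : exists U : set_system nat,
  UltraFilter U /\ forall N, U [set n | (N <= n)%N].
Proof.
have [U [UU sU]] := @ultraFilterLemma nat \oo _.
by exists U; split=> // N; apply: sU; exists N.
Qed.

Definition ultra_limit (U : set_system nat) (T : Type) (B : nat ->
  set T) : set T :=
  [set x | U [set n | B n x]].

(** The ultrafilter decides membership of each point, and finitely many of its sets meet in one of
    its sets. Properties that involve finitely many points thus pass between the limit and most
    terms. *)
Lemma ultra_limit_agree (U : set_system nat) (T : choiceType) (B : nat -> set T)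
    (A : {fset T}) : UltraFilter U ->
  U [set n | forall x, x \in A -> (B n x <-> ultra_limit U B x)].
Proof.
move=> UU.
suff : forall s : seq T, U [set n | forall x, x \in s -> (B n x <->
  ultra_limit U B x)].
  by move/(_ (enum_fset A)).
elim=> [|x s IH]; first by apply: filterE => n x; rewrite in_nil.
have Ux : U [set n | B n x <-> ultra_limit U B x].
  have [h|h] := in_ultra_setVsetC [set n | B n x] UU.
    by apply: filterS (h) => n /= Bn; split=> // _; exact: h.
  apply: filterS (h) => n /= nBn; split=> // h'.
  by have [m [/= ]] := filter_ex (filterI h h').
apply: filterS2 Ux IH => n hx hs y; rewrite inE => /orP[/eqP->|] //.
exact: hs.
Qed.

Variable Rr : realType.

Lemma ultra_cvg (U : set_system nat) (u : nat -> Rr) : UltraFilter U ->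
  (forall n, 0 <= u n <= 1) -> exists l : Rr, u @ U --> l.
Proof.
move=> UU u01.
have := @segment_compact Rr 0 1; rewrite compact_ultra.
have UuU : UltraFilter (u @ U).
  split=> [|G GF UG]; first exact: fmap_proper_filter.
  apply/seteqP; split=> [V GV|]; last exact: UG.
  have [//|UnV] := in_ultra_setVsetC (u @^-1` V) UU.
  by have [x []] := filter_ex (filterI GV (UG (~` V) UnV)).
move=> /(_ (u @ U) UuU) [|l [_ ul]]; last by exists l.
by apply: (@filterE _ U) => n; rewrite /= in_itv /=.
Qed.

(* The Fatou-type argument behind Bergelson's intersectivity lemma, for a
   measure that is only finitely additive: [W i (k i)] almost exhausts
   [\bigcup_(n >= i) E n]. *)
Lemma limsup_finitely_additive (T : Type) (mu : set T -> Rr) (E : nat -> set T)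
    (d : Rr) :
  (forall V, 0 <= mu V <= 1) ->
  (forall V W, V `&` W = set0 -> mu (V `|` W) = mu V + mu W) ->
  0 < d -> (forall n, d <= mu (E n)) ->
  exists k : nat -> nat, forall m, exists x, forall i, (i <= m)%N ->
    exists2 n, (i <= n < k i)%N & E n x.
Proof.
move=> mu01 muD d0 dE.
have muS V W : V `<=` W -> mu V <= mu W.
  move=> VW; rewrite (_ : W = V `|` (W `\` V)); last first.
    apply/seteqP; split=> x; last by case=> [/VW|[]].
    by move=> Wx; case: (pselect (V x)) => ?; [left|right].
  rewrite muD; last by rewrite setDE setICA setICr setI0.
  by rewrite lerDl; have /andP[] := mu01 (W `\` V).
have muU V W : mu (V `|` W) <= mu V + mu W.
  have -> : V `|` W = V `|` (W `\` V).
    apply/seteqP; split=> x; last by case=> [|[]]; [left|right].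
    by case=> Hx; [left|case: (pselect (V x)) => ?; [left|right]].
  rewrite muD; last by rewrite setDE setICA setICr setI0.
  by rewrite lerD2l; apply: muS => x [].
pose W i k := [set x | exists2 n, (i <= n < k)%N & E n x].
(* The sum of all these errors is [d / 2], less than the measure of any [E m]. *)
pose eps i : Rr := d / 2 ^+ i.+2.
have eps0 i : 0 < eps i by rewrite divr_gt0 ?exprn_gt0.
have /choice[k kP] : forall i, exists k, (i < k)%N /\
    forall k', mu (W i k') <= mu (W i k) + eps i.
  move=> i; pose A := [set mu (W i k) | k in setT].
  have A0 : has_sup A.
    split; first by exists (mu (W i 0)), 0%N.
    by exists 1 => _ [k _ <-]; have /andP[] := mu01 (W i k).
  have [_ [k _ <-] Hk] := sup_adherent (eps0 i) A0.
  (* The maximum with [i.+1] puts [E i] itself among the sets that make up [W i (k i)]. *)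
  exists (maxn i.+1 k); split; first by rewrite leq_maxl.
  move=> k'; rewrite -lerBlDr; apply: le_trans (muS (W i k) _ _); last first.
    by move=> x [n /andP[h1 h2]]; exists n => //; rewrite h1 leq_max h2 orbT.
  apply: ltW; apply: le_lt_trans Hk; rewrite lerD2r.
  by apply: sup_upper_bound => //; exists k'.
exists k => m; apply: contrapT => /forallNP H.
(* [A j] collects the points of [W m (k m)] missed by an earlier [W i (k i)]; its measure is at most
   the sum of the first [j] errors. Without a common point, [A m] would contain [E m]. *)
pose A j := [set x | W m (k m) x /\ exists2 i, (i < j)%N & ~ W i (k i) x].
have muA j : (j <= m)%N -> mu (A j) <= d / 2 * (1 - 2 ^- j).
  elim: j => [|j IH] jm.
    rewrite expr0 invr1 subrr mulr0.
    have -> : A 0%N = set0 by rewrite -subset0 => x [_ []].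
    by have := muD set0 set0 (setI0 _); rewrite setU0; lra.
  apply: (@le_trans _ _ (mu (A j `|` (W m (k m) `\` W j (k j))))).
    apply: muS => x [Wx [i ij nW]]; move: ij; rewrite ltnS leq_eqVlt.
    by case/orP => [/eqP ij|ij]; [right; rewrite -ij|left; split=> //;
      exists i].
  apply: le_trans (muU _ _) _.
  have step : mu (W m (k m) `\` W j (k j)) <= eps j.
    rewrite -(lerD2l (mu (W j (k j)))) -muD;
      last by rewrite setDE setICA setICr setI0.
    have [_ /(_ (maxn (k j) (k m)))] := kP j; apply: le_trans; apply: muS => x.
    case=> [|[]] [n /andP[h1 h2] En] => [|_]; exists n => //.
      by rewrite h1 leq_max h2.
    by rewrite (leq_trans (ltnW jm) h1) leq_max h2 orbT.
  apply: le_trans (lerD (IH (ltnW jm)) step) _.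
  have E1 : (2 : Rr) ^+ j.+1 = 2 * 2 ^+ j by rewrite exprS.
  have E2 : (2 : Rr) ^+ j.+2 = 4 * 2 ^+ j by rewrite !exprS mulrA -natrM.
  rewrite /eps E1 E2.
  have : (2 ^+ j : Rr) != 0 by rewrite expf_neq0.
  move: (2 ^+ j) => y y0; rewrite le_eqVlt; apply/orP; left; apply/eqP; field.
  by [].
have : d <= mu (A m).
  apply: le_trans (dE m) (muS _ _ _) => x Ex.
  have Wx : W m (k m) x by exists m => //; rewrite leqnn; case: (kP m).
  split=> //; have /existsNP[i /not_implyP[im nW]] := H x; exists i => //.
  by move: im; rewrite leq_eqVlt => /orP[/eqP im|] //; move: nW; rewrite im.
have := muA m (leqnn m).
have : 0 < (2 ^- m : Rr) by rewrite invr_gt0 exprn_gt0.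
move: (2 ^- m) => y y0 h1 h2; have := le_trans h2 h1; nra.
Qed.
End UltrafilterLimits.

(** * A set of positive density from dense finite configurations *)

Section DenseLimit.
Local Open Scope classical_set_scope.
Local Open Scope ring_scope.
Variables (Rr : realType) (R : idomainType) (enum : nat -> R).
Hypothesis enumP : forall x, exists n, enum n = x.

(** The assumptions on [good] are closure under pointwise limits and under dilations. A finitely
    additive probability [mu] on the space of subsets of the ring gives the good sets that are dense
    in [F n] a measure bounded below; the Fatou argument then finds sets dense in many [F n] at
    once, and a limit of these is taken. *)
Lemma dense_limit (good : set R -> Prop) (e : nat) : (0 < e)%N ->
  (forall B, (forall A : {fset R}, exists2 B', good B' &
     forall x, x \in A -> B x -> B' x) -> good B) ->
  (forall B r, r != 0 -> good B -> good [set x | B (r * x)]) ->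
  (forall A : {fset R}, 0 \notin A -> exists2 B, good B &
     (#|` A| <= e * #|` [fset x in A | x \in B]%fset|)%N) ->
  exists2 B, good B & (0 < upper_banach_density Rr B)%E.
Proof.
move=> e0 goodlim goodM dense.
have [F Ff] := folner_exists Rr enumP; have [F0 Fn0 _] := Ff.
have cF n : (0 < #|` F n|)%N by rewrite cardfs_gt0.
have /choice[G GP] : forall n, exists B, good B /\
    (#|` F n| <= e * #|` [fset x in F n | x \in B]%fset|)%N.
  by move=> n; have [B] := dense _ (Fn0 n); exists B.
pose tr n r := [set x | G n (r * x)].
(* [muN n V] is the probability, for a random [r] in [F n], that the dilate [tr n r] of [G n]
   belongs to [V]. *)
pose muN n (V : set (set R)) : Rr :=
  (\sum_(r <- F n) `[< V (tr n r) >])%N%:R / #|` F n|%:R.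
pose E n := [set B | good B /\
  (#|` F n| <= 4 * e * #|` [fset x in F n | x \in B]%fset|)%N].
have [U [UU Uge]] := free_ultrafilter.
have muN01 V n : 0 <= muN n V <= 1.
  rewrite /muN divr_ge0 //= ler_pdivrMr ?ltr0n // mul1r ler_nat.
  rewrite -card_fset_count; apply/fsubset_leq_card/fsubsetP => x.
  by rewrite inE => /andP[].
have /choice[mu muP] : forall V, exists l : Rr, (fun n => muN n V) @ U --> l.
  by move=> V; exact: (ultra_cvg UU (muN01 V)).
have mu01 V : 0 <= mu V <= 1.
  apply/andP; split.
    apply: (cvgr_to_ge (muP V)); apply: (@filterE _ U) => n.
    by have /andP[] := muN01 V n.
  apply: (cvgr_to_le (muP V)); apply: (@filterE _ U) => n.
  by have /andP[] := muN01 V n.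
have muD V W : V `&` W = set0 -> mu (V `|` W) = mu V + mu W.
  move=> VW; have h := cvgD (muP V) (muP W).
  apply: (cvg_unique _ (muP (V `|` W))) => //.
  suff -> : (fun n => muN n (V `|` W)) = (fun n => muN n V) \+ (fun n =>
    muN n W).
    exact: h.
  apply/funext => n /=.
  rewrite /muN -mulrDl -natrD -big_split /=; congr (_%:R / _);
    apply: eq_bigr => r _.
  case: (asboolP (V _)) => hV; case: (asboolP (W _)) => hW.
  - by move: (conj hV hW); rewrite -[_ /\ _]/((V `&` W) _) VW.
  - by case: asboolP => // -[]; left.
  - by case: asboolP => // -[]; right.
  - by case: asboolP => // -[].
(* On average over [r], the dilate of [G m] has proportion at least [1 / (2 * e)] in [F n]; so with
   probability at least [1 / (4 * e)] its proportion is at least [1 / (4 * e)]. *)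
have muE n : (4 * e)%:R^-1 <= mu (E n).
  apply: (cvgr_to_ge (muP _)).
  have [N HN] := folner_translate_count e Ff (Fn0 n).
  apply: filterS (Uge N) => m /= Nm.
  have [gm dm] := GP m; have cnt := HN m (G m) Nm dm.
  rewrite /muN ler_pdivlMr ?ltr0n // ler_pdivrMl ?ltr0n ?muln_gt0 //.
  rewrite -natrM ler_nat.
  have sum1 : (#|` F n| * #|` F m| <=
      2 * e * \sum_(r <- F m) \sum_(a <- F n) ((r * a)%R \in G m))%N.
    rewrite exchange_big /= big_distrr /=.
    apply: leq_trans (_ : (\sum_(a <- F n) #|` F m| <= _)%N).
      by rewrite big_const_seq count_predT iter_addn addn0 mulnC.
    by rewrite [X in (X <= _)%N]big_seq [X in (_ <= X)%N]big_seq;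
      apply: leq_sum.
  have sum2 : (4 * e * \sum_(r <- F m) \sum_(a <- F n) ((r * a)%R \in G m) <=
      \sum_(r <- F m) (4 * e * #|` F n| * `[< E n (tr m r) >] + #|` F n|))%N.
    rewrite big_distrr /= [X in (X <= _)%N]big_seq [X in (_ <= X)%N]big_seq.
    apply: leq_sum => r rF; have r0 : r != 0 by apply: contraNneq (Fn0 m) => <-.
    have -> : (\sum_(a <- F n) ((r * a)%R \in G m))%N =
        #|` [fset x in F n | x \in tr m r]%fset|.
      by rewrite card_fset_count; apply: eq_bigr => a _; congr nat_of_bool;
        apply/asboolP/asboolP.
    case: asboolP => [_|nE].
      rewrite muln1; apply: leq_trans (leq_addr _ _); rewrite leq_mul2l.
      by rewrite fsubset_leq_card ?orbT //; apply/fsubsetP => x; rewrite inE =>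
        /andP[].
    rewrite muln0 add0n leqNgt; apply/negP => h; apply: nE; split;
      last exact: ltnW.
    exact: goodM.
  rewrite big_split /= -big_distrr /= big_const_seq count_predT iter_addn addn0 in sum2.
  have := cF n; move: sum1 sum2.
  move: (\sum_(r <- F m) \sum_(a <- F n) ((r * a)%R \in G m))%N => x.
  move: (\sum_(r <- F m) `[< E n (tr m r) >])%N => y.
  move: #|` F n| #|` F m| => a b h1 h2 a0.
  rewrite -(leq_pmul2l a0); nia.
have d0 : 0 < (4 * e)%:R^-1 :> Rr by rewrite invr_gt0 ltr0n muln_gt0.
have [k kP] := limsup_finitely_additive mu01 muD d0 muE.
have /choice[B BP] := kP.
pose B' := ultra_limit U B; exists B'.
  apply: goodlim => A.
  have [m /= hm] := filter_ex (ultra_limit_agree B A UU).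
  have [n _ [gB _]] := BP m m (leqnn m).
  by exists (B m) => // x xA /(hm _ xA).
apply/density_gt0P; exists F, (4 * e)%N; split=> //; first by rewrite muln_gt0.
(* [A] is the union of the [F n] with [n < k N]. On it [B'] agrees with some [B m], [m >= N], which
   is dense in one of the [F n] with [N <= n < k N]. *)
move=> N; pose A := \big[fsetU/fset0]_(n < k N) F n.
have [m [/= Nm hm]] := filter_ex (filterI (Uge N) (ultra_limit_agree B A UU)).
have [n /andP[Nn nk] [_ dn]] := BP m N Nm.
exists n => //; apply: leq_trans dn _; rewrite leq_mul2l; apply/orP; right.
apply/fsubset_leq_card/fsubsetP => x; rewrite !inE /= => /andP[xF /set_mem xB].
rewrite xF; apply/mem_set/hm => //; apply/bigfcupP; exists (Ordinal nk) => //.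
by rewrite mem_index_enum.
Qed.

End DenseLimit.

(** * The upper bounds *)

(** A number below [b ^ n] codes, by its base [b] digits, a map from [{0, ..., n - 1}] to [b]
    values; colourings, subsets and points become numbers in a bounded range. *)
Definition digit (b j i : nat) : nat := (j %/ b ^ i) %% b.

Lemma digits_exist b n (f : nat -> nat) : (forall i, i < n -> f i < b) ->
  exists2 j, j < b ^ n & forall i, i < n -> digit b j i = f i.
Proof.
elim: n f => [|n IH] f fb; first by exists 0.
have [|j jb jf] := IH (fun i => f i.+1); first by move=> i ni; apply: fb.
have f0 := fb 0 isT; have b0 : 0 < b by apply: leq_ltn_trans f0.
exists (j * b + f 0).
  by rewrite expnS; nia.
case=> [|i] ni; rewrite /digit ?expn0 ?divn1.
  by rewrite modnMDl modn_small.
by rewrite expnS divnMA divnMDl // (divn_small f0) addn0 -jf.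
Qed.

Lemma ultra_color (U : set_system nat) (f : nat -> nat) l :
  UltraFilter U -> (forall n, f n < l) ->
    exists2 c, c < l & U [set n | f n = c]%classic.
Proof.
move=> UU fl; suff H k : (exists2 c, c < k & U [set n | f n = c]%classic) \/
    U [set n | k <= f n]%classic.
  have [//|/filter_ex[n /=]] := H l.
  by rewrite leqNgt fl.
elim: k => [|k [[c ck Uc]|Uk]]; first by right; apply: filterE.
  by left; exists c => //; apply: ltnW.
have [Uc|Uc] := in_ultra_setVsetC [set n | f n = k]%classic UU.
  by left; exists k.
right; apply: filterS2 Uk Uc => n /= h1 h2; rewrite ltn_neqAle h1 andbT.
by apply/eqP => h3; apply: h2.
Qed.

(** * Characterizations by finite configurations *)

Section FiniteCharacterizations.
Local Open Scope classical_set_scope.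
Local Open Scope ring_scope.
Variables (Rr : realType) (R : idomainType) (C : computable_idomain R).

Lemma enumC x : exists n, phi_inv C n = x.
Proof. by exists (phi C x); rewrite phiK. Qed.

Definition has_root_flag (inj : bool) n (p : {mpoly R[n]}) (B : set R) : Prop :=
  exists v : 'I_n -> R, [/\ inj -> injective v, forall i, B (v i) & p.@[v] = 0].

Lemma has_root_flagS inj n (p : {mpoly R[n]}) B B' :
  B `<=` B' -> has_root_flag inj p B -> has_root_flag inj p B'.
Proof. by move=> BB' [v [vi vB v0]]; exists v; split=> // i; apply: BB'. Qed.

Lemma has_root_flagF n (p : {mpoly R[n]}) B :
  has_root_flag false p B <-> has_root_in p B.
Proof. by split=> [[v []]|[v vB v0]]; exists v. Qed.

Lemma has_root_flagT n (p : {mpoly R[n]}) B :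
  has_root_flag true p B <-> has_injective_root_in p B.
Proof.
split=> -[v [vi vB v0]]; exists v; split=> //; exact: vi.
Qed.

Definition PR_flag inj n (p : {mpoly R[n]}) : Prop :=
  forall l (P : 'I_l -> set R), nonzero_partition P ->
    exists i, has_root_flag inj p (P i).

(** The numbers [k] below [l.+1 ^ N] code the colourings of the elements of code below [N]. If every
    [N] has a bad colouring, each nonzero element receives the colour it has in most of them; a
    monochromatic root, having finitely many coordinates, would already be monochromatic in a bad
    colouring. *)
Lemma PR_flag_finite inj n (p : {mpoly R[n]}) : PR_flag inj p <->
  forall l, exists N, forall k, (k < l.+1 ^ N)%N -> exists2 c, (c < l.+1)%N &
    has_root_flag inj p
      [set x | [/\ (phi C x < N)%N, x != 0 & digit l.+1 k (phi C x) = c]].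
Proof.
split=> H; last first.
  move=> l P [Pcov Pdisj].
  have cov x : x != 0 -> exists i, P i x.
    move=> x0; have [i _ Pi] : (\bigcup_i P i) x by rewrite Pcov.
    by exists i.
  case: l P Pcov Pdisj cov => [P _ _ cov|l P Pcov Pdisj cov].
    by have [[j +] _] := cov 1 (oner_neq0 R); rewrite ltn0.
  have /choice[chi chiP] : forall x, exists i, x != 0 -> P i x.
    move=> x; case: (pselect (x != 0)) => [/cov[i Pi]|nx]; first by exists i.
    by exists ord0 => /nx.
  have [N HN] := H l.
  have [|k kN kchi] := @digits_exist l.+1 N (fun j => chi (phi_inv C j)).
    by [].
  have [c cl Hc] := HN k kN; exists (Ordinal cl); move: Hc;
    apply: has_root_flagS => x /= [xN x0].
  rewrite kchi // phiK => cE; have -> : Ordinal cl = chi x by apply/val_inj.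
  exact: chiP.
move=> l; apply: contrapT => /forallNP Hl.
have /choice[k kP] : forall N, exists k, forall c, (c < l.+1)%N ->
    ~ has_root_flag inj p
      [set x | [/\ (phi C x < N)%N, x != 0 & digit l.+1 k (phi C x) = c]].
  move=> N; apply: contrapT => /forallNP h; apply: (Hl N) => k kN.
  have /existsNP[c /not_implyP[cl /contrapT hc]] := h k.
  by exists c.
have [U [UU Uge]] := free_ultrafilter.
have /choice[chi chiP] : forall x, exists c : 'I_l.+1,
    U [set N | digit l.+1 (k N) (phi C x) = c].
  move=> x; have [|c cl Uc] := @ultra_color U (fun N =>
    digit l.+1 (k N) (phi C x)) l.+1 UU.
    by move=> N; rewrite ltn_mod.
  by exists (Ordinal cl).
pose P (i : 'I_l.+1) := [set x : R | x != 0 /\ chi x = i].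
have Ppart : nonzero_partition P.
  split; last by move=> i j _ _ [x [[_ <-] [_ <-]]].
  apply/seteqP; split=> [x [i _ []]|x x0] //.
  by exists (chi x).
have [i [v [vi vP v0]]] := H _ P Ppart.
have UA : U [set N | forall j, (phi C (v j)
  < N)%N /\ digit l.+1 (k N) (phi C (v j)) = i].
  suff h : U [set N | forall j, j \in enum 'I_n ->
      (phi C (v j) < N)%N /\ digit l.+1 (k N) (phi C (v j)) = i].
    by apply: filterS h => N h j; apply: h; rewrite mem_enum.
  elim: (enum 'I_n) => [|j s IH]; first by apply: filterE => N j;
    rewrite in_nil.
  have [_ vj] := vP j.
  apply: filterS3 (Uge (phi C (v j)).+1) (chiP (v j)) IH => N /= h1 h2 h3 j'.
  by rewrite inE => /orP[/eqP->|/h3] //; rewrite h2 vj.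
have [N HN] := filter_ex UA.
apply: (kP N i) => //; exists v; split=> // j.
by have [h1 h2] := HN j; split=> //; have [] := vP j.
Qed.

Lemma homog_meval n (p : {mpoly R[n]}) d (r : R) (v : 'I_n -> R) :
  p \is d.-homog -> p.@[fun i => r * v i] = r ^+ d * p.@[v].
Proof.
move=> /dhomogP hp; rewrite !mevalE big_distrr /= !big_seq; apply: eq_bigr =>
  m mp.
rewrite mulrCA; congr (_ * _).
under eq_bigr do rewrite exprMn.
by rewrite big_split /= -(hp m mp) /= mdegE -prodrXr.
Qed.

Lemma has_root_flag_dilate inj n (p : {mpoly R[n]}) (B : set R) (r : R) :
  homogeneous p -> r != 0 -> has_root_flag inj p [set x | B (r * x)] ->
  has_root_flag inj p B.
Proof.
move=> [d hp] r0 [v [vi vB v0]]; exists (fun i => r * v i); split=> //.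
  by move=> /vi h i j /(mulfI r0)/h.
by rewrite (homog_meval _ _ hp) v0 mulr0.
Qed.

Lemma IMDR_finite n (p : {mpoly R[n]}) : homogeneous p -> IMDR Rr p <->
  forall e, exists2 A : {fset R}, 0 \notin A &
    forall B : {fset R}, (B `<=` A)%fset -> (#|` A| <= e.+1 * #|` B|)%N ->
    has_root_flag true p [set` B].
Proof.
move=> hp; split=> H; last first.
  move=> B /density_gt0P[F [e [Ff e0 FB]]]; apply/has_root_flagT.
  (* The proportion [1 / e] in the Folner sets becomes [1 / (2 * e)] in a dilate; the predecessor
     offsets the successor in the statement. *)
  have [A A0 HA] := H (2 * e).-1.
  have [r r0 cA] := folner_dense_translate Ff FB A0.
  apply: (has_root_flag_dilate hp r0).
  have : has_root_flag true p [set` [fset a in A | (r * a) \in B]%fset].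
    apply: HA; first by apply/fsubsetP => x; rewrite inE => /andP[].
    by rewrite prednK ?muln_gt0.
  by apply: has_root_flagS => x /=; rewrite !inE /= => /andP[_ /set_mem].
move=> e; apply: contrapT => nA.
(* Having no injective root is preserved by limits, since a root has finitely many coordinates, and
   by dilations, since [p] is homogeneous. *)
pose good B := ~ has_root_flag true p B.
have [||||B gB dB] := @dense_limit Rr R (phi_inv C) enumC good e.+1 => //.
- move=> B HB [v [vi vB v0]].
  have [B' gB' BB'] := HB [fset v i | i in 'I_n]%fset.
  apply: gB'; exists v; split=> // i; apply: BB' => //.
  by apply/imfsetP; exists i.
- by move=> B r r0 gB /(has_root_flag_dilate hp r0).
- move=> A A0; apply: contrapT => h; apply: nA; exists A => // B BA cB.
  apply: contrapT => nB; apply: h; exists [set` B] => //.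
  apply: leq_trans cB _; rewrite leq_mul2l /=;
    apply/fsubset_leq_card/fsubsetP => x xB.
  by rewrite !inE /= (fsubsetP BA) //=; apply/mem_set.
by apply: gB; apply/has_root_flagT; exact: H.
Qed.

End FiniteCharacterizations.

Lemma rec_digit {T : Type} {rT : rep T} (b j i : T -> nat) :
  recursive b -> recursive j -> recursive i ->
  recursive (fun x => digit (b x) (j x) (i x)).
Proof. by rewrite /digit => *; rec_tac. Qed.

Lemma rec_code_nvars {T : Type} {rT : rep T} (c : T -> nat) :
  recursive c -> recursive (fun x => code_nvars (c x)).
Proof. by rewrite /code_nvars => *; rec_tac. Qed.

(** * Decidable finite checks on coded polynomials *)

Section CodedPolynomials.
Local Open Scope ring_scope.
Variables (R : idomainType) (C : computable_idomain R).

#[local] Instance rep_ring : rep R := phi C.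

Section RingOperations.
Context {T : Type} {rT : rep T}.

Lemma rec_addr (f g : T -> R) :
  recursive f -> recursive g -> recursive (fun x => f x + g x).
Proof.
apply: rec_comp2; have [h ch Hh] := computable2_recursive (phi_add C).
exists h => // -[x y]; have := Hh (phi C x, phi C y).
by rewrite /= !phiK.
Qed.

Lemma rec_mulr (f g : T -> R) :
  recursive f -> recursive g -> recursive (fun x => f x * g x).
Proof.
apply: rec_comp2; have [h ch Hh] := computable2_recursive (phi_mul C).
exists h => // -[x y]; have := Hh (phi C x, phi C y).
by rewrite /= !phiK.
Qed.

Lemma rec_phi_inv (f : T -> nat) :
  recursive f -> recursive (fun x => phi_inv C (f x)).
Proof. by case=> g cg Hg; exists g => // x; rewrite Hg [RHS]phi_invK. Qed.

Lemma rec_phi (f : T -> R) : recursive f -> recursive (fun x => phi C (f x)).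
Proof. by case=> g cg Hg; exists g => // x; rewrite Hg. Qed.

Lemma rec_eqr (f g : T -> R) :
  recursive f -> recursive g -> recursive (fun x => f x == g x).
Proof.
move=> rf rg; have := rec_eqn (rec_phi rf) (rec_phi rg); apply: eq_rec => x.
by rewrite (can_eq (phiK C)).
Qed.

End RingOperations.

Ltac rec_local ::=
  match goal with
  | |- recursive (fun x => digit (@?b x) (@?j x) (@?i x)) =>
     apply: (rec_digit (b := b) (j := j) (i := i))
  | |- recursive (fun x => code_nvars (@?f x)) => apply: (rec_code_nvars (c :=
    f))
  | |- recursive (fun x => (@?f x + @?g x)%R) => apply: (rec_addr (f :=
    f) (g := g))
  | |- recursive (fun x => (@?f x * @?g x)%R) => apply: (rec_mulr (f :=
    f) (g := g))
  | |- recursive (fun x => phi_inv C (@?f x)) => apply: (rec_phi_inv (f := f))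
  | |- recursive (fun x => phi C (@?f x)) => apply: (rec_phi (f := f))
  | |- recursive (fun x => @eq_op _ (@?f x) (@?g x)) => apply: (rec_eqr (f :=
    f) (g := g))
  end.

Definition term_coef (t : nat) : R := phi_inv C (head 0%N (CodeSeq.decode t)).

Definition term_exp (t i : nat) : nat := nth 0%N (behead (CodeSeq.decode t)) i.

Definition terms (c : nat) : seq nat := behead (CodeSeq.decode c).

Definition eval_code (c : nat) (v : nat -> R) : R :=
  foldl (fun acc t => acc + term_coef t *
    iteri (code_nvars c) (fun i y => y * iter (term_exp t i) ( *%R (v i)) 1) 1)
    0 (terms c).

Lemma foldl_sum (s : seq nat) (F : nat -> R) :
  foldl (fun acc t => acc + F t) 0 s = \sum_(t <- s) F t.
Proof.
suff H a : foldl (fun acc t => acc + F t) a s = a + \sum_(t <- s) F t.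
  by rewrite H add0r.
elim: s a => [|t s IH] a; first by rewrite big_nil addr0.
by rewrite big_cons addrA -IH.
Qed.

Lemma eval_codeP c (v : 'I_(code_nvars c) -> R) (w : nat -> R) :
  (forall i, v i = w i) -> (mpoly_of_code C c).@[v] = eval_code c w.
Proof.
move=> vw; rewrite /eval_code foldl_sum /mpoly_of_code raddf_sum /=.
apply: eq_bigr => t _; rewrite mevalZ mevalX; congr (_ * _).
have H n (F : nat -> R) : iteri n (fun i y => y * F i) 1 = \prod_(i < n) F i.
  by elim: n => [|n IH]; rewrite ?big_ord0 // big_ord_recr /= IH.
rewrite H; apply: eq_bigr => i _; rewrite mnmE vw -/(term_exp t i).
by elim: (term_exp t i) => //= e <-; rewrite exprS.
Qed.

Lemma rec_eval_code {T : Type} {rT : rep T} (c : T -> nat) (w : T -> nat -> R) :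
  recursive c -> recursive (fun p : T * nat => w p.1 p.2) ->
  recursive (fun x => eval_code (c x) (w x)).
Proof.
move=> rc rw; rewrite /eval_code /term_coef /term_exp /terms /code_nvars.
by rec_tac.
Qed.

(* [digit N j] runs through all the points of [{0, ..., N - 1}^n] as [j] runs
   through the numbers below [N ^ n]. *)
Definition root_code (inj : bool) (c : nat) (S : nat -> bool) (N :
  nat) : bool :=
  let n := code_nvars c in
  has (fun j => [&& all (fun i => S (digit N j i)) (iota 0 n),
    inj ==> all (fun i => all (fun i' =>
      (digit N j i == digit N j i') ==> (i == i')) (iota 0 n)) (iota 0 n) &
    eval_code c (fun i => phi_inv C (digit N j i)) == 0]) (iota 0 (N ^ n)).

Lemma root_codeP inj c (S : nat -> bool) N : (forall t, S t -> (t < N)%N) ->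
  root_code inj c S N <->
  has_root_flag inj (mpoly_of_code C c) [set x | S (phi C x)]%classic.
Proof.
move=> SN.
have ord_iota (i : 'I_(code_nvars c)) : (i : nat) \in iota 0 (code_nvars c).
  by rewrite mem_iota add0n ltn_ord.
split.
  case/hasP=> j _ /and3P[/allP Sj /implyP injj /eqP e0].
  exists (fun i => phi_inv C (digit N j i)); split=> [/injj/allP h i i'|i|].
  - move/(can_inj (phi_invK C)) => E; apply/val_inj/eqP.
    have /allP h' := h i (ord_iota i).
    have /implyP := h' i' (ord_iota i').
    by apply; rewrite E.
  - by rewrite /= phi_invK; apply: Sj; exact: ord_iota.
  by rewrite (eval_codeP (w := fun i => phi_inv C (digit N j i))).
case=> v [vi vS v0].
pose f i := if insub i is Some k then phi C (v k) else 0%N.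
have fE (i : 'I_(code_nvars c)) : f i = phi C (v i) by rewrite /f valK.
have [i ni|j jN Hj] := @digits_exist N (code_nvars c) f.
  by rewrite -[i]/(val (Ordinal ni)) fE SN //; exact: vS.
have {}Hj (i : 'I_(code_nvars c)) : digit N j i = phi C (v i) by rewrite Hj.
apply/hasP; exists j; first by rewrite mem_iota.
apply/and3P; split.
- apply/allP => i; rewrite mem_iota => /= ni.
  by rewrite -[i]/(val (Ordinal ni)) Hj; exact: vS.
- apply/implyP => /vi {}vi; apply/allP => i; rewrite mem_iota => /= ni.
  apply/allP => i'; rewrite mem_iota => /= ni'; apply/implyP.
  rewrite -[i]/(val (Ordinal ni)) -[i']/(val (Ordinal ni')) !Hj.
  by move=> /eqP/(can_inj (phiK C))/vi ->.
by rewrite -(eval_codeP (v := v)) ?v0 // => i; rewrite Hj phiK.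
Qed.

Lemma rec_root_code {T : Type} {rT : rep T} inj (c N : T -> nat)
    (S : T -> nat -> bool) :
  recursive c -> recursive (fun p : T * nat => S p.1 p.2) -> recursive N ->
  recursive (fun x => root_code inj (c x) (S x) (N x)).
Proof.
move=> rc rS rN; rewrite /root_code; cbv zeta.
by rec_tac; apply: rec_eval_code; rec_tac.
Qed.

Definition PR_check (inj : bool) (c l N : nat) : bool :=
  all (fun k => has (fun col => root_code inj c
        (fun t => [&& (t < N)%N, t != phi C 0 & digit l.+1 k t == col]) N)
    (iota 0 l.+1)) (iota 0 (l.+1 ^ N)%N).

Lemma PR_checkP inj c : PR_flag inj (mpoly_of_code C c) <->
  forall l, exists N, PR_check inj c l N.
Proof.
rewrite (PR_flag_finite C).
have E l N k col : root_code inj c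
     (fun t => [&& (t < N)%N, t != phi C 0 & digit l.+1 k t == col]) N <->
   has_root_flag inj (mpoly_of_code C c)
      [set x | [/\ (phi C x < N)%N, x != 0 & digit l.+1 k (phi C x)
        = col]]%classic.
  rewrite root_codeP; last by move=> t /and3P[].
  split; apply: has_root_flagS => x /=; rewrite (can_eq (phiK C)).
    by case/and3P=> -> -> /eqP->.
  by case=> -> -> ->; rewrite eqxx.
split=> H l; have [N HN] := H l; exists N.
  apply/allP => k; rewrite mem_iota add0n => kN; have [col cl /E] := HN k kN.
  by move=> Hc; apply/hasP; exists col => //; rewrite mem_iota.
move=> k kN; have /allP HN' := HN; have /hasP[col] :=
  HN' k ltac:(by rewrite mem_iota).
by rewrite mem_iota add0n => /= cl /E; exists col.
Qed.

Lemma rec_PR_check inj :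
  recursive (fun p : nat * nat * nat => PR_check inj p.1.1 p.1.2 p.2).
Proof.
by rewrite /PR_check; rec_tac; apply: rec_root_code; rec_tac.
Qed.

(** [m] codes a pair of [N] and [a]: the binary digits of [a] select the finite set among the
    nonzero elements of code below [N], and those of [b] select its subsets. *)
Definition IMDR_check (c e m : nat) : bool :=
  let N := (Cantor.of_nat m).1 in let a := (Cantor.of_nat m).2 in
  all (fun b =>
    (count (fun t => (t != phi C 0) && (digit 2 a t == 1%N)) (iota 0 N) <=
     e.+1 * count (fun t => [&& t != phi C 0, digit 2 a t == 1%N &
                                digit 2 b t == 1%N]) (iota 0 N))%N ==>
    root_code true c (fun t => [&& (t < N)%N, t != phi C 0, digit 2 a t == 1%N &
                                   digit 2 b t == 1%N]) N) (iota 0 (2 ^ N)%N).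

Lemma rec_IMDR_check :
  recursive (fun p : nat * nat * nat => IMDR_check p.1.1 p.1.2 p.2).
Proof.
by rewrite /IMDR_check; cbv zeta; rec_tac; apply: rec_root_code; rec_tac.
Qed.

Lemma IMDR_checkP (Rr : realType) c : homogeneous (mpoly_of_code C c) ->
  IMDR Rr (mpoly_of_code C c) <-> forall e, exists m, IMDR_check c e m.
Proof.
move=> hp; rewrite (IMDR_finite Rr C hp).
have cnt N (P : pred nat) (A : {fset R}) :
    (forall x, (x \in A) = (phi C x < N)%N && P (phi C x)) ->
    count P (iota 0 N) = #|` A|.
  move=> AE; rewrite -size_filter -(size_map (phi_inv C)).
  apply/perm_size/uniq_perm; rewrite ?fset_uniq //.
    by rewrite (map_inj_uniq (can_inj (phi_invK C))) filter_uniq ?iota_uniq.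
  move=> x; rewrite -{1}(phiK C x) (mem_map (can_inj (phi_invK C))).
  by rewrite mem_filter mem_iota /= add0n andbC -AE.
split=> H e.
  have [A A0 HA] := H e.
  have [N AN] : exists N, forall x, x \in A -> (phi C x < N)%N.
    by exists (\max_(x <- A) phi C x).+1 => x xA; rewrite ltnS leq_bigmax_seq.
  have [|a aN Ha] := @digits_exist 2 N (fun t => phi_inv C t \in A).
    by move=> i _; case: (_ \in _).
  have Ha' x : (x \in A) =
      [&& (phi C x < N)%N, phi C x != phi C 0 & digit 2 a (phi C x) == 1%N].
    apply/idP/and3P => [xA|[xN _]]; last first.
      by rewrite Ha // phiK; case: (x \in A).
    split; first exact: AN.
      by rewrite (can_eq (phiK C)); apply: contraNneq A0 => <-.
    by rewrite Ha ?AN // phiK xA.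
  exists (pairN N a); rewrite /IMDR_check of_pairN /=.
  apply/allP => b _; apply/implyP.
  pose B := [fset x in A | digit 2 b (phi C x) == 1%N]%fset.
  have HB x : (x \in B) = [&& (phi C x < N)%N, phi C x != phi C 0,
      digit 2 a (phi C x) == 1%N & digit 2 b (phi C x) == 1%N].
    by rewrite !inE /= Ha' -!andbA.
  rewrite (cnt N _ A) ?(cnt N _ B) // => le_AB.
  have BA : (B `<=` A)%fset by apply/fsubsetP => x; rewrite inE => /andP[].
  apply/root_codeP; first by move=> t /andP[].
  by have := HA B BA le_AB; apply: has_root_flagS => x /=; rewrite HB.
have [m] := H e; rewrite /IMDR_check.
move: (Cantor.of_nat m).1 (Cantor.of_nat m).2 => N a /allP Hm.
pose P t := (t != phi C 0) && (digit 2 a t == 1%N).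
pose A := [fset x in [seq phi_inv C t | t <- iota 0 N] | P (phi C x)]%fset.
have Ha x : (x \in A) = (phi C x < N)%N && P (phi C x).
  rewrite !inE /= -{1}(phiK C x) (mem_map (can_inj (phi_invK C))).
  by rewrite mem_iota.
exists A; first by rewrite Ha /P eqxx andbF.
move=> B BA le_AB.
have [|b bN Hb] := @digits_exist 2 N (fun t => phi_inv C t \in B).
  by move=> i _; case: (_ \in _).
have HB x : (x \in B) = (phi C x < N)%N && [&& phi C x != phi C 0,
    digit 2 a (phi C x) == 1%N & digit 2 b (phi C x) == 1%N].
  apply/idP/idP => [xB|/and4P[xN _ _]]; last first.
    by rewrite Hb // phiK; case: (x \in B).
  have := fsubsetP BA x xB; rewrite Ha => /and3P[xN -> ->] /=.
  by rewrite xN Hb // phiK xB.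
have /implyP := Hm b ltac:(by rewrite mem_iota).
rewrite (cnt N _ A) ?(cnt N _ B) // => /(_ le_AB) /root_codeP h.
have {}h := h (fun t Ht => proj1 (andP Ht)).
by apply: has_root_flagS h => x /=; rewrite HB.
Qed.

Definition same_monomial (c t t' : nat) : bool :=
  all (fun i => term_exp t i == term_exp t' i) (iota 0 (code_nvars c)).

(** A code may repeat a monomial, possibly with cancellation, so the true coefficient sums over all
    terms with the same exponents. *)
Definition coef_code (c t : nat) : R :=
  foldl (fun acc t' => acc + if same_monomial c t t' then term_coef t' else 0)
    0 (terms c).

Definition deg_code (c t : nat) : nat :=
  iteri (code_nvars c) (fun i d => (d + term_exp t i)%N) 0%N.

Definition homog_check (c : nat) : bool :=
  all (fun j => all (fun j' =>
    ((coef_code c (nth 0 (terms c) j)%N != 0)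
      && (coef_code c (nth 0 (terms c) j')%N != 0))
    ==> (deg_code c (nth 0 (terms c) j)%N == deg_code c (nth 0 (terms c) j')%N))
   (iota 0 (size (terms c)))) (iota 0 (size (terms c))).

Definition term_mnm (c t : nat) : 'X_{1..code_nvars c} :=
  [multinom term_exp t i | i < code_nvars c].

Lemma coef_codeE c t : (mpoly_of_code C c)@_(term_mnm c t) = coef_code c t.
Proof.
rewrite /coef_code foldl_sum /mpoly_of_code raddf_sum /=; apply: eq_bigr =>
  t' _.
rewrite mcoeffZ mcoeffX -/(term_coef t').
rewrite (_ : (_ == _) = same_monomial c t t'); last first.
  apply/eqP/allP => [E i|H].
    rewrite mem_iota add0n => /= ni; have := congr1 (fun m : 'X_{1.._} =>
      m (Ordinal ni)) E.
    by rewrite !mnmE => /eqP; rewrite eq_sym.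
  apply/mnmP => i; rewrite !mnmE; apply/eqP; rewrite eq_sym; apply: H.
  by rewrite mem_iota add0n ltn_ord.
by case: same_monomial; rewrite ?mulr1 ?mulr0.
Qed.

Lemma deg_codeE c t : mdeg (term_mnm c t) = deg_code c t.
Proof.
rewrite mdegE /deg_code; under eq_bigr do rewrite mnmE.
by elim: (code_nvars c) => [|n IH]; rewrite ?big_ord0 // big_ord_recr /= IH.
Qed.

Lemma msupp_code c m : m \in msupp (mpoly_of_code C c) ->
  exists2 j, (j < size (terms c))%N & m = term_mnm c (nth 0%N (terms c) j).
Proof.
rewrite mcoeff_msupp; apply: contraNP => H.
rewrite /mpoly_of_code raddf_sum /= big_seq big1 // => t ts.
rewrite mcoeffZ mcoeffX; case: eqP => [E|_]; last by rewrite mulr0.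
case: H; exists (index t (terms c)); first by rewrite index_mem.
by rewrite nth_index // -E.
Qed.

Lemma homog_checkP c : homog_check c <-> homogeneous (mpoly_of_code C c).
Proof.
split=> [/allP H|[d /dhomogP H]]; last first.
  apply/allP => j _; apply/allP => j' _; apply/implyP => /andP[].
  rewrite -!coef_codeE -!deg_codeE -!mcoeff_msupp => /H -> /H ->.
  by [].
case E : (msupp (mpoly_of_code C c)) => [|m0 s].
  (* The zero polynomial counts as homogeneous, in degree 0 for instance. *)
  by exists 0%N; rewrite (msuppnil0 E); apply: rpred0.
have m0s : m0 \in msupp (mpoly_of_code C c) by rewrite E mem_head.
have [j js mj] := msupp_code m0s.
exists (mdeg m0); apply/dhomogP => m ms; have [j' js' mj'] := msupp_code ms.
have /allP/(_ j) := H j' ltac:(by rewrite mem_iota).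
rewrite mem_iota => /(_ js) /implyP; rewrite -!coef_codeE -!deg_codeE -mj -mj'.
by rewrite -!mcoeff_msupp ms m0s => /(_ isT)/eqP.
Qed.

Lemma rec_homog_check : recursive homog_check.
Proof.
rewrite /homog_check /coef_code /deg_code /same_monomial /term_coef /term_exp /terms.
by rec_tac.
Qed.

Lemma PR_flagE n (p : {mpoly R[n]}) : PR p <-> PR_flag false p.
Proof.
by split=> H l P /H[i Pi]; exists i; apply/has_root_flagF.
Qed.

Lemma IPR_flagE n (p : {mpoly R[n]}) : IPR p <-> PR_flag true p.
Proof.
by split=> H l P /H[i Pi]; exists i; apply/has_root_flagT.
Qed.

Lemma Pi2_PR_flag inj (A : set nat) :
  (forall c, A c <-> PR_flag inj (mpoly_of_code C c)) -> Pi2 A.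
Proof.
move=> AE; apply/Pi2P; exists (PR_check inj); first exact: rec_PR_check.
by move=> c; rewrite AE PR_checkP.
Qed.

(** Homogeneity is decidable and can be absorbed into the matrix of the formula, so [chi] only has
    to be correct on homogeneous polynomials, as is the case in [IMDR_checkP]. *)
Lemma Pi2_homogeneous (A : set nat) (chi : nat -> nat -> nat -> bool) :
  recursive (fun p : nat * nat * nat => chi p.1.1 p.1.2 p.2) ->
  (forall c, homogeneous (mpoly_of_code C c) ->
     A c <-> forall m, exists k, chi c m k) ->
  (forall c, A c -> homogeneous (mpoly_of_code C c)) -> Pi2 A.
Proof.
move=> rchi AE AH; have rh := rec_homog_check.
apply/Pi2P; exists (fun c m k => homog_check c && chi c m k).
  by rec_tac.
move=> c; split=> [Ac|H].
  have hc := AH c Ac; move/(AE c hc): (Ac) => H m; have [k Hk] := H m.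
  by exists k; rewrite Hk (homog_checkP c).2.
have hc : homogeneous (mpoly_of_code C c).
  by have [k /andP[/homog_checkP]] := H 0%N.
by apply/(AE c hc) => m; have [k /andP[]] := H m; exists k.
Qed.

End CodedPolynomials.

(** * Homogenized master polynomials *)

(** The identity behind the homogenization, for one monomial: [P] stands for the product of the
    powers of the [u_j - v_j], and [S] for the sum of their exponents. *)
Lemma clear_denominators (F : fieldType) (x y P d : F) (a S D : nat) :
  (y != 0 -> d != 0 -> (a <= D)%N -> (S <= D)%N ->
   x ^+ a * y ^+ (D - a) * P * d ^+ (D - S) =
   (y * d) ^+ D * ((x / y) ^+ a * (P / d ^+ S)))%R.
Proof.
move=> y0 d0 aD SD; rewrite exprMn expr_div_n.
have -> : (y ^+ D = y ^+ (D - a) * y ^+ a)%R by rewrite -exprD subnK.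
have -> : (d ^+ D = d ^+ (D - S) * d ^+ S)%R by rewrite -exprD subnK.
have ya := expf_neq0 a y0; have dS := expf_neq0 S d0.
by field; rewrite ya dS.
Qed.

Section Homogenization.
Local Open Scope ring_scope.
Variables (R : idomainType).
Local Notation "x %:F" := (@tofrac R x).

Lemma fracP (x : {fraction R}) : exists n d : R, d != 0 /\ x = n%:F / d%:F.
Proof.
elim/quotW: x => r; exists r.1, r.2; have d0 := denom_ratioP r; split=> //.
have d0' : r.2%:F != 0 by rewrite tofrac_eq0.
apply: (mulIf d0'); rewrite divfK // -[_ * _]/(FracField.mul _ _) !piE.
apply/eqP; rewrite FracField.equivf_def /FracField.mulf.
by rewrite !numden_Ratio ?mulr1 ?oner_neq0 // mulrC.
Qed.

Lemma common_denominator (s : seq {fraction R}) : exists2 d : R, d != 0 &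
  forall x, x \in s -> exists a : R, x = a%:F / d%:F.
Proof.
elim: s => [|y s [d d0 IH]]; first by exists 1; rewrite ?oner_neq0 // => x;
  rewrite in_nil.
have [n [e [e0 yE]]] := fracP y; exists (d * e); first by rewrite mulf_neq0.
move=> x; rewrite inE => /orP[/eqP->|/IH[a ->]].
  by exists (d * n); rewrite yE !tofracM -mulf_div divff ?mul1r ?tofrac_eq0.
by exists (a * e); rewrite !tofracM -mulf_div divff ?mulr1 ?tofrac_eq0.
Qed.

Lemma meval_map_frac l (q : {mpoly R[l]}) (w : 'I_l -> {fraction R}) :
  (map_mpoly (@tofrac R) q).@[w] =
  \sum_(m <- msupp q) (q@_m)%:F * \prod_(i < l) w i ^+ m i.
Proof.
rewrite /map_mpoly {1}/mmap raddf_sum /=; apply: eq_bigr => m _.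
by rewrite mevalM mevalC mmap1_id mevalX.
Qed.

Variables (k : nat) (p : {mpoly R[k.+2]}).
Let n := (4 + (k + k))%N.

(* The variables are [x], [y], [w], [t] (in this order, through [ix_base]),
   [u_1], ..., [u_k] and [v_1], ..., [v_k]. *)
Definition ix_base (i : 'I_4) : 'I_n := lshift (k + k) i.
Definition ix_u (j : 'I_k) : 'I_n := rshift 4 (lshift k j).
Definition ix_v (j : 'I_k) : 'I_n := rshift 4 (rshift k j).

Let mX (m : 'X_{1..k.+2}) : nat := m (lift ord0 ord0).
Let mZ (m : 'X_{1..k.+2}) (j : 'I_k) : nat := m (lift ord0 (lift ord0 j)).

(** This comes from substituting [x / y] and the [(u_j - v_j) / Delta] for all variables but the
    first and multiplying by [(y * Delta) ^ msize p]. As [msize p] bounds the exponents, the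
    subtractions are exact, and for linear [Delta] every monomial gets degree [2 * msize p]. *)
Definition homogenized_monomial (Delta : {mpoly R[n]}) (m : 'X_{1..k.+2}) :
    {mpoly R[n]} :=
  'X_(ix_base 0) ^+ mX m * 'X_(ix_base 1) ^+ (msize p - mX m) *
  (\prod_j ('X_(ix_u j) - 'X_(ix_v j)) ^+ mZ m j) *
  Delta ^+ (msize p - \sum_j mZ m j).

Definition homogenized (Delta : {mpoly R[n]}) (a : R) : {mpoly R[n]} :=
  \sum_(m <- msupp p) (p@_m * a ^+ m ord0) *: homogenized_monomial Delta m.

Lemma mX_sumZ_le m : m \in msupp p ->
  (mX m <= msize p)%N /\ (\sum_j mZ m j <= msize p)%N.
Proof.
move=> /msize_mdeg_lt; rewrite mdegE 2!big_ord_recl -/(mX m).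
by move=> /ltnW h; split; apply: leq_trans h;
  [rewrite addnCA leq_addr|rewrite addnA leq_addl].
Qed.

Lemma homogenized_homog Delta a : Delta \is 1.-homog ->
  homogeneous (homogenized Delta a).
Proof.
move=> hD; exists (msize p + msize p)%N.
rewrite /homogenized big_seq; apply: rpred_sum => m /mX_sumZ_le[leX leZ].
apply: rpredZ; rewrite /homogenized_monomial.
have hX i : ('X_i : {mpoly R[n]}) \is 1.-homog by rewrite dhomogX /= mdeg1.
have hpow (q : {mpoly R[n]}) e : q \is 1.-homog -> q ^+ e \is e.-homog.
  by move=> hq; have := dhomogMn e hq; rewrite mul1n.
have hprod (s : seq 'I_k) : \prod_(j <- s)
  ('X_(ix_u j) - 'X_(ix_v j) : {mpoly R[n]}) ^+ mZ m j \is
    ((\sum_(j <- s) mZ m j)%N).-homog.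
  elim: s => [|j s IH]; rewrite ?big_nil ?big_cons; first exact: dhomog1.
  apply: dhomogM IH; apply: hpow.
  by apply: rpredB; apply: hX.
have -> : (msize p + msize p = mX m + (msize p - mX m) + \sum_j mZ m j +
    (msize p - \sum_j mZ m j))%N by rewrite -addnA !subnKC.
apply: dhomogM; last exact: hpow.
apply: dhomogM; last exact: hprod.
by apply: dhomogM; apply: hpow; apply: hX.
Qed.

Lemma homogenizedE Delta a (v : 'I_n -> R) :
  v (ix_base 1) != 0 -> Delta.@[v] != 0 ->
  ((homogenized Delta a).@[v] == 0) = 
  ((map_mpoly (@tofrac R) p).@[tnth [tuple of [:: a%:F,
    (v (ix_base 0))%:F / (v (ix_base 1))%:F &
    [tuple (v (ix_u j) - v (ix_v j))%:F / (Delta.@[v])%:F | j < k]]]] == 0).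
Proof.
move=> y0 d0; set w := tnth _.
have w0 : w ord0 = a%:F by rewrite /w (tnth_nth 0).
have w1 : w (lift ord0 ord0) = (v (ix_base 0))%:F / (v (ix_base 1))%:F.
  by rewrite /w (tnth_nth 0).
have wZ j : w (lift ord0 (lift ord0 j)) =
    (v (ix_u j) - v (ix_v j))%:F / (Delta.@[v])%:F.
  rewrite /w (tnth_nth 0) /= -[RHS](tnth_mktuple (fun j =>
    (v (ix_u j) - v (ix_v j))%:F / (Delta.@[v])%:F)) (tnth_nth 0) /=.
  by rewrite /bump.
rewrite -tofrac_eq0.
suff -> : ((homogenized Delta a).@[v])%:F =
    ((v (ix_base 1))%:F * (Delta.@[v])%:F) ^+ msize p *
    (map_mpoly (@tofrac R) p).@[w].
  by rewrite mulf_eq0 expf_eq0 mulf_eq0 !tofrac_eq0 (negPf y0)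
    (negPf d0) /= andbF.
have tX (x : R) e : (x ^+ e)%:F = x%:F ^+ e by rewrite rmorphXn.
rewrite meval_map_frac big_distrr /=.
rewrite /homogenized (raddf_sum (meval v)) (raddf_sum (@tofrac R)) /=.
rewrite big_seq [RHS]big_seq; apply: eq_bigr => m /mX_sumZ_le[leX leZ].
rewrite mevalZ tofracM.
have -> : \prod_(i < k.+2) w i ^+ m i = a%:F ^+ m ord0 *
   (((v (ix_base 0))%:F / (v (ix_base 1))%:F) ^+ mX m *
    ((\prod_j (v (ix_u j) - v (ix_v j))%:F ^+ mZ m j) /
     (Delta.@[v])%:F ^+ (\sum_j mZ m j))).
  rewrite 2!big_ord_recl w0 w1; congr (_ * (_ * _)).
  rewrite -prodrXr -prodf_div; apply: eq_bigr => j _.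
  by rewrite wZ expr_div_n.
have -> : ((homogenized_monomial Delta m).@[v])%:F =
   (v (ix_base 0))%:F ^+ mX m * (v (ix_base 1))%:F ^+ (msize p - mX m) *
   (\prod_j (v (ix_u j) - v (ix_v j))%:F ^+ mZ m j) *
   (Delta.@[v])%:F ^+ (msize p - \sum_j mZ m j).
  rewrite /homogenized_monomial !mevalM !tofracM !rmorphXn /= !mevalXU.
  congr (_ * _ * _ * _); rewrite !rmorph_prod /=; apply: eq_bigr => j _.
  by rewrite !rmorphXn /= mevalB !mevalXU.
rewrite (@clear_denominators _ _ _ _ _ (mX m)) ?tofrac_eq0 // !tofracM tX.
by rewrite mulrCA -!mulrA.
Qed.

End Homogenization.

(** * Computable codes of homogenized polynomials *)

Section SparseCodes.
Local Open Scope ring_scope.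
Variables (R : idomainType) (C : computable_idomain R).

#[local] Instance rep_ringC : rep R := rep_ring C.

#[local] Arguments CodeSeq.code : simpl never.

(** [L] lists coefficients, powers of the parameter and exponents. It is fixed during the reduction,
    where only the parameter [a = f m] varies, so the code is computable in [m]. *)
Definition sparse_poly n (L : seq (R * nat * seq nat)) (a : R) : {mpoly R[n]} :=
  \sum_(u <- L) (u.1.1 * a ^+ u.1.2) *: 'X_[[multinom nth 0%N u.2 i | i < n]].

Definition sparse_code (n : nat) (L : seq (R * nat * seq nat)) (a : R) : nat :=
  CodeSeq.code (n :: [seq CodeSeq.code (phi C (u.1.1 * a ^+ u.1.2)
    :: u.2) | u <- L]).

Lemma code_set_sparse (P : forall n, {mpoly R[n]} -> Prop) n L a :
  code_set C P (sparse_code n L a) <-> P n (sparse_poly n L a).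
Proof.
(* The number of variables depends on the code; abstracting over the decoded list makes it possible
   to rewrite with [CodeSeq.codeK] inside the dependent type. *)
pose poly_of (s : seq nat) : {mpoly R[head 0%N s]} :=
  \sum_(t <- behead s)
    let u := CodeSeq.decode t in
    phi_inv C (head 0%N u) *:
      'X_[[multinom nth 0%N (behead u) i | i < head 0%N s]].
have -> : code_set C P (sparse_code n L a) =
   P _ (poly_of (CodeSeq.decode (sparse_code n L a))) by [].
rewrite CodeSeq.codeK /poly_of /= big_map.
rewrite (_ : \sum_(u <- L) _ = sparse_poly n L a) //.
by apply: eq_bigr => u _; rewrite CodeSeq.codeK /= phiK.
Qed.

Lemma rec_sparse_code n L (f : nat -> R) :
  recursive f -> recursive (fun m => sparse_code n L (f m)).
Proof.
move=> rf; rewrite /sparse_code; apply: rec_code; apply: rec_cons.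
  exact: rec_const.
elim: L => [|u L IH] /=; first exact: rec_const.
apply: rec_cons IH; apply: rec_code; apply: rec_cons; last exact: rec_const.
apply: rec_phi; apply: rec_mulr; first exact: rec_const.
apply: (eq_rec (f := fun m => iter u.1.2 ( *%R (f m)) 1)).
  by move=> m; elim: (u.1.2) => //= e ->; rewrite exprS.
apply: rec_iter; [exact: rec_const| |exact: rec_const].
by apply: rec_mulr; [apply: (rec_comp rf);
  exact: rec_fst rec_id|exact: rec_snd rec_id].
Qed.

Lemma homogenized_sparse k (p : {mpoly R[k.+2]}) Delta :
  exists L, forall a, homogenized p Delta a = sparse_poly _ L a.
Proof.
pose Q := homogenized_monomial p Delta.
exists (flatten [seq [seq (p@_m * (Q m)@_m', m ord0,
  [seq m' i | i <- enum 'I_(4 + (k + k))])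
    | m' <- msupp (Q m)] | m <- msupp p]).
move=> a; rewrite /sparse_poly /homogenized big_flatten /= big_map.
apply: eq_bigr => m _;
  rewrite big_map {1}[homogenized_monomial _ _ _]mpolyE scaler_sumr.
apply: eq_bigr => m' _ /=; rewrite scalerA mulrAC; congr (_ *: 'X_[_]).
apply/mnmP => i; rewrite mnmE (nth_map i) ?size_enum_ord // nth_ord_enum.
by [].
Qed.

End SparseCodes.

(** * From master polynomials to the data of the reduction *)

Section Settings.
Local Open Scope ring_scope.
Variables (R : idomainType) (C : computable_idomain R).
Local Notation K := {fraction R}.
Local Notation "x %:F" := (@tofrac R x).

(* What the reduction uses of an additive or multiplicative master polynomial:
   [t] is the code of the value of [g], and [t0] that of its neutral element. *)
Record reduction_data (A : set nat) (k : nat) (p : {mpoly R[k.+2]})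
    (f : nat -> R) (t : K -> nat) (t0 : nat) : Prop := ReductionData {
  data_computable : computable (fun n => phi C (f n));
  data_root : forall m b, A m -> b != 0 -> t b <> t0 ->
    exists2 z : k.-tuple K, (forall i, tnth z i != 0)
      & frac_root p (f m)%:F b z;
  data_noroot : forall m, ~ A m -> exists N, forall b z, b != 0 ->
    t b = t0 \/ (N <= t b)%N -> ~ frac_root p (f m)%:F b z;
  data_coloring : forall N, exists l (chi : K ->
    nat), (forall x, (chi x < l)%N) /\
    forall x y, x != 0 -> y != 0 -> chi x = chi y ->
      t (x / y) = t0 \/ (N <= t (x / y))%N;
  data_one : t 1 = t0;
  data_power : exists2 r : R, r != 0 & forall i, (0 < i)%N ->
    t (r%:F ^+ i) <> t0
}.

Definition bounded_search (chi : nat -> nat -> nat -> bool) (m e s :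
  nat) : bool :=
  all (fun x => has (chi m x) (iota 0 s)) (iota 0 e.+1).

Lemma bounded_searchP chi m e : (exists s, bounded_search chi m e s) <->
  forall x, (x <= e)%N -> exists y, chi m x y.
Proof.
split=> [[s /allP H] x xe|H].
  by have /hasP[y _ ?] := H x ltac:(by rewrite mem_iota); exists y.
have /choice[y Hy] : forall x, exists y, (x <= e)%N -> chi m x y.
  by move=> x; case: (leqP x e) => [/H[y]|]; [exists y|exists 0%N].
exists (\max_(x < e.+1) y x).+1; apply/allP => x; rewrite mem_iota add0n => xe.
apply/hasP; exists (y x); last exact: Hy.
by rewrite mem_iota add0n ltnS (leq_bigmax (Ordinal xe)).
Qed.

Lemma Sigma1_bounded_search (T : Type) (enc : T -> nat) chi (e0 : nat) :
  recursive (fun p : nat * nat * nat => chi p.1.1 p.1.2 p.2) ->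
  Sigma1_rel enc (fun m n => enc n <> e0 /\ exists s,
    bounded_search chi m (enc n) s).
Proof.
move=> rchi.
exists (fun q => (Cantor.of_nat q).2 <> e0 /\
  exists s, bounded_search chi (Cantor.of_nat q).1 (Cantor.of_nat q).2 s).
  apply/Sigma1P; exists (fun q s => ((Cantor.of_nat q).2 != e0) &&
    bounded_search chi (Cantor.of_nat q).1 (Cantor.of_nat q).2 s).
    rewrite /bounded_search; rec_tac.
    by apply: (rec_comp (g := fun p : nat * nat * nat * nat =>
      ((Cantor.of_nat p.1.1.1).1, p.1.2, p.2)) rchi); rec_tac.
  move=> q; split=> [[/eqP ne [s Hs]]|[s /andP[/eqP ne Hs]]].
    by exists s; rewrite ne.
  by split=> //; exists s.
by move=> m n; rewrite of_pairN.
Qed.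

Lemma reduction_data_exists (T : Type) (enc : T -> nat) (n0 : T) (A : set nat)
    (chi : nat -> nat -> nat -> bool) k (p : {mpoly R[k.+2]}) (f : nat -> R)
    (g : K -> T) :
  (forall m, A m <-> forall x, exists y, chi m x y) ->
  computable (fun n => phi C (f n)) ->
  master_equivalence
    (fun m n => enc n <> enc n0 /\ exists s,
      bounded_search chi m (enc n) s) p f g ->
  injective enc -> g 1 = n0 ->
  (forall a b, a != 0 -> b != 0 -> g a = n0 -> g b = n0 -> g (a / b) = n0) ->
  (exists2 b, b != 0 & forall i, (0 < i)%N -> g (b ^+ i) <> n0) ->
  (forall n, n <> n0 -> exists l (chi : K -> nat), (forall x, (chi x < l)%N) /\
    forall x y, x != 0 -> y != 0 -> chi x = chi y -> g (x / y) <> n) ->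
  reduction_data A p f (enc \o g) (enc n0).
Proof.
move=> AE cf master enc_inj g1 gker [b b0 bpow] gcol; split=> //=.
- move=> m c Am c0 tc.
  have [S1 _] := master m (g c); apply: (S1.1 _ c (erefl _)); split=> //.
  by apply/bounded_searchP => x _; exact: ((AE m).1 Am x).
- move=> m nAm.
  have [x Hx] : exists x, forall y, ~ chi m x y.
    apply: contrapT => /forallNP H; apply: nAm; apply/AE => x.
    by have /existsNP[y /contrapT] := H x; exists y.
  (* A value of code at least [x] requires a witness for this [x], which has none, and the neutral
     value is excluded from the set outright. *)
  exists x => c z c0 tc zroot.
  have [_ S2] := master m (g c); case: (S2.1 _ c (erefl _)); last by exists z.
  case=> te /bounded_searchP; case: tc => // xe /(_ _ xe) [y].
  exact: Hx.
(* Induction on [N]: to exclude also the value of code [N], if there is one, the colouring is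
   refined by one from [gcol]. A pair of colours is coded as [col x + l * col' x]. *)
- elim=> [|N [l [col [coll colP]]]]; first by exists 1%N, (fun=> 0%N); split=>
  // *; right.
  case: (pselect (exists2 n, n <> n0 & enc n = N)) => [[n nn0 nN]|noN].
    have [l' [col' [coll' colP']]] := gcol n nn0.
    exists (l * l')%N, (fun x => col x + l * col' x)%N; split=> [x|x y x0 y0].
      by have := coll x; have := coll' x; nia.
    have [cx cy] := (coll x, coll y) => E.
    have l0 : (0 < l)%N by apply: leq_ltn_trans cx.
    have E1 : col x = col y.
      have := congr1 (modn^~ l) E.
      by rewrite /= ![(l * _)%N]mulnC !(addnC (col _)) !modnMDl !modn_small.
    have E2 : col' x = col' y by move: E; rewrite E1 => /addnI/eqP;
      rewrite eqn_pmul2l // => /eqP.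
    have := colP' x y x0 y0 E2; case: (colP x y x0 y0 E1) => [|h nE];
      first by left.
    right; rewrite ltn_neqAle h andbT -nN; apply/eqP => /enc_inj/esym.
    exact: nE.
  exists l, col; split=> // x y x0 y0 E.
  case: (colP x y x0 y0 E) => [|h]; first by left.
  case: (pselect (g (x / y) = n0)) => [->|ne]; first by left.
  right; rewrite ltn_neqAle h andbT; apply/eqP => NE; apply: noN.
  by exists (g (x / y)).
- by rewrite g1.
have [a [d [d0 bE]]] := fracP b.
have a0 : a != 0 by apply: contraNneq b0 => a0; rewrite bE a0 tofrac0 mul0r.
have gX c i : c != 0 -> g c = n0 -> g (c ^+ i) = n0.
  move=> c0 gc; elim: i => [|i IH]; first by rewrite expr0.
  rewrite exprS -[c ^+ i]invrK; apply: (gker) => //;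
    rewrite ?invr_eq0 ?expf_neq0 //.
  by rewrite -[_^-1]mul1r; apply: (gker); rewrite ?oner_neq0 ?expf_neq0.
(* With [b = a / d], one of [a] and [d] has the required property: if [a ^ i] and [d ^ j] both had
   neutral value, so would [b ^ (i * j)]. *)
case: (pselect (forall i, (0 < i)%N -> g (a%:F ^+ i) <> n0)) => [H|].
  by exists a => // i /H H' /enc_inj.
move=> /existsNP[i /not_implyP[i0 /contrapT gi]].
exists d => // j j0 /enc_inj gj; apply: (bpow (i * j)%N).
  by rewrite muln_gt0 i0.
rewrite bE expr_div_n; apply: (gker); rewrite ?expf_neq0 ?tofrac_eq0 //.
  by rewrite exprM; apply: (gX); rewrite ?expf_neq0 ?tofrac_eq0.
by rewrite mulnC exprM; apply: (gX); rewrite ?expf_neq0 ?tofrac_eq0.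
Qed.

End Settings.

Lemma code_int_inj : injective code_int.
Proof.
move=> [a|a] [b|b] /= E; try by move: (congr1 odd E); rewrite /= !odd_double.
  by rewrite (double_inj E).
by case: E => /double_inj->.
Qed.

Lemma code_rat_inj : injective code_rat.
Proof.
move=> x y /Cantor.to_nat_inj[/code_int_inj En /code_int_inj Ed].
by rewrite -(divq_num_den x) -(divq_num_den y) En Ed.
Qed.

(** * Colourings of the rationals that avoid a given quotient *)

Section LogarithmColoring.
Local Open Scope ring_scope.

Lemma floor_log (a x : rat) : 1 < a -> 0 < x ->
  exists i : int, a ^ i <= x < a ^ (i + 1).
Proof.
move=> a1 x0; have a0 : 0 < a by apply: lt_trans a1.
have pow y : exists n : nat, y < a ^+ n.
  have [n Hn] : exists n : nat, y < n%:R * (a - 1).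
    exists (Num.truncn (y / (a - 1))).+1.
    by rewrite -ltr_pdivrMr ?subr_gt0 // truncnS_gt.
  exists n; apply: lt_le_trans Hn _.
  elim: n => [|n IH]; first by rewrite mul0r.
  rewrite exprS; have : 1 <= a ^+ n by rewrite exprn_ege1 // ltW.
  by move: IH; rewrite -natr1; nra.
have least y : 1 <= y -> exists n : nat, a ^+ n <= y < a ^+ n.+1.
  move=> y1; have [n Hn nmin] := ex_minnP (pow y).
  case: n Hn nmin => [|n] Hn nmin; first by move: Hn; rewrite expr0 ltNge y1.
  exists n; rewrite Hn andbT leNgt; apply/negP => /nmin.
  by rewrite ltnn.
case: (leP 1 x) => [/least[n Hn]|x1].
  by exists n%:Z; rewrite -PoszD addn1.
have [|n /andP[H1 H2]] := least x^-1; first by rewrite ltW ?invf_gt1.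
have an m : 0 < a ^+ m by rewrite exprn_gt0.
case: (eqVneq (a ^+ n) x^-1) => [E|ne].
  have -> : x = a ^ (- n%:Z) by rewrite -exprnN E invrK.
  by exists (- n%:Z); rewrite lexx ltr_eXz2l // ltrDl.
exists (- n.+1%:Z); have -> : - n.+1%:Z + 1 = - n%:Z by lia.
rewrite -!exprnN -[x]invrK; apply/andP; split.
  by rewrite lef_pV2 ?posrE ?invr_gt0 // ltW.
by rewrite ltf_pV2 ?posrE ?invr_gt0 // lt_neqAle ne H1.
Qed.

Lemma floor_log_succ (a x : rat) (i j : int) : 1 < a ->
  a ^ i <= x < a ^ (i + 1) -> a ^ j <= a * x < a ^ (j + 1) -> j = i + 1.
Proof.
move=> a1 /andP[i1 i2] /andP[j1 j2].
have a0 : 0 < a by apply: lt_trans a1.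
have E (m : int) : a ^ (m + 1)
  = a * a ^ m by rewrite expfzDr ?gt_eqF // expr1z mulrC.
have h1 : j < i + 1 + 1.
  by rewrite -(ltr_eXz2l a1) E; apply: le_lt_trans j1 _; rewrite ltr_pM2l.
have h2 : i + 1 < j + 1.
  by rewrite -(ltr_eXz2l a1) E; apply: le_lt_trans j2; rewrite ler_pM2l.
by lia.
Qed.

(** For positive [n], the colour is the parity of the integer part of the logarithm of [|x|] in base
    [n] or [1 / n], which changes under multiplication by the base; for negative [n], it is the
    sign; the quotient 0 never occurs. *)
Lemma rat_coloring (n : rat) : n != 1 -> exists l (chi : rat -> nat),
  (forall x, (chi x < l)%N) /\
  forall x y, x != 0 -> y != 0 -> chi x = chi y -> x / y <> n.
Proof.
case: (ltrgt0P n) => [n0|n0|->] n1.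
- pose a := if 1 < n then n else n^-1.
  have a1 : 1 < a.
    rewrite /a; case: ifP => // /negbT; rewrite -leNgt le_eqVlt (negPf n1)
      /= => h.
    by rewrite invf_gt1.
  have /choice[fl Hfl] : forall x : rat, exists i : int, x != 0 ->
    a ^ i <= `|x| < a ^ (i + 1).
    move=> x; case: (eqVneq x 0) => [->|x0]; first by exists 0.
    have x0' : 0 < `|x| by rewrite normr_gt0.
    by have [i Hi] := floor_log a1 x0'; exists i.
  have step x y : x != 0 -> y != 0 -> x = a * y ->
      `|(fl x %% 2)%Z|%N = `|(fl y %% 2)%Z|%N -> False.
    move=> x0 y0 xy; have := Hfl x x0.
    have -> : `|x| = a * `|y| by rewrite xy normrM (gtr0_norm (lt_trans _ a1)).
    move=> Hx.
    have := floor_log_succ a1 (Hfl y y0) Hx; move: (fl x) (fl y) => i j ->.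
    by lia.
  exists 2, (fun x => `|(fl x %% 2)%Z|%N); split.
    by move=> x; move: (fl x) => i; lia.
  move=> x y x0 y0 E xy; have {}xy : x = n * y by rewrite -xy divfK.
  move: (step); rewrite /a; case: ifP => _ h; first exact: (h x y).
  apply: (h y x) => //; rewrite xy mulrA mulVf ?mul1r //.
  by rewrite gt_eqF.
- exists 2, (fun x => nat_of_bool (0 < x)); split=> [x|x y x0 y0 E xy].
    by case: (_ < _).
  have {}xy : x = n * y by rewrite -xy divfK.
  move: E; rewrite xy nmulr_rgt0 //.
  by case: (ltrgt0P y) y0 => // _ _; rewrite eqxx.
exists 1%N, (fun=> 0%N); split=> // x y x0 y0 _ /eqP.
by rewrite mulf_eq0 invr_eq0 (negPf x0) (negPf y0).
Qed.

End LogarithmColoring.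

(** * The additive and the multiplicative case *)

Section AdmitsData.
Local Open Scope ring_scope.
Variables (R : idomainType) (C : computable_idomain R).

Lemma admits_reduction_data (A : set nat) : Pi2 A ->
  admits_master_polynomials C ->
  exists k p f t t0, @reduction_data R C A k p f t t0.
Proof.
move=> /Pi2P[chi rchi AE] [adm|adm].
  have [k [p [f [g [cf _ [g0 gM gsurj] master]]]]] :=
    adm _ (Sigma1_bounded_search code_int (code_int 0) rchi).
  have g1 : g 1 = 0.
    by apply: (addrI (g 1)); rewrite addr0 -gM ?oner_neq0 // mulr1.
  have gV a : a != 0 -> g a^-1 = - g a.
    move=> a0; apply: (addrI (g a)).
    by rewrite -gM ?invr_eq0 // mulfV // g1 subrr.
  exists k, p, f, (code_int \o g), (code_int 0).
  apply: (reduction_data_exists AE cf master code_int_inj g1).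
  - by move=> a b a0 b0 ga gb; rewrite gM ?invr_eq0 // gV // ga gb.
  - have [b b0 gb] := gsurj 1; exists b => // i i0.
    have -> : g (b ^+ i) = i%:Z; last by case: i i0.
    elim: i {i0} => [|i IH]; first by rewrite expr0.
    by rewrite exprS gM ?expf_neq0 // IH gb; lia.
  (* Adding [n] to [g y] increases the quotient by [n] by exactly 1, hence changes its parity. *)
  move=> n /eqP n0; exists 2, (fun x => `|((g x %/ n)%Z %% 2)%Z|%N); split.
    by move=> x; move: (g x %/ n)%Z => i; lia.
  move=> x y x0 y0 E gxy.
  have gx : g x = 1 * n + g y.
    by move: gxy; rewrite gM ?invr_eq0 // gV //; lia.
  by move: E; rewrite gx divzMDl //; move: (g y %/ n)%Z => i; lia.
have [k [p [f [g [cf _ [g0 gn0 gM gsurj] master]]]]] :=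
  adm _ (Sigma1_bounded_search code_rat (code_rat 1) rchi).
have g1 : g 1 = 1.
  apply: (mulIf (gn0 1 (oner_neq0 _))).
  by rewrite -gM ?oner_neq0 // mulr1 mul1r.
have gV a : a != 0 -> g a^-1 = (g a)^-1.
  move=> a0; apply: (mulIf (gn0 a a0)).
  by rewrite -gM ?invr_eq0 // mulVf // mulVf ?gn0.
exists k, p, f, (code_rat \o g), (code_rat 1).
apply: (reduction_data_exists AE cf master code_rat_inj g1).
- by move=> a b a0 b0 ga gb; rewrite gM ?invr_eq0 // gV // ga gb divr1.
- have [|b b0 gb] := gsurj 2%:R; first by [].
  exists b => // i i0.
  have -> : g (b ^+ i) = 2%:R ^+ i.
    elim: i {i0} => [|i IH]; first by rewrite expr0.
    by rewrite !exprS gM ?expf_neq0 // IH gb.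
  by apply/eqP; rewrite gt_eqF // exprn_egt1 // -lt0n.
move=> n /eqP n1; have [l [col [coll colP]]] := rat_coloring n1.
exists l, (col \o g); split=> [x|x y x0 y0 E] //=;
  rewrite gM ?invr_eq0 // gV //.
by apply: colP => //; apply: gn0.
Qed.

End AdmitsData.

(** Consecutive blocks of length [#|A| %/ q]; the successor in the bound accounts for the
    remainder. *)
Lemma disjoint_chunks (T : choiceType) (A : {fset T}) q : 0 < q ->
  exists C : nat -> {fset T},
    (forall i, i < q -> (C i `<=` A)%fset /\ #|` A| < q * (#|` C i|).+1) /\
    forall i j x, x \in C i -> x \in C j -> i = j.
Proof.
move=> q0; pose S := enum_fset A; pose s := size S %/ q.
have US : uniq S by exact: fset_uniq.
exists (fun i => [fset x in take s (drop (i * s) S)]%fset); split=> [i iq|].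
  split; first by apply/fsubsetP => x; rewrite inE => /mem_take/mem_drop.
  rewrite card_fseq undup_id ?take_uniq ?drop_uniq // size_takel.
    by rewrite mulnC; apply: ltn_ceil.
  rewrite size_drop leq_subRL; last first.
    by apply: leq_trans (leq_divM (size S) q);
      rewrite mulnC leq_mul2l ltnW ?orbT.
  by apply: leq_trans (leq_divM (size S) q);
    rewrite -mulSnr mulnC leq_mul2l iq orbT.
suff H i x : x \in take s (drop (i * s) S) -> i = index x S %/ s.
  by move=> i j x; rewrite !inE => /H-> /H->.
case/(nthP x) => j; rewrite size_take_min leq_min => /andP[js jd] <-.
rewrite nth_take // nth_drop index_uniq ?US //; last by move: jd;
  rewrite size_drop ltn_subRL.
by rewrite divnMDl ?divn_small ?addn0 //; apply: leq_ltn_trans js.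
Qed.

Lemma computable_idomain_infinite (R : idomainType) (C : computable_idomain R) :
  infinite_type R.
Proof.
move=> N; exists [fset phi_inv C (nat_of_ord i) | i in 'I_N]%fset.
rewrite card_imfset ?cardE /= ?size_enum_ord // => i j /(can_inj (phi_invK C)).
exact: val_inj.
Qed.

(** * Colourings without roots, and roots in dense sets or in cells *)

Section Reduction.
Local Open Scope classical_set_scope.
Local Open Scope ring_scope.
Variables (Rr : realType) (R : idomainType) (C : computable_idomain R).
Local Notation K := {fraction R}.
Local Notation "x %:F" := (@tofrac R x).
Variables (A : set nat) (k : nat) (p : {mpoly R[k.+2]}) (f : nat -> R).
Variables (t : K -> nat) (t0 : nat).
Hypothesis data : reduction_data C A p f t t0.

Let n := (4 + (k + k))%N.

(** The colouring of the fraction field is restricted to the ring: [x] and [y] in one cell make the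
    value at [x / y] neutral or of large code, where the master polynomial has no root at all. *)
Lemma nonroot_partition (Delta : {mpoly R[n]}) m : ~ A m ->
  exists l (P : 'I_l -> set R), nonzero_partition P /\
    forall i v, (forall j, P i (v j)) -> Delta.@[v] != 0 ->
      (homogenized p Delta (f m)).@[v] != 0.
Proof.
move=> /(data_noroot data)[N HN]; have [l [chi [chil chiP]]] :=
  data_coloring data N.
exists l, (fun i => [set x : R | x != 0 /\ chi x%:F = i]); split.
  split; last by move=> i j _ _ [x [[_ xi] [_ xj]]]; apply/val_inj;
    rewrite /= -xi -xj.
  apply/seteqP; split=> [x [i _ []]|x x0] //.
  by exists (Ordinal (chil x%:F)).
move=> i v Pv d0; have [[x0 xi] [y0 yi]] :=
  (Pv (ix_base k 0), Pv (ix_base k 1)).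
rewrite homogenizedE //; apply/eqP; apply: HN.
  by rewrite mulf_neq0 ?invr_eq0 ?tofrac_eq0.
by apply: chiP; rewrite ?tofrac_eq0 // xi yi.
Qed.

Lemma homogenized_root (Delta : {mpoly R[n]}) m (v : 'I_n -> R) (z :
  k.-tuple K) :
  v (ix_base k 1) != 0 -> Delta.@[v] != 0 ->
  frac_root p (f m)%:F ((v (ix_base k 0))%:F / (v (ix_base k 1))%:F) z ->
  (forall j, (v (ix_u j) - v (ix_v j))%:F / (Delta.@[v])%:F = tnth z j) ->
  (homogenized p Delta (f m)).@[v] = 0.
Proof.
move=> y0 d0 zroot zE; apply/eqP; rewrite homogenizedE //; apply/eqP.
rewrite (_ : [tuple _ | j < k] = z) //.
by apply: eq_from_tnth => j; rewrite tnth_mktuple.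
Qed.

(** Coordinates of a root grouped by role: [inl] for [x] and [y], [inr (ord0, _)] for the pair [w],
    [t], and [inr (lift ord0 j, _)] for the pair [u_j], [v_j]. *)
Definition point_index := (bool + 'I_k.+1 * bool)%type.

Definition point_ix (i : 'I_n) : point_index :=
  match split i with
  | inl a => nth (inl true) [:: inl true; inl false; inr (ord0, true);
    inr (ord0, false)] a
  | inr c => match split c with
             | inl j => inr (lift ord0 j, true)
             | inr j => inr (lift ord0 j, false)
             end
  end.

Lemma point_ix_base (a : 'I_4) : point_ix (ix_base k a) =
  nth (inl true) [:: inl true; inl false; inr (ord0, true);
    inr (ord0, false)] a.
Proof. by rewrite /point_ix (unsplitK (inl a)). Qed.

Lemma point_ix_u (j : 'I_k) : point_ix (ix_u j) = inr (lift ord0 j, true).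
Proof. by rewrite /point_ix (unsplitK (inr _)) (unsplitK (inl j)). Qed.

Lemma point_ix_v (j : 'I_k) : point_ix (ix_v j) = inr (lift ord0 j, false).
Proof. by rewrite /point_ix (unsplitK (inr _)) (unsplitK (inr j)). Qed.

Lemma point_ix_inj : injective point_ix.
Proof.
pose inv (q : point_index) : 'I_n :=
  match q with
  | inl b => ix_base k (if b then 0 else 1)
  | inr (l, b) =>
      if unlift ord0 l is Some j then if b then ix_u j else ix_v j
      else ix_base k (if b then 2 else 3)
  end.
apply: (can_inj (g := inv)) => i; rewrite -(splitK i).
case: (split i) => [a|c].
  rewrite [unsplit _]/(ix_base k a) point_ix_base.
  case: a => -[|[|[|[|l]]]] hl //=; rewrite ?unlift_none; congr (ix_base k _);
    exact/val_inj.
rewrite -(splitK c); case: (split c) => j.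
  by rewrite -/(ix_u j) point_ix_u /= liftK.
by rewrite -/(ix_v j) point_ix_v /= liftK.
Qed.

Lemma power_inj (r : R) (i j : nat) : r != 0 ->
  (forall i, (0 < i)%N -> t (r%:F ^+ i) <> t0) -> r ^+ i = r ^+ j -> i = j.
Proof.
move=> r0 rt; suff H a b : (a < b)%N -> r ^+ a <> r ^+ b.
  by case: (ltngtP i j) => // /H h E; case: h.
move=> ab E; apply: (rt (b - a)%N); first by rewrite subn_gt0.
have : r ^+ (b - a) = 1.
  apply: (mulfI (expf_neq0 a r0)); rewrite -exprD subnKC ?mulr1 //; exact: ltnW.
by move/(congr1 (fun x : R => x%:F)); rewrite tofracXn tofrac1 => ->;
  exact: data_one data.
Qed.

Lemma frac_powers (c r : R) (i j : nat) : c != 0 -> r != 0 -> (i < j)%N ->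
  (c * r ^+ j)%:F / (c * r ^+ i)%:F = r%:F ^+ (j - i).
Proof.
move=> c0 r0 ij; rewrite -{1}(subnKC (ltnW ij)) exprD mulrA tofracM mulrC.
rewrite mulrA mulVf ?mul1r ?tofracXn //.
by rewrite tofrac_eq0 mulf_neq0 ?expf_neq0.
Qed.

Lemma dense_pair (B : set R) F e : folner Rr F -> frequently_dense F B e ->
  exists x y, [/\ B x, B y, x != 0, y != 0 & t (x%:F / y%:F) <> t0].
Proof.
move=> Ff FB; have [r r0 rt] := data_power data.
(* With [2 * e + 1] powers of [r], a proportion [1 / (2 * e)] means at least two of them, and their
   quotient is a positive power of [r] or its inverse. *)
pose Phi := [fset r ^+ nat_of_ord i | i in 'I_(2 * e).+1]%fset.
have [|c c0 cPhi] := folner_dense_translate (A := Phi) Ff FB.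
  by apply/imfsetP => -[i /= _ /eqP]; rewrite eq_sym expf_eq0 (negPf r0) andbF.
pose D := [fset a in Phi | c * a \in B]%fset.
have cD : (1 < #|` D|)%N.
  move: cPhi; rewrite card_imfset ?cardE /= ?size_enum_ord; last first.
    by move=> i j /= E; apply/val_inj/(power_inj r0 rt E).
  rewrite -/D; case: #|` D| => [|[|d]] //; first by rewrite muln0.
  by rewrite muln1 ltnn.
have [a aD] : exists a, a \in D by apply/fset0Pn; rewrite -cardfs_gt0 ltnW.
have [a'] : exists a', a' \in (D `\ a)%fset.
  by apply/fset0Pn; rewrite -cardfs_gt0; move: cD; rewrite (cardfsD1 a) aD.
move: aD; rewrite !inE /= => /andP[/imfsetP[i _ ->] /set_mem iB].
case/and3P=> ne /imfsetP[j _ jE] /set_mem; move: ne; rewrite jE => ne jB {jE}.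
have c0' q : c * r ^+ q != 0 by rewrite mulf_neq0 ?expf_neq0.
have key q q' : (q < q')%N -> t ((c * r ^+ q')%:F / (c * r ^+ q)%:F) <> t0.
  by move=> qq; rewrite frac_powers //; apply: rt; rewrite subn_gt0.
case: (ltngtP i j) => ij; last by rewrite ij eqxx in ne.
  by exists (c * r ^+ j), (c * r ^+ i); split=> //; apply: key.
by exists (c * r ^+ i), (c * r ^+ j); split=> //; apply: key.
Qed.

Definition injective_denominator : {mpoly R[n]} :=
  'X_(ix_base k 2) - 'X_(ix_base k 3).

Lemma IMDR_homogenized m : A m ->
  IMDR Rr (homogenized p injective_denominator (f m)).
Proof.
move=> Am B /density_gt0P[F [e [Ff e0 FB]]].
have [x [y [xB yB x0 y0 txy]]] := dense_pair Ff FB.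
have b0 : x%:F / y%:F != 0 by rewrite mulf_neq0 ?invr_eq0 ?tofrac_eq0.
have [z z0 zroot] := data_root data Am b0 txy.
have xy : x != y.
  by apply/eqP => E; apply: txy; rewrite E divff ?tofrac_eq0 //;
    exact: data_one data.
have [d d0 dz] := common_denominator z.
have /choice[a aE] : forall j, exists a, tnth z j = a%:F / d%:F.
  by move=> j; apply: dz; exact: mem_tnth.
(* That the root has nonzero coordinates is what keeps [u_j] and [v_j] distinct. *)
have an0 j : a j != 0.
  by apply: contraNneq (z0 j) => E; rewrite aE E tofrac0 mul0r.
pose qs := d :: [seq a j | j <- enum 'I_k].
have sqs : size qs = k.+1 by rewrite /= size_map size_enum_ord.
have qs_lift (j : 'I_k) : qs`_(lift ord0 j) = a j.
  by rewrite lift0 /= (nth_map j) ?size_enum_ord // nth_ord_enum.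
have qs0 (l : 'I_k.+1) : qs`_l != 0.
  by case: (unliftP ord0 l) => [j ->|->]; rewrite ?qs_lift.
(* Of the proportion [1 / (2 * e)] of [A0], at most two points are lost to avoid [x] and [y], and at
   most [k] to rounding in the [k + 1] chunks. Once [A0] has [4 * e * (k + 2)] points, this loss
   costs at most half of [A0], so each chunk keeps a proportion [1 / (4 * e * (k + 1))]. *)
have e'0 : (0 < 4 * e * k.+1)%N by rewrite !muln_gt0 e0.
have Rinf := computable_idomain_infinite C.
have [A0 [T [A00 A0N T0 HA]]] := additive_recurrence Rinf qs (4 * e * k.+2) e'0.
have [c c0 cA] := folner_dense_translate Ff FB A00.
pose S := [fset s in A0 | c * s \in B]%fset.
pose S' := [fset s in S | c * s \notin [fset x; y]%fset]%fset.
have SS' : (#|` S| <= #|` S'| + 2)%N.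
  have -> : #|` S| = #|` [fset c * s | s in S]%fset|.
    by rewrite [RHS]card_imfset //; exact: (mulfI c0).
  have -> : #|` S'| = #|` [fset c * s | s in S']%fset|.
    by rewrite [RHS]card_imfset //; exact: (mulfI c0).
  apply: leq_trans (_ : #|` ([fset (c * s)%R | s in S'] `|` [fset x;
    y])%fset| <= _)%N.
    apply/fsubset_leq_card/fsubsetP => _ /imfsetP[q /= qS ->].
    rewrite in_fsetU; case: (boolP (c * q \in [fset x; y]%fset)) => [|nq].
      by rewrite orbT.
    by apply/orP; left; apply/imfsetP; exists q => //; move: qS nq;
      rewrite !inE /= => -> ->.
  apply: leq_trans (leq_card_fsetU _ _) _; rewrite leq_add2l cardfs2.
  by case: (x != y).
(* One chunk for each pair of coordinates: disjointness makes coordinates of different pairs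
   distinct. *)
have [D [DP Ddisj]] := disjoint_chunks S' (ltn0Sn k).
have DS i : (i < k.+1)%N -> {subset D i <= S'} by move=> /DP[/fsubsetP].
have S'B q : q \in S' -> [/\ q \in A0, B (c * q), c * q != x & c * q != y].
  by rewrite !inE /= negb_or => /andP[/andP[-> /set_mem ?] /andP[-> ->]].
have [|rho rhoT Hrho] := HA D.
  move=> i; rewrite sqs => ik; have [_ cD] := DP i ik; split.
    by apply/fsubsetP => q /(DS i ik)/S'B[].
  move: cA A0N SS' cD; rewrite -/S.
  move: #|` A0| #|` S| #|` S'| #|` D i| => a1 a2 a3 a4 h1 h2 h3 h4.
  have h5 : (e * a2 <= e * (k.+1 * a4) + e * k.+2)%N.
    by rewrite -mulnDr leq_mul2l; apply/orP; right; move: h4; rewrite mulnS;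
      lia.
  move: h1 h2 h5; rewrite -!mulnA.
  by move: (e * (k.+1 * a4))%N (e * k.+2)%N (e * a2)%N => y1 y2 y3; lia.
have rho0 : rho != 0 by apply: contraNneq T0 => <-.
have /choice[u uP] : forall l : 'I_k.+1, exists u,
    exists v, [/\ u \in D l, v \in D l & u - v = qs`_l * rho].
  by move=> l; apply: Hrho; rewrite sqs.
have /choice[v vP] := uP.
pose val_ix (q : point_index) : R :=
  match q with
  | inl b => if b then x else y
  | inr (l, b) => c * (if b then u l else v l)
  end.
have uvS (l : 'I_k.+1) (b : bool) : (if b then u l else v l) \in D l.
  by have [? ? _] := vP l; case: b.
have val_inj' : injective val_ix.
  have nxy l b b' : c * (if b then u l else v l) <> if b' then x else y.
    have /(DS l (ltn_ord l))/S'B[_ _ /eqP nx /eqP ny] := uvS l b.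
    by case: b'.
  move=> [b|[l b]] [b'|[l' b']] /=.
  - by case: b; case: b' => // E; move: xy; rewrite E eqxx.
  - by move/esym/nxy.
  - by move/nxy.
  move/(mulfI c0) => E; have El : l = l'.
    by apply/val_inj/(Ddisj _ _ _ (uvS l b)); rewrite E; exact: uvS.
  move: E; rewrite -El; have [_ _ uv] := vP l.
  have nuv : u l <> v l.
    by move=> E; move: (mulf_neq0 (qs0 l) rho0); rewrite -uv E subrr eqxx.
  by case: b; case: b' => // /esym.
pose w i := val_ix (point_ix i).
have wB i : B (w i).
  rewrite /w; case: (point_ix i) => [[]|[l b]] //=.
  by have /(DS l (ltn_ord l))/S'B[] := uvS l b.
have wd : injective_denominator.@[w] = c * (d * rho).
  rewrite mevalB !mevalXU /w !point_ix_base /= -mulrBr.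
  by have [_ _ ->] := vP ord0.
apply/has_root_flagT; exists w; split=> //.
  by move=> _ i j /val_inj'/point_ix_inj.
have c0' : c%:F != 0 by rewrite tofrac_eq0.
have rho0' : rho%:F != 0 by rewrite tofrac_eq0.
apply: (homogenized_root (z := z)).
- by rewrite /w point_ix_base.
- by rewrite wd !mulf_neq0.
- by rewrite /w !point_ix_base.
move=> j; rewrite wd /w point_ix_u point_ix_v /= -mulrBr.
have [_ _ ->] := vP (lift ord0 j); rewrite qs_lift aE !tofracM.
by rewrite -mulf_div divff // mul1r -mulf_div divff // mulr1.
Qed.

Lemma PR_homogenized m : A m -> PR (homogenized p 'X_(ix_base k 2) (f m)).
Proof.
move=> Am l P [Pcov Pdisj].
have cov x : x != 0 -> exists i, P i x.
  move=> x0; have [i _ Pi] : (\bigcup_i P i) x by rewrite Pcov.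
  by exists i.
have Pn0 i x : P i x -> x != 0.
  by move=> Px; have : (\bigcup_i P i) x by [exists i]; rewrite Pcov.
(* Only mixed cells can provide [x] and [y]. A pair and a root are fixed for each of them
   beforehand, since the cell delivered by [finite_brauer] is not known yet; [d] is a common
   denominator for all of them. *)
pose mixed i := exists x y, [/\ P i x, P i y & t (x%:F / y%:F) <> t0].
have /choice[w wP] : forall i, exists w : R * R * k.-tuple K, mixed i ->
    [/\ P i w.1.1, P i w.1.2 & frac_root p (f m)%:F (w.1.1%:F / w.1.2%:F) w.2].
  move=> i; case: (pselect (mixed i)) => [[x [y [Px Py txy]]]|nmi].
    have b0 : x%:F / y%:F != 0.
      by rewrite mulf_neq0 ?invr_eq0 ?tofrac_eq0 ?(Pn0 i).
    have [z _ zroot] := data_root data Am b0 txy.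
    by exists (x, y, z).
  by exists (0, 0, [tuple 0 | _ < k]) => /nmi.
have [d d0 dz] :=
  common_denominator (flatten [seq tval (w i).2 | i <- enum 'I_l]).
have /choice[a aE] : forall q : 'I_l * 'I_k,
  exists a, tnth (w q.1).2 q.2 = a%:F / d%:F.
  move=> q; apply: dz; apply/flattenP; exists (tval (w q.1).2);
    last exact: mem_tnth.
  by apply/mapP; exists q.1; rewrite ?mem_enum.
have [F F0 HF] := finite_brauer (computable_idomain_infinite C) (codom a) l d0.
have Fn0 x : x \in F -> x != 0 by move=> xF; apply: contraNneq F0 => <-.
have [r r0 rt] := data_power data.
(* A cell that is not mixed contains at most one element of each progression [x * r ^ e], as the
   quotient of two of them would not be neutral. *)
have /choice[N HN] : forall q : 'I_l * R, exists N, ~ mixed q.1 -> q.2 != 0 ->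
    forall e, (N <= e)%N -> ~ P q.1 (q.2 * r ^+ e).
  move=> [i x] /=.
  case: (pselect (exists e, P i (x * r ^+ e))) => [[e Pe]|nP]; last first.
    by exists 0%N => _ _ e _ Pe; apply: nP; exists e.
  exists e.+1 => nmi x0 e' ee' Pe'; apply: nmi.
  exists (x * r ^+ e'), (x * r ^+ e); split=> //.
  by rewrite frac_powers //; apply: rt; rewrite subn_gt0.
(* Dilation by [r ^ M] moves all of [F] into mixed cells; [chi] colours [F] by the cell of the
   dilate. *)
pose M := (\max_(i < l) \max_(x <- F) N (i, x))%N.
have HM i x : x \in F -> P i (x * r ^+ M) -> mixed i.
  move=> xF Px; apply: contrapT => nmi; apply: (HN (i, x) nmi (Fn0 x xF) M) =>
    //.
  apply: leq_trans (leq_bigmax (F := fun i => \max_(x <- F) N (i, x))%N i).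
  exact: (leq_bigmax_seq (F := fun x => N (i, x)) x xF).
have /choice[chi chiP] : forall x, exists i : nat, x != 0 ->
    exists il : (i < l)%N, P (Ordinal il) (x * r ^+ M).
  move=> x; case: (eqVneq x 0) => [_|x0]; first by exists 0%N.
  have [|[i il] Pi] := cov (x * r ^+ M); first by rewrite mulf_neq0 ?expf_neq0.
  by exists i; exists il.
have [|s [s0 dsF sP]] := HF chi.
  by move=> x /Fn0/chiP[].
have [il Pds] := chiP _ (Fn0 _ dsF); pose i := Ordinal il.
have Pi x : x \in F -> chi x = chi (d * s) -> P i (x * r ^+ M).
  move=> /Fn0/chiP[il' Px] xE; have -> : i = Ordinal il' by apply/val_inj;
    rewrite /= -xE.
  exact: Px.
have [Px Py zroot] := wP i (HM i _ dsF Pds).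
have /choice[u /choice[v uvP]] : forall j,
  exists u v, [/\ P i (u * r ^+ M), P i (v * r ^+ M) &
    u - v = a (i, j) * s].
  move=> j; have [u [v [uF vF uc vc uv]]] := sP _ (codom_f a (i, j)).
  by exists u, v; split=> //; apply: Pi.
(* The pair of index [ord0] takes the value of [w] twice, so that [t] stays in the cell as well. *)
pose val_ix (q : point_index) : R :=
  match q with
  | inl b => if b then (w i).1.1 else (w i).1.2
  | inr (q, b) => if unlift ord0 q is Some j then
                    (if b then u j else v j) * r ^+ M
                  else d * s * r ^+ M
  end.
have rM0 : r ^+ M != 0 by rewrite expf_neq0.
have wd : ('X_(ix_base k 2) : {mpoly R[n]}).@[fun q => val_ix (point_ix q)] =
    d * s * r ^+ M.
  by rewrite mevalXU point_ix_base /= unlift_none.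
exists i; exists (fun q => val_ix (point_ix q)).
  move=> q; case: (point_ix q) => [[]|[q' b]] //=.
  by case: (unlift ord0 q') => [j|]; [have [] := uvP j; case: b|exact: Pds].
apply: (homogenized_root (z := (w i).2)).
- by rewrite point_ix_base /=; apply: (Pn0 i).
- by rewrite wd !mulf_neq0.
- by rewrite !point_ix_base.
move=> j; rewrite wd point_ix_u point_ix_v /= !liftK -mulrBl.
have [_ _ ->] := uvP j; rewrite (aE (i, j))
  /= -[a (i, j) * s * _]mulrA -[d * s * _]mulrA.
rewrite !tofracM -mulf_div divff ?mulr1 //.
by rewrite mulf_neq0 ?tofrac_eq0.
Qed.

End Reduction.

(** * Universality *)

Lemma IMDR_IPR (Rr : realType) (R : idomainType) (C : computable_idomain R) n
    (p : {mpoly R[n]}) : IMDR Rr p -> IPR p.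
Proof.
move=> Hp l P [Pcov _].
have [x x0|i Pi] := @density_cover Rr R (phi_inv C) l P (enumC C).
  have [i _ Pi] : (\bigcup_i P i)%classic x by rewrite Pcov.
  by exists i.
by exists i; apply: Hp.
Qed.

Section Universality.
Local Open Scope ring_scope.
Variables (Rr : realType) (R : idomainType) (C : computable_idomain R).
Hypothesis master : admits_master_polynomials C.

Lemma homogenized_reducible (A : set nat) k (p : {mpoly R[k.+2]}) f t t0
    (data : reduction_data C A p f t t0) Delta
    (Q : forall n, {mpoly R[n]} -> Prop) :
  (forall m, A m <-> Q _ (homogenized p Delta (f m))) ->
  computably_reducible A (code_set C Q).
Proof.
move=> AQ; have [L LE] := homogenized_sparse p Delta.
exists (fun m => sparse_code C (4 + (k + k)) L (f m)); last first.
  by move=> m; rewrite code_set_sparse -LE.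
have rf : @recursive _ _ _ (rep_ring C) f by exists (fun m => phi C (f m));
  first exact: data_computable data.
exact: recursive_computable (rec_sparse_code _ L rf).
Qed.

Lemma base_homog n (i : 'I_n) : ('X_i : {mpoly R[n]}) \is 1.-homog.
Proof. by rewrite dhomogX /= mdeg1. Qed.

(** One reduction serves every class [Q] in this range: its values lie in [IMDR] when [m] is in [A],
    and outside [IPR] otherwise. *)
Lemma between_IMDR_IPR_universal (Q : forall n, {mpoly R[n]} -> Prop) :
  (forall n (p : {mpoly R[n]}), homogeneous p -> IMDR Rr p -> Q n p) ->
  (forall n (p : {mpoly R[n]}), Q n p -> IPR p) -> Pi2_universal (code_set C Q).
Proof.
move=> IQ QI A PA; have [k [p [f [t [t0 data]]]]] :=
  admits_reduction_data PA master.
apply: (homogenized_reducible data (Delta := injective_denominator R k)) => m;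
  split.
  move=> Am; apply: IQ; last exact: IMDR_homogenized data _ Am.
  by apply: homogenized_homog; apply: rpredB; apply: base_homog.
move=> /QI Hq; apply: contrapT => nA.
have [l [P [Ppart HP]]] := nonroot_partition data (injective_denominator R k)
  nA.
have [i [v [vi vP v0]]] := Hq l P Ppart.
(* Injectivity of the root is what makes the denominator [w - t] nonzero. *)
have dn0 : (injective_denominator R k).@[v] != 0.
  rewrite mevalB !mevalXU subr_eq0; apply/eqP => /vi/lshift_inj.
  by [].
by have := HP i v vP; rewrite v0 eqxx => /(_ dn0).
Qed.

Lemma between_PR_universal (Q : forall n, {mpoly R[n]} -> Prop) :
  (forall n (p : {mpoly R[n]}), homogeneous p -> PR p -> Q n p) ->
  (forall n (p : {mpoly R[n]}), Q n p -> PR p) -> Pi2_universal (code_set C Q).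
Proof.
move=> IQ QI A PA; have [k [p [f [t [t0 data]]]]] :=
  admits_reduction_data PA master.
apply: (homogenized_reducible data (Delta := 'X_(ix_base k 2))) => m; split.
  move=> Am; apply: IQ; last exact: PR_homogenized data _ Am.
  by apply: homogenized_homog; apply: base_homog.
move=> /QI Hq; apply: contrapT => nA.
have [l [P [Ppart HP]]] := nonroot_partition data 'X_(ix_base k 2) nA.
have [i [v vP v0]] := Hq l P Ppart.
(* The denominator [w] is nonzero because the cells consist of nonzero elements. *)
have vn0 : v (ix_base k 2) != 0.
  have [Pcov _] := Ppart; have : (\bigcup_i P i)%classic (v (ix_base k 2))
    by exists i.
  by rewrite Pcov.
by have := HP i v vP; rewrite mevalXU v0 eqxx => /(_ vn0).
Qed.

End Universality.

Theorem theorem4p3 (Rr : realType) (R : idomainType)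
    (C : computable_idomain R) :
  admits_master_polynomials C ->
  let IMDR_H := code_set C (mpolyI (@IMDR Rr R) (@homogeneous R)) in
  let PR_H := code_set C (mpolyI (@PR R) (@homogeneous R)) in
  let PR_all := code_set C (@PR R) in
  let IPR_H := code_set C (mpolyI (@IPR R) (@homogeneous R)) in
  let IPR_all := code_set C (@IPR R) in
  [/\ Pi2_complete IMDR_H,
      [/\ Pi2_complete PR_H, Pi2_complete PR_all,
          Pi2_complete IPR_H & Pi2_complete IPR_all] &
      [/\ Pi2_universal IMDR_H, Pi2_universal PR_H, Pi2_universal PR_all,
          Pi2_universal IPR_H & Pi2_universal IPR_all]].
Proof.
move=> master IMDR_H PR_H PR_all IPR_H IPR_all.
have U1 : Pi2_universal IMDR_H.
  apply: (between_IMDR_IPR_universal (Rr := Rr) master) => n p; first by split.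
  by case=> /(IMDR_IPR C).
have U2 : Pi2_universal PR_H.
  by apply: (between_PR_universal master) => n p; [split|case].
have U3 : Pi2_universal PR_all by apply: (between_PR_universal master).
have U4 : Pi2_universal IPR_H.
  apply: (between_IMDR_IPR_universal (Rr := Rr) master) => n p; last by case.
  by move=> hp /(IMDR_IPR C); split.
have U5 : Pi2_universal IPR_all.
  apply: (between_IMDR_IPR_universal (Rr := Rr) master) => // n p _.
  exact: IMDR_IPR.
have P1 : Pi2 IMDR_H.
  apply: (Pi2_homogeneous (C := C) (rec_IMDR_check C)) => c; last by move=> [].
  by move=> hc; rewrite -(IMDR_checkP Rr hc); split=> [[]|].
have P2 : Pi2 PR_H.
  apply: (Pi2_homogeneous (C := C) (rec_PR_check C false)) => c; last by move=>
    [].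
  by move=> hc; rewrite -PR_checkP -PR_flagE; split=> [[]|].
have P3 : Pi2 PR_all.
  by apply: (Pi2_PR_flag (C := C) (inj := false)) => c; rewrite -PR_flagE.
have P4 : Pi2 IPR_H.
  apply: (Pi2_homogeneous (C := C) (rec_PR_check C true)) => c; last by move=>
    [].
  by move=> hc; rewrite -PR_checkP -IPR_flagE; split=> [[]|].
have P5 : Pi2 IPR_all.
  by apply: (Pi2_PR_flag (C := C) (inj := true)) => c; rewrite -IPR_flagE.
by split; [|split|split]; try exact: Pi2_universal_complete.
Qed.
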